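(* Let $d\geq 2$. For any $g\in \mathrm{GL}_d(\mathbb{R})$ there is a constant $c=c(g)>0$ such that for all $T\geq 2$ $$\int_{U_d(\mathbb{Z})\backslash U_d(\mathbb{R})}|\mathcal{R}_{B_T}(\mathbb{Z}^d u g)|^2\,du\leq c\,T^{d-1}\log^2(T),$$ where $du$ is Lebesgue measure on $U_d(\mathbb{R})\cong \mathbb{R}^{d(d-1)/2}$.
   Context: $U_d<\mathrm{GL}_d$ is the group of unipotent upper triangular matrices (ones on the diagonal), with real or integer entries for $U_d(\mathbb{R})$, $U_d(\mathbb{Z})$ respectively; the entries above the diagonal identify $U_d(\mathbb{R})$ with $\mathbb{R}^{d(d-1)/2}$, and the integral over the quotient is over a fundamental domain, e.g. all above-diagonal entries in $[0,1)$. Vectors are row vectors, and $\mathbb{Z}^d h=\{nh: n\in\mathbb{Z}^d\}$ for $h\in \mathrm{GL}_d(\mathbb{R})$. $B_T=\{v\in\mathbb{R}^d:\|v\|<T\}$ is the Euclidean ball of radius $T$ centered at the origin. For a lattice $\Lambda\subset\mathbb{R}^d$, $$\mathcal{R}_{B_T}(\Lambda)=\#(\Lambda\cap B_T)-\frac{\mathrm{vol}(B_T)}{\mathrm{vol}(\mathbb{R}^d/\Lambda)}.$$ (The function $u\mapsto \mathcal{R}_{B_T}(\mathbb{Z}^dug)$ is left $U_d(\mathbb{Z})$-invariant.) *)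

(* Defs.v *)
From HB Require Import structures.
From mathcomp Require Import all_boot all_order all_algebra.
From mathcomp Require Import finmap.
From mathcomp Require Import all_classical all_reals all_analysis.

Set Implicit Arguments.
Unset Strict Implicit.
Unset Printing Implicit Defensive.

Import Order.TTheory GRing.Theory Num.Theory.
Import numFieldNormedType.Exports.

Local Open Scope classical_set_scope.
Local Open Scope ring_scope.

Section lebesgue_step.
Variables (R : realType) (n : nat).
Local Notation RM := (measurableTypeR R).
Variable m : {sigma_finite_measure set (n.-tuple RM) -> \bar R}.

Definition pair_cons (p : RM * n.-tuple RM) : n.+1.-tuple RM :=
  [the n.+1.-tuple RM of p.1 :: p.2].

Lemma measurable_pair_cons : measurable_fun [set: RM * n.-tuple RM] pair_cons.
Proof. by apply: measurable_cons. Qed.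

Definition lebesgue_step : set (n.+1.-tuple RM) -> \bar R :=
  pushforward (@lebesgue_measure R \x m)%E pair_cons.

Let lebesgue_step0 : lebesgue_step set0 = 0%E.
Proof. by rewrite /lebesgue_step /pushforward preimage_set0 measure0. Qed.

Let lebesgue_step_ge0 A : (0 <= lebesgue_step A)%E.
Proof. by rewrite /lebesgue_step /pushforward measure_ge0. Qed.

Let lebesgue_step_sigma_additive : semi_sigma_additive lebesgue_step.
Proof.
move=> F mF tF mUF.
have mpre A : measurable A -> measurable (pair_cons @^-1` A).
  by move=> mA; rewrite -[X in measurable X]setTI; exact: measurable_pair_cons.
rewrite /lebesgue_step /pushforward preimage_bigcup.
apply: measure_semi_sigma_additive => [k||]; first exact: mpre.
- apply/trivIsetP => i j _ _ ij; rewrite -preimage_setI.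
  by move/trivIsetP : tF => /(_ _ _ _ _ ij) ->//; rewrite preimage_set0.
- by rewrite -preimage_bigcup; exact: mpre.
Qed.

HB.instance Definition _ := isMeasure.Build _ _ _ lebesgue_step
  lebesgue_step0 lebesgue_step_ge0 lebesgue_step_sigma_additive.

Lemma lebesgue_step_sigma_finite : sigma_finite setT lebesgue_step.
Proof.
have /sigma_finiteP[F [TF ndF Foo]] := sigma_finiteT (@lebesgue_measure R).
have /sigma_finiteP[G [TG ndG Goo]] := sigma_finiteT m.
pose uncons (t : n.+1.-tuple RM) : RM * n.-tuple RM :=
  (thead t, [tuple of behead t]).
have unconsK : cancel uncons pair_cons.
  by move=> t; rewrite [RHS]tuple_eta; exact/val_inj.
have consK : cancel pair_cons uncons.
  by move=> [x t]; congr pair; exact/val_inj.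
have muncons : measurable_fun setT uncons.
  by apply/measurable_fun_pair; [exact: measurable_tnth|exact: measurable_behead].
exists (fun k => uncons @^-1` (F k `*` G k)).
  apply/esym; rewrite -subTset => t _.
  have [k1 _ Fk] : (\bigcup_i F i) (uncons t).1 by rewrite -TF.
  have [k2 _ Gk] : (\bigcup_i G i) (uncons t).2 by rewrite -TG.
  exists (maxn k1 k2) => //; split.
    by move: Fk; apply/subsetPset/ndF/leq_maxl.
  by move: Gk; apply/subsetPset/ndG/leq_maxr.
move=> k; have [mFk Fk] := Foo k; have [mGk Gk] := Goo k; split.
  by rewrite -[X in measurable X]setTI; apply: muncons => //; exact: measurableX.
rewrite /lebesgue_step /pushforward.
have -> : pair_cons @^-1` (uncons @^-1` (F k `*` G k)) = F k `*` G k.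
  rewrite -comp_preimage (_ : uncons \o pair_cons = id)//.
  by apply/funext => p; exact: consK.
by rewrite product_measure1E// lte_mul_pinfty// ge0_fin_numE.
Qed.

HB.instance Definition _ := @Measure_isSigmaFinite.Build _ _ _
  lebesgue_step lebesgue_step_sigma_finite.

End lebesgue_step.

(* Lebesgue measure on R^n, as the n-fold product of the Lebesgue measure on R,
   restricted to the Borel sets (see lebesgue_tuple_box). *)
Fixpoint lebesgue_tuple (R : realType) (n : nat) :
    {sigma_finite_measure set (n.-tuple (measurableTypeR R)) -> \bar R} :=
  match n with
  | 0 => dirac [tuple]
  | k.+1 => lebesgue_step (lebesgue_tuple R k)
  end.

Lemma lebesgue_tuple_box (R : realType) (n : nat)
    (A : 'I_n -> set (measurableTypeR R)) : (forall i, measurable (A i)) ->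
  lebesgue_tuple R n [set t | forall i, A i (tnth t i)] =
  (\prod_(i < n) lebesgue_measure (A i))%E.
Proof.
elim: n A => [|n IH] A mA.
  rewrite big_ord0 /= diracE mem_set//; by case.
rewrite big_ord_recl -IH// /= /lebesgue_step /pushforward.
rewrite -product_measure1E//; last first.
  rewrite (_ : mkset _ = \bigcap_(i in [set: 'I_n]) ((@tnth _ _)^~ i @^-1` A (lift ord0 i))).
    apply: fin_bigcap_measurable => // i _.
    by rewrite -[X in measurable X]setTI; exact: measurable_tnth.
  by apply/seteqP; split => t /= tA i; [move=> _; exact: tA|exact: tA].
congr (_ _); apply/seteqP; split => -[x t] /=.
  move=> tA; split; first exact: (tA ord0).
  by move=> i; have := tA (lift ord0 i); rewrite tnthS.
move=> [x0 tA] i; have [j ->|->] := unliftP ord0 i; last by [].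
by rewrite tnthS; exact: tA.
Qed.

(* Vectors are row vectors.  The norm `|v| that the library puts on 'rV[R]_d
   is the sup norm, hence the explicit Euclidean norm below. *)
Section lattices.
Variables (R : realType) (d : nat).
Implicit Types (A F L : set 'rV[R]_d) (v l : 'rV[R]_d).

Definition row_of_tuple (t : d.-tuple R) : 'rV[R]_d := \row_i tnth t i.

Definition measurable_rV A := measurable
  (row_of_tuple @^-1` A : set (d.-tuple (measurableTypeR R))).

Definition vol A : \bar R := lebesgue_tuple R d (row_of_tuple @^-1` A).

Definition euclidean_norm v : R := Num.sqrt (\sum_i v 0 i ^+ 2).

Definition euclidean_ball (T : R) : set 'rV[R]_d :=
  [set v | euclidean_norm v < T].

Definition lattice_of (h : 'M[R]_d) : set 'rV[R]_d :=
  [set map_mx intr n *m h | n in [set: 'rV[int]_d]].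

Definition fundamental_domain L F :=
  measurable_rV F /\ forall v, exists! l, L l /\ F (v - l).

(* All fundamental domains of a lattice have the same volume, so that the
   infimum is just a choice-free way of naming this common value. *)
Definition covolume L : R :=
  fine (ereal_inf [set vol F | F in fundamental_domain L]).

(* For a lattice L the set L `&` euclidean_ball T is finite and the volumes are
   finite, so that fset_set and fine do not lose anything. *)
Definition ball_discrepancy (T : R) L : R :=
  #|` fset_set (L `&` euclidean_ball T)|%:R
    - fine (vol (euclidean_ball T)) / covolume L.

End lattices.

Definition unipotent_mx (K : pzSemiRingType) (d : nat) : set 'M[K]_d :=
  [set u | (forall i, u i i = 1) /\ (forall i j : 'I_d, (j < i)%N -> u i j = 0)].

(* The entries above the diagonal are listed column by column: column j has j
   of them and is preceded by 0 + 1 + ... + (j - 1) = 'C(j, 2) entries; in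
   total there are 'C(d, 2) = d (d - 1) / 2 of them. *)
Definition unipotent_of_tuple (R : realType) (d : nat)
    (x : 'C(d, 2).-tuple R) : 'M[R]_d :=
  \matrix_(i, j) if i == j then 1
                 else if (i < j)%N then nth 0 x ('C(j, 2) + i) else 0.

Definition unit_cube (R : realType) (n : nat) : set (n.-tuple R) :=
  [set x | forall i, 0 <= tnth x i < 1].

(* The integral of a left-U_d(Z)-invariant function f over U_d(Z)\U_d(R),
   computed on the fundamental domain given by unit_cube
   (see unit_cube_fundamental). *)
Definition unipotent_quotient_integral (R : realType) (d : nat)
    (f : 'M[R]_d -> \bar R) : \bar R :=
  (\int[lebesgue_tuple R 'C(d, 2)]_(x in @unit_cube R 'C(d, 2))
     f (unipotent_of_tuple x))%E.

Section unipotent_coordinates.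
Variables (R : realType) (d : nat).

Let index_lt (i j : 'I_d) : (i < j)%N -> ('C(j, 2) + i < 'C(d, 2))%N.
Proof.
move=> ij; apply: (@leq_trans 'C(j.+1, 2)); last first.
  by apply: leq_bin2l.
by rewrite binS bin1 ltn_add2l.
Qed.

Let index_inj (i j i' j' : nat) : (i < j)%N -> (i' < j')%N ->
  ('C(j, 2) + i = 'C(j', 2) + i')%N -> (i, j) = (i', j').
Proof.
have aux k k' l l' : (k < l)%N -> (l < l')%N -> ('C(l, 2) + k < 'C(l', 2) + k')%N.
  move=> kl ll'; apply: (@leq_trans 'C(l.+1, 2)).
    by rewrite binS bin1 ltn_add2l.
  by apply: leq_trans (leq_addr _ _); apply: leq_bin2l.
move=> ij ij' e; have [jj'|jj'|jj'] := ltngtP j j'.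
- by have := aux i i' _ _ ij jj'; rewrite e ltnn.
- by have := aux i' i _ _ ij' jj'; rewrite e ltnn.
- by move: e; rewrite jj' => /addnI ->.
Qed.

Let index_surj k : (k < 'C(d, 2))%N ->
  exists p : 'I_d * 'I_d, (p.1 < p.2)%N /\ k = ('C(p.2, 2) + p.1)%N.
Proof.
suff H n : (k < 'C(n, 2))%N -> exists i j, [/\ (i < j)%N, (j < n)%N &
    k = ('C(j, 2) + i)%N].
  move=> /H[i [j [ij jd ->]]].
  by exists (Ordinal (ltn_trans ij jd), Ordinal jd).
elim: n => // n IH; rewrite binS bin1 => kn.
have [/IH[i [j [ij jn ->]]]|nk] := ltnP k 'C(n, 2).
  by exists i, j; split => //; exact: ltnW.
by exists (k - 'C(n, 2))%N, n; split; rewrite ?subnKC// ltn_subLR// addnC.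
Qed.

Lemma unipotent_of_tuple_bij :
  set_bij setT (@unipotent_mx R d) (@unipotent_of_tuple R d).
Proof.
split.
- move=> x _; split=> [i|i j ji]; rewrite mxE ?eqxx//.
  by rewrite -val_eqE/= gtn_eqF// ltnNge ltnW.
- move=> x y _ _ /matrixP xy; apply: eq_from_tnth => k.
  have [[i j]/= [ij ke]] := index_surj (ltn_ord k).
  have := xy i j; rewrite !mxE -val_eqE/= ltn_eqF// ij.
  by rewrite !(tnth_nth 0) ke.
- move=> u [u1 u0].
  have /choice[f fP] (k : 'I_('C(d, 2))) := index_surj (ltn_ord k).
  exists [tuple u (f k).1 (f k).2 | k < 'C(d, 2)] => //.
  apply/matrixP => i j; rewrite mxE; case: eqP => [->//|/eqP ij].
  case: ltnP => [lij|lji]; last first.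
    by rewrite u0// ltn_neqAle lji andbT eq_sym.
  pose k := Ordinal (index_lt lij).
  rewrite -[('C(j, 2) + i)%N]/(val k) -tnth_nth tnth_mktuple.
  have [fk /= ke] := fP k.
  have [e1 e2] := index_inj lij fk ke.
  by congr (u _ _); apply: val_inj.
Qed.

Lemma unipotent_mul (n : 'M[int]_d) (u : 'M[R]_d) :
  unipotent_mx n -> unipotent_mx u -> unipotent_mx (map_mx intr n *m u).
Proof.
move=> [n1 n0] [u1 u0]; split=> [i|i j ji]; rewrite mxE.
  rewrite (bigD1 i)//= mxE n1 u1 mulr1 big1 ?addr0// => k; rewrite mxE -val_eqE/=.
  by case: ltngtP => // ki _; [rewrite n0 ?mul0r|rewrite u0 ?mulr0].
rewrite big1// => k _; rewrite mxE; have [ki|ik] := ltnP k i.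
  by rewrite n0// mul0r.
by rewrite u0 ?mulr0//; exact: leq_trans ji ik.
Qed.

Let row_exists (u : 'M[R]_d) (i : 'I_d) : unipotent_mx u ->
  exists c : 'I_d -> int, [/\ c i = 1, forall j : 'I_d, (j < i)%N -> c j = 0 &
    forall j : 'I_d, (i < j)%N -> 0 <= \sum_k (c k)%:~R * u k j < 1].
Proof.
move=> [u1 u0].
suff H m : exists c : 'I_d -> int, [/\ c i = 1, forall j : 'I_d, (j < i)%N -> c j = 0 &
    forall j : 'I_d, (i < j < m)%N -> 0 <= \sum_k (c k)%:~R * u k j < 1].
  have [c [c1 c0 cP]] := H d; exists c; split => // j ij.
  by apply: cP; rewrite ij ltn_ord.
elim: m => [|m [c [c1 c0 cP]]].
  exists (fun j => (j == i)%:R); split; rewrite ?eqxx// => j ji.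
    by rewrite -val_eqE/= ltn_eqF.
  by rewrite ltn0 andbF in ji.
have [im|mi] := ltnP i m; last first.
  exists c; split => // j /andP[ij]; rewrite ltnS => jm.
  by have := leq_trans ij (leq_trans jm mi); rewrite ltnn.
have [md|dm] := ltnP m d; last first.
  exists c; split => // j /andP[ij _]; apply: cP; rewrite ij/=.
  exact: leq_trans (ltn_ord j) dm.
pose jm := Ordinal md.
pose a := Num.floor (\sum_k (c k)%:~R * u k jm).
pose c' k := c k - (k == jm)%:R * a.
have sumc' j : \sum_k (c' k)%:~R * u k j =
    \sum_k (c k)%:~R * u k j - a%:~R * u jm j.
  rewrite (bigD1 jm)//= [in RHS](bigD1 jm)//= /c' eqxx mul1r rmorphB/= mulrBl.
  rewrite addrAC; congr (_ + _ - _); apply: eq_bigr => k /negbTE ->.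
  by rewrite mul0r subr0.
exists c'; split.
- by rewrite /c' -val_eqE/= ltn_eqF// mul0r subr0.
- move=> j ji; rewrite /c' -val_eqE/= ltn_eqF ?mul0r ?subr0 ?c0//.
  exact: ltn_trans ji im.
- move=> j /andP[ij]; rewrite ltnS leq_eqVlt sumc' => /orP[/eqP jmE|ltjm].
    have -> : j = jm by exact: val_inj.
    have /andP[fl flt] := floor_itv (\sum_k (c k)%:~R * u k jm).
    by rewrite u1 mulr1 subr_ge0 fl/= ltrBlDl; rewrite intrD in flt.
  by rewrite (u0 jm j)// mulr0 subr0; apply: cP; rewrite ij.
Qed.

Lemma unit_cube_fundamental (u : 'M[R]_d) : unipotent_mx u ->
  exists! n : 'M[int]_d, unipotent_mx n /\
    exists2 x, unit_cube x & unipotent_of_tuple x = map_mx intr n *m u.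
Proof.
move=> uu; have [u1 u0] := uu.
have /choice[c cP] := fun i => row_exists i uu.
pose n := \matrix_(i, j) c i j.
have nu : unipotent_mx n.
  by split=> [i|i j ji]; rewrite mxE; have [c1 c0 _] := cP i; [|exact: c0].
have nE i j : (map_mx intr n *m u) i j = \sum_k (c i k)%:~R * u k j.
  by rewrite mxE; apply: eq_bigr => k _; rewrite !mxE.
exists n; split.
  split => //.
  have [_ _ surj] := unipotent_of_tuple_bij.
  have [x _ xE] := surj _ (unipotent_mul nu uu).
  exists x => //= k; have [[i j]/= [ij ke]] := index_surj (ltn_ord k).
  have := nE i j; rewrite -xE mxE -val_eqE/= ltn_eqF// ij -ke -tnth_nth => ->.
  by have [_ _] := cP i; exact.
move=> n' [nu' [x xc xE]]; have [n1' n0'] := nu'; have [n1 n0] := nu.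
apply/matrixP => i j.
have [m] := ubnP (val j); elim: m j => // m IH j; rewrite ltnS => jm.
have [ij|ji|ij] := ltngtP i j; last first.
- by have -> : i = j :> 'I_d; [exact: val_inj|rewrite n1 n1'].
- by rewrite n0 ?n0'.
have fE (p : 'M[int]_d) : (map_mx intr p *m u) i j =
    (p i j)%:~R + \sum_(k < d | (k < j)%N) (p i k)%:~R * u k j.
  rewrite mxE (bigD1 j)//= mxE u1 mulr1; congr (_ + _).
  rewrite big_mkcond [RHS]big_mkcond; apply: eq_bigr => k _.
  rewrite mxE -val_eqE/=; case: ltngtP => //= jk.
  by rewrite (u0 k j)// mulr0.
have sE : \sum_(k < d | (k < j)%N) (n i k)%:~R * u k j =
    \sum_(k < d | (k < j)%N) (n' i k)%:~R * u k j.
  by apply: eq_bigr => k kj; rewrite IH//; exact: leq_trans kj jm.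
have : 0 <= (map_mx intr n *m u) i j < 1.
  by rewrite nE; have [_ _] := cP i; exact.
have : 0 <= (map_mx intr n' *m u) i j < 1.
  rewrite -xE mxE -val_eqE/= ltn_eqF// ij.
  by have := xc (Ordinal (index_lt ij)); rewrite (tnth_nth 0).
rewrite !fE sE; set s := \sum_(k < d | _) _.
move=> /andP[a b] /andP[a' b'].
have lt1 (y z : int) : 0 <= y%:~R + s -> z%:~R + s < 1 -> z <= y.
  move=> h1 h2; rewrite -ltzD1 -(ltr_int R) intrD.
  by rewrite -(ltrD2r s) (lt_le_trans h2)// addrAC lerDr.
by apply/eqP; rewrite eq_le !lt1.
Qed.

End unipotent_coordinates.

(* Main.v *)
From HB Require Import structures.
From mathcomp Require Import all_boot all_order all_algebra.
From mathcomp Require Import finmap.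
From mathcomp Require Import all_classical all_reals all_analysis.
From mathcomp Require Import measurable_realfun ring lra.
Require Import Defs.

Set Implicit Arguments.
Unset Strict Implicit.
Unset Printing Implicit Defensive.

Import Order.TTheory GRing.Theory Num.Theory.
Import numFieldNormedType.Exports.

Local Open Scope classical_set_scope.
Local Open Scope ring_scope.

(** Completing squares, |y g|^2 is a sum of squares
    (kap_j (y_j + sum_(i < j) nu_ij y_i))^2 ([norm_cholesky]).  For y = n u with n
    integral, y_j is n_j + sum_(i < j) n_i u_ij: column j of u does not enter before
    the j-th square, and it enters that square through the value of the linear form
    (n_0, ..., n_(j-1)) on the column.  The lattice points of the ball are therefore
    enumerated one coordinate at a time, and the columns are integrated one after the
    other.

    Let M_j be the sum, over the integers n_0, ..., n_(j-1), of the suitably normalized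
    volumes of the sections of the ball on which the first j coordinates take these
    values ([fibre_sum]).  Then M_0 = vol / covol, M_d is the number of lattice points,
    and the discrepancy is the sum of the differences M_(j+1) - M_j.
    Such a difference is a sum over n in Z^j of errors [chord_err] made when an
    integral of (1 - t^2)^(k/2), k = d - j - 1, is replaced by a Riemann sum over
    Z + x, where x is n.c plus a shift that does not involve the column c.  This error
    has period 1 in x, and its sum over the shifts x + i / a, i < a, is O(T^(k/2))
    uniformly in a, because these shifts add up to one sum over a grid that is a times
    finer ([chord_err_average], from [window_arch]).

    Let F and G be two functions of this kind, with bound K, and n, m in Z^j.  If some
    vector v has n.v in Z and m.v in 1/a + Z, then translation by multiples of v shows
    that the mean of F(n.c) G(m.c) over the column c is at most K^2 / a
    ([mean_pair]).  When n and m are not proportional, or only one of them is zero,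
    every a is possible and the mean vanishes; when n = a p and m = b p with a and b
    coprime, it is at most K^2 / max(|a|, |b|) ([pair_cases]).  Summing over the O(T^j)
    vectors p of the ball and their multiples, with K^2 = O(T^(d-j-1)), the mean square
    of M_(j+1) - M_j is O(T^(d-1) log T) ([second_moment], [column_moment]), and
    [iterated_moment] adds up the columns.  The result, of order T^(d-1) log T, is at
    most a constant times T^(d-1) log^2 T for T >= 2.

    That M_0 is the main term of the discrepancy, whatever fundamental domain defines
    the covolume, follows from the cruder pointwise estimate M_d - M_0 = O(T^(d-1))
    for all translates of the lattice ([fibre_sum_dist]): its integral over a
    fundamental domain determines the volume of the latter ([covolume_of_count]). *)

(** * Profiles of balls *)

Section profile.
Variable R : realType.
Implicit Types (p : {poly R}) (f : R -> R).

Definition arch (t : R) : R := Num.sqrt (1 - t ^+ 2).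

(** The section at height t of a unit ball of dimension k + 1 has volume proportional to
    arch t ^+ k.  The polynomial factor makes this family of functions stable under
    differentiation. *)
Definition profile p k (t : R) : R := p.[t] * arch t ^+ k.

Lemma arch_ge0 t : 0 <= arch t. Proof. exact: sqrtr_ge0. Qed.

Lemma arch_out t : 1 <= `|t| -> arch t = 0.
Proof.
move=> t1; apply: ler0_sqrtr; rewrite subr_le0 -real_normK ?num_real//.
by rewrite exprn_ege1.
Qed.

Lemma sqr_arch t : `|t| <= 1 -> arch t ^+ 2 = 1 - t ^+ 2.
Proof.
move=> t1; rewrite sqr_sqrtr// subr_ge0 -real_normK ?num_real//.
by rewrite exprn_ile1.
Qed.

Lemma arch_gt0 t : `|t| < 1 -> 0 < arch t.
Proof.
move=> t1; rewrite sqrtr_gt0 subr_gt0 -real_normK ?num_real//.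
by rewrite exprn_ilt1.
Qed.

Lemma arch_le1 t : arch t <= 1.
Proof. by rewrite -sqrtr1 ler_sqrt// gerBl sqr_ge0. Qed.

Lemma profile_out p k t : 1 <= `|t| -> profile p k.+1 t = 0.
Proof. by move=> t1; rewrite /profile arch_out// expr0n mulr0. Qed.

Lemma continuous_arch : continuous arch.
Proof.
move=> t; apply: continuous_comp; last exact: sqrt_continuous.
by apply: cvgB; [exact: cvg_cst|exact: exprn_continuous].
Qed.

Lemma continuous_profile p k : continuous (profile p k).
Proof.
move=> t; apply: cvgM; first exact: continuous_horner.
apply: (@continuous_comp _ _ _ arch (fun x => x ^+ k)).
  exact: continuous_arch.
exact: exprn_continuous.
Qed.

(** An exponent of at least 3 makes up for the singularity of the square root at 0, so
    that the formula holds on the whole line, with Num.sqrt vanishing on negative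
    numbers. *)
Lemma is_derive_sqrtX k (a : R) :
  is_derive a 1 (fun x : R => Num.sqrt x ^+ k.+3)
    (k.+3%:R / 2 * Num.sqrt a ^+ k.+1).
Proof.
have [a0|a0|<-] := ltgtP 0 a.
- have d := is_derive1_sqrt a0.
  have := is_deriveX k.+3 d; rewrite exprfctE => /trigger_derive; apply.
  have s0 : Num.sqrt a != 0 by rewrite gt_eqF// sqrtr_gt0.
  rewrite /GRing.scale/= (exprS _ k.+1); set s := Num.sqrt a in s0 *.
  by set e := s ^+ k.+1; field.
- rewrite ler0_sqrtr ?ltW// expr0n mulr0.
  have d0 : is_derive a 1 (cst 0 : R -> R) 0 by exact: is_derive_cst.
  apply: near_eq_is_derive d0; near=> x; rewrite /= ler0_sqrtr ?expr0n//; apply: ltW; near: x.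
  exact: lt_nbhsl.
- rewrite sqrtr0 expr0n mulr0.
  suff H : h^-1 *: ((Num.sqrt (h + 0) : R) ^+ k.+3 - Num.sqrt (0:R) ^+ k.+3) @[h --> (0:R)^'] --> (0:R).
    apply: DeriveDef.
      apply/cvg_ex; exists 0; move: H; under eq_fun do rewrite -[X in X + 0]mulr1.
      exact.
    rewrite /derive; apply/cvg_lim => //.
    by move: H; under eq_fun do rewrite -[X in X + 0]mulr1.
  apply: (@cvg_trans _ ((Num.sqrt h ^+ k.+1) @[h --> (0:R)^'])).
    apply: near_eq_cvg; near=> h.
    have h0 : h != 0 by near: h; exact: nbhs_dnbhs_neq.
    rewrite addr0 sqrtr0 expr0n/= subr0 /GRing.scale/=.
    have [h1|h1] := leP 0 h; last by rewrite ler0_sqrtr ?ltW// !expr0n/= mulr0.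
    by rewrite !exprS !mulrA -(mulrA h^-1) -expr2 sqr_sqrtr// mulVf// mul1r.
  have H : {for 0, continuous (fun h : R => Num.sqrt h ^+ k.+1)}.
    apply: (@continuous_comp _ _ _ (@Num.sqrt R) (fun x => x ^+ k.+1)).
      exact: sqrt_continuous.
    exact: exprn_continuous.
  apply: cvg_within_filter.
  by move: H; rewrite /prop_for/= /continuous_at sqrtr0 expr0n.
Unshelve. all: by end_near. Qed.

Lemma is_derive_1Bsqr (t : R) : is_derive t 1 (fun t : R => 1 - t ^+ 2) (- (2 * t)).
Proof.
have := is_deriveB (is_derive_cst (1:R) t (1:R)) (is_deriveX 2 (is_derive_id t (1:R))).
by move/trigger_derive; apply; rewrite /GRing.scale/= expr1; ring.
Qed.

(** The polynomial factor of the derivative of a profile; the exponent drops by two. *)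
Definition lower p k : {poly R} := p^`() * (1 - 'X ^+ 2) - k%:R *: ('X * p).

Lemma is_derive_profile p k (t : R) :
  is_derive t 1 (profile p k.+3) (profile (lower p k.+3) k.+1 t).
Proof.
have d1 := is_derive_1Bsqr t.
have d2 := @is_derive_sqrtX k (1 - t ^+ 2).
have d3 : is_derive t 1 (fun t => arch t ^+ k.+3)
    (- (2 * t) * (k.+3%:R / 2 * arch t ^+ k.+1)).
  have := @is_derive1_comp _ (fun x : R => Num.sqrt x ^+ k.+3) (fun t : R => 1 - t ^+ 2) t.
  by move/(_ _ _ d2 d1); rewrite mulrC.
have := is_deriveM (is_derive_poly p t) d3.
move/trigger_derive; apply.
rewrite /GRing.scale/= /profile /lower.
rewrite !(hornerD, hornerN, hornerM, hornerX, hornerZ, hornerXn, hornerC).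
have [t1|t1] := lerP 1 `|t|; first by rewrite arch_out// !expr0n/=; ring.
have -> : arch t ^+ k.+3 = (1 - t ^+ 2) * arch t ^+ k.+1.
  by rewrite -sqr_arch ?ltW// -exprD.
by field.
Qed.

(** The integral from -oo, which converges since f has compact support. *)
Lemma antiderivative f : continuous f -> (forall x, 1 <= `|x| -> f x = 0) ->
  exists Phi : R -> R, forall x : R, is_derive x 1 Phi (f x).
Proof.
move=> cf f0.
have int : (@lebesgue_measure R).-integrable setT (EFin \o f).
  have : (@lebesgue_measure R).-integrable `[(-1), 1] (EFin \o f).
    apply: continuous_compact_integrable; first exact: segment_compact.
    exact: continuous_subspaceT.
  rewrite integrable_mkcond//.
  congr (is_true (integrable _ _ _)); apply/funext => x /=; rewrite patchE; case: ifPn => //.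
  rewrite notin_setE/= in_itv/= => /negP; rewrite -ler_norml -ltNge => /ltW xx.
  by rewrite f0.
pose Phi y := (\int[@lebesgue_measure R]_(t in [set` Interval (BInfty R true) (BRight y)]) f t)%R.
exists Phi => x.
have xu : x < x + 1 by rewrite ltrDl.
have intx : (@lebesgue_measure R).-integrable
    [set` Interval (BInfty R true) (BRight (x + 1))] (EFin \o f).
  by apply: integrableS int.
have [d1 d2] : derivable Phi x 1 /\ derive1 Phi x = f x :=
  continuous_FTC1 xu intx (ltNyr _) (cf x).
by split; [exact: d1|rewrite -derive1E; exact: d2].
Qed.

End profile.

(** * Riemann sums of concave functions *)

Section grid.
Variable R : realType.
Implicit Types (f Phi : R -> R) (d x t : R).

Lemma mean_value f df (a b : R) : a <= b ->
  (forall x : R, is_derive x 1 f (df x)) ->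
  exists c, [/\ a <= c, c <= b & f b - f a = df c * (b - a)].
Proof.
move=> ab fd.
have cf : {within `[a, b], continuous f}.
  by apply: derivable_within_continuous => x _; apply: ex_derive.
have [c + ?] := MVT_segment ab (fun x _ => fd x) cf.
by rewrite in_itv/= => /andP[? ?]; exists c.
Qed.

Lemma is_derive_affine f (df : R) (a b t : R) :
  is_derive (a * (b + t)) 1 f df ->
  is_derive t 1 (fun t => f (a * (b + t))) (a * df).
Proof.
move=> fd; rewrite mulrC.
apply: (@is_derive1_comp _ f (fun t => a * (b + t))) => //.
have := is_deriveZ a (is_deriveD (is_derive_cst (b:R) t (1:R)) (is_derive_id t (1:R))).
by move/trigger_derive; apply; rewrite /GRing.scale/=; ring.
Qed.

(** Jumps by one at -1 and at 1: an error that occurs only in the cells meeting an end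
    of [-1, 1] is bounded by increments of this function, which telescope. *)
Definition edge_step (t : R) : R := (-1 <= t)%R%:R + (1 <= t)%R%:R.

Lemma edge_step_mono (x y : R) : x <= y -> edge_step x <= edge_step y.
Proof.
move=> xy; rewrite /edge_step; apply: lerD; rewrite ler_nat.
  by have [x1|//] := leP (-1) x; rewrite (le_trans x1).
by have [x1|//] := leP 1 x; rewrite (le_trans x1).
Qed.

(** The bound M near the ends serves for the cells of length d that stick out of
    [-1, 1], where concavity gives nothing. *)
Definition concave_bump f (d M : R) :=
  [/\ forall x : R, 0 <= f x,
      forall x : R, 1 <= `|x| -> f x = 0,
      forall x y s : R, -1 <= x <= 1 -> -1 <= y <= 1 -> 0 <= s <= 1 ->
        (1 - s) * f x + s * f y <= f ((1 - s) * x + s * y) &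
      forall x : R, 1 - d <= `|x| -> f x <= M].

Lemma concave_bump_edges f (d M : R) : 0 < d -> d <= 1 -> concave_bump f d M ->
  [/\ 0 <= d * M, forall x : R, x <= -1 + d -> f x <= M,
      forall x : R, 1 - d <= x -> f x <= M,
      forall x : R, x <= -1 -> f x = 0 & forall x : R, 1 <= x -> f x = 0].
Proof.
move=> d_gt0 d_le1 [f_ge0 f_out f_concave f_edge]; split.
- rewrite mulr_ge0 ?(ltW d_gt0)//.
  by apply: le_trans (f_ge0 1) (f_edge _ _); rewrite normr1; lra.
- by move=> x xd; apply: f_edge; rewrite ler0_norm; lra.
- by move=> x xd; apply: f_edge; rewrite ger0_norm; lra.
- by move=> x xd; apply: f_out; rewrite ler0_norm; lra.
- by move=> x xd; apply: f_out; rewrite ger0_norm; lra.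
Qed.

Section concave.
Variables (f Phi : R -> R).
Hypothesis dPhi : forall x : R, is_derive x 1 Phi (f x).

Lemma antiderivative_mono : (forall x : R, 0 <= f x) ->
  forall x y : R, x <= y -> Phi x <= Phi y.
Proof.
move=> f_ge0 x y xy; have [c [_ _]] := mean_value xy dPhi => e.
by rewrite -subr_ge0 e mulr_ge0// subr_ge0.
Qed.

(** A concave function lies above its chords, so the trapezoid rule underestimates its
    integral; only the cells at the ends need a correction. *)
Lemma trapezoid_concave (d M t : R) : 0 < d -> d <= 1 -> concave_bump f d M ->
  d * (f t + f (t + d)) / 2 <=
  Phi (t + d) - Phi t + d * M * (edge_step (t + d) - edge_step t).
Proof.
move=> d_gt0 d_le1 fb.
have [f_ge0 _ f_concave _] := fb.
have [dM0 f_left f_right f_le f_ge] := concave_bump_edges d_gt0 d_le1 fb.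
have Phi_mono := antiderivative_mono f_ge0.
have le_td : t <= t + d by rewrite lerDl ltW.
have P0 : 0 <= Phi (t + d) - Phi t by rewrite subr_ge0 Phi_mono.
have B0 : 0 <= edge_step (t + d) - edge_step t by rewrite subr_ge0 edge_step_mono.
have [t1|t1] := ltP t (-1).
  rewrite (f_le _ (ltW t1)) add0r.
  have [td1|td1] := ltP (t + d) (-1).
    by rewrite (f_le _ (ltW td1)); have := mulr_ge0 dM0 B0; lra.
  have fM : d * f (t + d) <= d * M by rewrite ler_pM2l// f_left; lra.
  have f0 : 0 <= d * f (t + d) by rewrite mulr_ge0// ltW.
  have B1 : 1 <= edge_step (t + d) - edge_step t.
    rewrite /edge_step td1 (leNgt (-1) t) t1 (leNgt 1 t) (_ : t < 1); last by lra.
    by rewrite addr0 subr0 lerDl ler0n.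
  have := ler_wpM2l dM0 B1; lra.
have [t2|t2] := leP (t + d) 1; last first.
  rewrite (f_ge _ (ltW t2)) addr0.
  have [t3|t3] := leP 1 t.
    by rewrite (f_ge _ t3); have := mulr_ge0 dM0 B0; lra.
  have fM : d * f t <= d * M by rewrite ler_pM2l// f_right; lra.
  have f0 : 0 <= d * f t by rewrite mulr_ge0// ltW.
  have B1 : 1 <= edge_step (t + d) - edge_step t.
    rewrite /edge_step t1 (leNgt 1 t) t3 (ltW t2) (_ : -1 <= t + d) ?addr0; last by lra.
    by rewrite addrK.
  have := ler_wpM2l dM0 B1; lra.
suff : d * (f t + f (t + d)) / 2 <= Phi (t + d) - Phi t.
  have := mulr_ge0 dM0 B0; lra.
(* Up to the constant Phi t, the integral over [t, t + s] of f minus its chord on [t, t + d]. *)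
pose g s := Phi (1 * (t + s)) - (s * f t + s ^+ 2 * ((f (t + d) - f t) / (2 * d))).
pose dg s := f (1 * (t + s)) - (f t + 2 * s * ((f (t + d) - f t) / (2 * d))).
have gd (s : R) : is_derive s 1 g (dg s).
  have D1 := @is_derive_affine Phi _ 1 t s (dPhi (1 * (t + s))).
  have D2 := is_deriveZ (f t) (is_derive_id s (1:R)).
  have D3 := is_deriveZ ((f (t + d) - f t) / (2 * d)) (is_deriveX 2 (is_derive_id s (1:R))).
  have := is_deriveB D1 (is_deriveD D2 D3).
  have -> : (fun t0 : R => Phi (1 * (t + t0))) - (f t *: id +
      ((f (t + d) - f t) / (2 * d)) *: id ^+ 2) = g.
    apply/funext => z; rewrite /g -[LHS]/(Phi (1 * (t + z)) - 
      (f t * z + (f (t + d) - f t) / (2 * d) * (z * z))).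
    rewrite expr2; ring.
  move/trigger_derive; apply.
  by rewrite /dg /GRing.scale/= expr1; ring.
have [c [c0 cd gc]] := mean_value (ltW d_gt0) gd.
suff : 0 <= dg c.
  move=> h; have : 0 <= g d - g 0 by rewrite gc mulr_ge0// subr0 ltW.
  rewrite /g !mul1r addr0 mul0r expr0n/= mul0r !addr0 subr0.
  have -> : d ^+ 2 * ((f (t + d) - f t) / (2 * d)) = d * (f (t + d) - f t) / 2.
    by field; rewrite gt_eqF.
  lra.
have := @f_concave t (t + d) (c / d).
have -> : (1 - c / d) * t + c / d * (t + d) = 1 * (t + c).
  by field; rewrite gt_eqF.
move=> H; rewrite /dg subr_ge0; apply: le_trans (H _ _ _).
- rewrite le_eqVlt; apply/orP; left; apply/eqP; field; by rewrite gt_eqF.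
- by apply/andP; split; lra.
- by apply/andP; split; lra.
- by rewrite divr_ge0 ?(ltW d_gt0)//= ler_pdivrMr// mul1r.
Qed.

(** A concave function lies below its tangents, so the midpoint rule overestimates its
    integral; only the cells at the ends need a correction. *)
Lemma midpoint_concave (d M t : R) : 0 < d -> d <= 1 -> concave_bump f d M ->
  Phi (t + d / 2) - Phi (t - d / 2) <=
  d * f t + d * M * (edge_step (t + d / 2) - edge_step (t - d / 2)).
Proof.
move=> d_gt0 d_le1 fb.
have [f_ge0 _ f_concave _] := fb.
have [dM0 f_left f_right f_le f_ge] := concave_bump_edges d_gt0 d_le1 fb.
have Phi_mono := antiderivative_mono f_ge0.
have le_td : t - d / 2 <= t + d / 2 by lra.
have B0 : 0 <= edge_step (t + d / 2) - edge_step (t - d / 2) by rewrite subr_ge0 edge_step_mono.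
have f0 : 0 <= d * f t by rewrite mulr_ge0// ltW.
have BM := mulr_ge0 dM0 B0.
have [c [c1 c2 ce]] := mean_value le_td dPhi.
have {}ce : Phi (t + d / 2) - Phi (t - d / 2) = d * f c by rewrite ce; lra.
have [t1|t1] := ltP (t - d / 2) (-1).
  rewrite ce.
  have [td1|td1] := ltP (t + d / 2) (-1); first by rewrite f_le; lra.
  have fM : d * f c <= d * M by rewrite ler_pM2l// f_left; lra.
  have B1 : 1 <= edge_step (t + d / 2) - edge_step (t - d / 2).
    rewrite /edge_step td1 (leNgt (-1) (t - _)) t1 (leNgt 1 (t - _)) (_ : t - d / 2 < 1); last by lra.
    by rewrite addr0 subr0 lerDl ler0n.
  have := ler_wpM2l dM0 B1; lra.
have [t2|t2] := leP (t + d / 2) 1; last first.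
  rewrite ce.
  have [t3|t3] := leP 1 (t - d / 2); first by rewrite f_ge; lra.
  have fM : d * f c <= d * M by rewrite ler_pM2l// f_right; lra.
  have B1 : 1 <= edge_step (t + d / 2) - edge_step (t - d / 2).
    rewrite /edge_step t1 (leNgt 1 (t - _)) t3 (ltW t2) (_ : -1 <= t + d / 2) ?addr0; last by lra.
    by rewrite addrK.
  have := ler_wpM2l dM0 B1; lra.
suff : Phi (t + d / 2) - Phi (t - d / 2) <= d * f t by lra.
(* The integral over [t - s, t + s] of f minus the constant f t. *)
pose g s := Phi (1 * (t + s)) - Phi ((-1) * (- t + s)) - 2 * f t * s.
pose dg s := f (1 * (t + s)) + f ((-1) * (- t + s)) - 2 * f t.
have gd (s : R) : is_derive s 1 g (dg s).
  have D1 := @is_derive_affine Phi _ 1 t s (dPhi (1 * (t + s))).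
  have D2 := @is_derive_affine Phi _ (-1) (- t) s (dPhi ((-1) * (- t + s))).
  have D3 := is_deriveZ (2 * f t) (is_derive_id s (1:R)).
  have := is_deriveB (is_deriveB D1 D2) D3; move/trigger_derive; apply.
  by rewrite /dg /GRing.scale/=; ring.
have d20 : 0 <= d / 2 by lra.
have [s [s0 sd gs]] := mean_value d20 gd.
suff h : dg s <= 0.
  have : g (d / 2) - g 0 <= 0 by rewrite gs mulr_le0_ge0// subr0.
  rewrite /g !mul1r !mulN1r !addr0 opprK mulr0 opprD opprK; lra.
have := @f_concave (t - s) (t + s) (1 / 2).
have -> : (1 - 1 / 2) * (t - s) + 1 / 2 * (t + s) = t by field.
move=> H; rewrite /dg mul1r mulN1r opprD opprK.
suff : (1 - 1 / 2) * f (t - s) + 1 / 2 * f (t + s) <= f t by lra.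
by apply: H; apply/andP; split; lra.
Qed.

End concave.
End grid.

Section grid_error.
Variable R : realType.
Implicit Types (f Phi : R -> R).

(** For f supported in [-1, 1], 0 <= x <= 1 and 1 + d <= d * N this is the sum of f over
    d (Z + x).  The range of i does not depend on x, so that it is a differentiable
    function of x. *)
Definition grid N (d : R) f (x : R) : R :=
  \sum_(i < N.*2) f (d * (i%:R - N%:R + x)).

Lemma antiderivative_out f Phi : (forall x : R, is_derive x 1 Phi (f x)) ->
  (forall x : R, 1 <= `|x| -> f x = 0) ->
  (forall x : R, 1 <= x -> Phi x = Phi 1) /\
  (forall x : R, x <= -1 -> Phi x = Phi (-1)).
Proof.
move=> dPhi f0; split=> x x1; have [c [c1 c2 e]] := mean_value x1 dPhi.
  by apply/eqP; rewrite -subr_eq0 e f0 ?mul0r// ger0_norm//; lra.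
by apply/esym/eqP; rewrite -subr_eq0 e f0 ?mul0r// ler0_norm//; lra.
Qed.

Lemma grid_telescope N (d x a : R) (G : R -> R) :
  \sum_(i < N.*2) (G (d * (i%:R - N%:R + x) + d + a) - G (d * (i%:R - N%:R + x) + a)) =
  G (d * (N%:R + x) + a) - G (d * (x - N%:R) + a).
Proof.
pose u i := G (d * (i%:R - N%:R + x) + a).
rewrite (eq_bigr (fun i : 'I_N.*2 => u i.+1 - u i)); last first.
  move=> i _; rewrite /u; congr (G _ - _); rewrite -natr1; ring.
rewrite -(big_mkord xpredT (fun i => u i.+1 - u i)) telescope_sumr//.
rewrite /u; congr (G _ - G _); last by ring.
by rewrite -addnn natrD; ring.
Qed.

(** The midpoint inequality summed over the cells centred at the grid points bounds the
    sum from below, the trapezoid inequality over the cells between them bounds it from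
    above, and both corrections telescope to at most two jumps of [edge_step]. *)
Lemma grid_concave f Phi N (d M x : R) : 0 < d -> d <= 1 -> concave_bump f d M ->
  (forall x : R, is_derive x 1 Phi (f x)) ->
  1 + d <= d * N%:R -> 0 <= x <= 1 ->
  `|d * grid N d f x - (Phi 1 - Phi (-1))| <= 2 * (d * M).
Proof.
move=> d0 d1 fb dPhi Nd /andP[x0 x1]; have [f_ge0 f_out _ f_edge] := fb.
have [Phi1 PhiN1] := antiderivative_out dPhi f_out.
have dM0 : 0 <= d * M.
  rewrite mulr_ge0 ?(ltW d0)//.
  by apply: le_trans (f_ge0 1) (f_edge _ _); rewrite normr1; lra.
have dx0 : 0 <= d * x by rewrite mulr_ge0// ltW.
have dx1 : d * x <= d by rewrite ger_pMr.
have B2 (a b : R) : edge_step b - edge_step a <= 2.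
  have : 0 <= edge_step a by rewrite addr_ge0.
  have : edge_step b <= 2.
    by rewrite /edge_step -natrD (ler_nat _ _ 2); case: (_ <= _); case: (_ <= _).
  lra.
have e1 : 1 <= d * (N%:R + x) by rewrite mulrDr; lra.
have e2 : d * (x - N%:R) <= -1 by rewrite mulrBr; lra.
rewrite ler_norml; apply/andP; split.
  pose G t := Phi t - d * M * edge_step t.
  have : G (d * (N%:R + x) + - (d / 2)) - G (d * (x - N%:R) + - (d / 2)) <= d * grid N d f x.
    rewrite -grid_telescope /grid mulr_sumr; apply: ler_sum => i _.
    have := midpoint_concave dPhi (d * (i%:R - N%:R + x)) d0 d1 fb.
    rewrite /G; set t := d * (i%:R - N%:R + x); have -> : t + d + - (d / 2) = t + d / 2 by field.
    lra.
  rewrite /G Phi1; last by rewrite mulrDr; lra.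
  rewrite (PhiN1 (d * (x - N%:R) + - (d / 2))); last by lra.
  have := ler_wpM2l dM0 (B2 (d * (x - N%:R) + - (d / 2)) (d * (N%:R + x) + - (d / 2))).
  lra.
pose G t := Phi t + d * M * edge_step t - d / 2 * f t.
have : d * grid N d f x <= G (d * (N%:R + x) + 0) - G (d * (x - N%:R) + 0).
  rewrite -grid_telescope /grid mulr_sumr; apply: ler_sum => i _.
  have := trapezoid_concave dPhi (d * (i%:R - N%:R + x)) d0 d1 fb.
  rewrite /G; set t := d * (i%:R - N%:R + x); rewrite !addr0.
  lra.
rewrite /G !addr0 (Phi1 _ e1) (PhiN1 _ e2) !f_out; last 2 first.
  by rewrite ler0_norm; lra.
  by rewrite ger0_norm; lra.
have := ler_wpM2l dM0 (B2 (d * (x - N%:R)) (d * (N%:R + x))).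
lra.
Qed.

Lemma is_derive_grid f df N (d x : R) : (forall x : R, is_derive x 1 f (df x)) ->
  is_derive x 1 (grid N d f) (d * grid N d df x).
Proof.
move=> fd; rewrite /grid mulr_sumr.
have -> : (fun x => \sum_(i < N.*2) f (d * (i%:R - N%:R + x))) =
  \sum_(i < N.*2) (fun x => f (d * (i%:R - N%:R + x))).
  by apply/funext => y; rewrite fct_sumE.
apply: is_derive_sum => i; exact: is_derive_affine.
Qed.

(** On average over x the Riemann sum equals the integral, so it does so for some x; the
    mean value theorem for the Riemann sum of an antiderivative finds this x. *)
Lemma grid_mean f Phi N (d : R) : (forall x : R, is_derive x 1 Phi (f x)) ->
  (forall x : R, 1 <= `|x| -> f x = 0) -> 0 < d -> 1 + d <= d * N%:R ->
  exists x, 0 <= x <= 1 /\ d * grid N d f x = Phi 1 - Phi (-1).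
Proof.
move=> dPhi f0 d0 Nd; have [Phi1 PhiN1] := antiderivative_out dPhi f0.
have [c [c0 c1]] := mean_value ler01 (fun x => is_derive_grid N d x dPhi).
rewrite subr0 mulr1 => e; exists c; rewrite c0 c1 -e; split=> //.
have -> : grid N d Phi 1 - grid N d Phi 0 = \sum_(i < N.*2)
   (Phi (d * (i%:R - N%:R + 0) + d + 0) - Phi (d * (i%:R - N%:R + 0) + 0)).
  rewrite /grid -sumrB; apply: eq_bigr => i _; congr (Phi _ - Phi _); ring.
rewrite grid_telescope !addr0 sub0r mulrN (Phi1 (d * N%:R)); last by lra.
by rewrite (PhiN1 (- _)); last by lra.
Qed.

(** The error vanishes for some x by [grid_mean]; elsewhere it is bounded by its
    derivative in x, which is d times the Riemann sum of f'. *)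
Lemma grid_lift f df Phi N (d E x : R) :
  (forall x : R, is_derive x 1 Phi (f x)) ->
  (forall x : R, is_derive x 1 f (df x)) ->
  (forall x : R, 1 <= `|x| -> f x = 0) -> 0 < d -> 1 + d <= d * N%:R ->
  (forall x, 0 <= x <= 1 -> `|d * grid N d df x| <= E) -> 0 <= x <= 1 ->
  `|d * grid N d f x - (Phi 1 - Phi (-1))| <= d * E.
Proof.
move=> dPhi fd f0 d0 Nd gE; have [y [+ <-]] := grid_mean dPhi f0 d0 Nd.
move=> + x01; wlog : x y x01 / x <= y => [H|].
  case: (leP x y) => [|/ltW] xy y01; first exact: H.
  by rewrite distrC; apply: H.
move=> xy y01; have [c [c0 c1 e]] := mean_value xy (fun x => is_derive_grid N d x fd).
rewrite distrC -mulrBr normrM (gtr0_norm d0) e normrM ler_pM2l//.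
case/andP : x01 => x0 _; case/andP : y01 => _ y1.
have h1 : `|d * grid N d df c| <= E by apply: gE; apply/andP; split; lra.
have E0 : 0 <= E by apply: le_trans h1.
apply: le_trans (_ : E * 1 <= _); last by rewrite mulr1.
by apply: ler_pM => //; rewrite ger0_norm; lra.
Qed.

End grid_error.

(** * Riemann sums of profiles *)

Section grid_profile.
Variable R : realType.
Implicit Types (p : {poly R}) (f Phi : R -> R).

(** The derivatives are given in the open interval only, since the square root has
    infinite slope at the ends. *)
Lemma concave_of_second_derivative f (f1 f2 : R -> R) : continuous f ->
  (forall x : R, `|x| < 1 -> is_derive x 1 f (f1 x)) ->
  (forall x : R, `|x| < 1 -> is_derive x 1 f1 (f2 x)) ->
  (forall x : R, `|x| < 1 -> f2 x <= 0) ->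
  forall x y s : R, -1 <= x <= 1 -> -1 <= y <= 1 -> 0 <= s <= 1 ->
    (1 - s) * f x + s * f y <= f ((1 - s) * x + s * y).
Proof.
move=> cf d1 d2 f2le0 x y s.
have mv (a b : R) : -1 <= a -> b <= 1 -> a < b ->
    exists c, [/\ a < c, c < b & f b - f a = f1 c * (b - a)].
  move=> a1 b1 ab.
  have fd (u : R) : u \in `]a, b[%R -> is_derive u 1 f (f1 u).
    by rewrite in_itv/= => /andP[au ub]; apply: d1; rewrite ltr_norml; apply/andP; split; lra.
  have [|c + e] := MVT ab fd; first exact: continuous_subspaceT.
  by rewrite in_itv/= => /andP[ac cb]; exists c.
wlog : x y s / x <= y => [H|xy].
  have [xy|/ltW xy] := leP x y; first exact: H.
  move=> x1 y1 s01; have := @H y x (1 - s) xy y1 x1.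
  have -> : 1 - (1 - s) = s by ring.
  have -> : s * f y + (1 - s) * f x = (1 - s) * f x + s * f y by ring.
  have -> : s * y + (1 - s) * x = (1 - s) * x + s * y by ring.
  by apply; case/andP : s01 => ? ?; apply/andP; split; lra.
case/andP=> x0 _ /andP[_ y1] /andP[s0 s1].
move: xy; rewrite le_eqVlt => /predU1P[<-|xy].
  have -> : (1 - s) * x + s * x = x by ring.
  have -> : (1 - s) * f x + s * f x = f x by ring.
  exact: lexx.
move: s0; rewrite le_eqVlt => /predU1P[<-|s0].
  by rewrite subr0 !mul1r !mul0r !addr0.
move: s1; rewrite le_eqVlt => /predU1P[->|s1].
  by rewrite subrr !mul0r !mul1r !add0r.
set z := (1 - s) * x + s * y.
have yx0 : 0 < y - x by lra.
have zx : z - x = s * (y - x) by rewrite /z; ring.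
have yz : y - z = (1 - s) * (y - x) by rewrite /z; ring.
have xz : x < z by rewrite -subr_gt0 zx mulr_gt0.
have zy : z < y by rewrite -subr_gt0 yz mulr_gt0//; lra.
have [c1 [xc1 c1z e1]] := mv x z x0 (le_trans (ltW zy) y1) xz.
have [c2 [zc2 c2y e2]] := mv z y (le_trans x0 (ltW xz)) y1 zy.
have c12 : c1 <= c2 by lra.
have d2' (u : R) : u \in `[c1, c2]%R -> is_derive u 1 f1 (f2 u).
  by rewrite in_itv/= => /andP[au ub]; apply: d2; rewrite ltr_norml; apply/andP; split; lra.
have c1cont : {within `[c1, c2], continuous f1}.
  by apply: derivable_within_continuous => u /d2' ?; apply: ex_derive.
have d2'' (u : R) : u \in `]c1, c2[%R -> is_derive u 1 f1 (f2 u).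
  by rewrite in_itv/= => /andP[/ltW ? /ltW ?]; apply: d2'; rewrite in_itv/=; apply/andP.
have [c + e3] := MVT_segment c12 d2'' c1cont.
rewrite in_itv/= => /andP[cc1 cc2].
have f2c : f2 c <= 0 by apply: f2le0; rewrite ltr_norml; apply/andP; split; lra.
rewrite -subr_ge0.
have -> : f z - ((1 - s) * f x + s * f y) = (1 - s) * (f z - f x) - s * (f y - f z) by ring.
rewrite e1 e2 zx yz.
have -> : (1 - s) * (f1 c1 * (s * (y - x))) - s * (f1 c2 * ((1 - s) * (y - x))) =
  - (s * (1 - s) * (y - x) * (f1 c2 - f1 c1)) by ring.
rewrite oppr_ge0 mulr_ge0_le0//; first by rewrite !mulr_ge0//; lra.
by rewrite e3 mulr_le0_ge0//; lra.
Qed.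

Lemma poly_bounded p : exists2 B : R, 0 <= B & forall t : R, `|t| <= 1 -> `|p.[t]| <= B.
Proof.
exists (\sum_(i < size p) `|p`_i|); first exact: sumr_ge0.
move=> t t1; rewrite horner_coef (le_trans (ler_norm_sum _ _ _))//.
apply: ler_sum => i _; rewrite normrM normrX ler_piMr// exprn_ile1//.
Qed.

Lemma is_derive_arch (t : R) : `|t| < 1 -> is_derive t 1 (@arch R) (- (t / arch t)).
Proof.
move=> t1; have a0 := arch_gt0 t1.
have d1 := is_derive_1Bsqr t.
have p0 : 0 < 1 - t ^+ 2 by rewrite -sqr_arch ?ltW// exprn_gt0.
have := @is_derive1_comp _ (@Num.sqrt R) (fun t : R => 1 - t ^+ 2) t _ _ (is_derive1_sqrt p0) d1.
move/trigger_derive; apply; rewrite -/(arch t).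
by field; rewrite gt_eqF.
Qed.

(** With q = p + 4 B >= 3 B, the second derivative of q * arch ^+ k.+1 is nonpositive on
    (-1, 1): it contains the term - q / arch^3 for exponent 1 and - 2 q for exponent 2,
    and this term dominates the others. *)
Lemma concave_profile p (B : R) (k : nat) : (k < 2)%N ->
  (forall t : R, `|t| <= 1 -> `|p.[t]| <= B) ->
  (forall t : R, `|t| <= 1 -> `|p^`().[t]| <= B) ->
  (forall t : R, `|t| <= 1 -> `|p^`()^`().[t]| <= B) ->
  forall x y s : R, -1 <= x <= 1 -> -1 <= y <= 1 -> 0 <= s <= 1 ->
    (1 - s) * profile (p + (4 * B)%:P) k.+1 x +
    s * profile (p + (4 * B)%:P) k.+1 y <=
    profile (p + (4 * B)%:P) k.+1 ((1 - s) * x + s * y).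
Proof.
move=> k2 B0 B1 B2 x y s x1 y1 s1.
set q := p + (4 * B)%:P; pose f := profile q k.+1; rewrite -/f.
have Bge0 : 0 <= B by apply: le_trans (B0 0 _); rewrite ?normr0.
have cf : continuous f by exact: continuous_profile.
have q0 t : `|t| <= 1 -> 3 * B <= q.[t].
  by move=> /B0; rewrite /q hornerD hornerC ler_norml => /andP[? ?]; lra.
have q1 : q^`() = p^`() by rewrite /q derivD derivC addr0.
case: k k2 @f cf => [|[|//]] _ f cf.
  pose f1 t := q^`().[t] * arch t - q.[t] * (t / arch t).
  pose f2 t := (q^`()^`().[t] * arch t - q^`().[t] * (t / arch t)) -
     (q^`().[t] * (t / arch t) + q.[t] * ((arch t + t * (t / arch t)) / arch t ^+ 2)).
  apply: (@concave_of_second_derivative f f1 f2) => //.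
  - move=> t t1.
    have := is_deriveM (is_derive_poly q t) (is_derive_arch t1).
    have -> : horner q * @arch R = f by apply/funext => u; rewrite /f /profile expr1.
    move/trigger_derive; apply; rewrite /GRing.scale/= /f1; ring.
  - move=> t t1; have a0 := arch_gt0 t1.
    have D1 := is_deriveM (is_derive_poly q^`() t) (is_derive_arch t1).
    have a1 : arch t != 0 by rewrite gt_eqF.
    have D2 := is_deriveM (is_derive_id t (1:R)) (is_deriveV a1 (is_derive_arch t1)).
    have D3 := is_deriveB D1 (is_deriveM (is_derive_poly q t) D2).
    have := D3.
    move/trigger_derive; apply; rewrite /GRing.scale/= /f2.
    rewrite -[(id * _) t]/(t * (arch t)^-1); by field.
  - move=> t t1; have a0 := arch_gt0 t1; have t1' := ltW t1.
    rewrite -(pmulr_rle0 _ (exprn_gt0 3 a0)).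
    have -> : arch t ^+ 3 * f2 t = q^`()^`().[t] * (arch t ^+ 2) ^+ 2 -
        2 * (q^`().[t] * t) * (arch t ^+ 2) - q.[t] * (arch t ^+ 2 + t ^+ 2).
      rewrite /f2; field; by rewrite gt_eqF.
    rewrite sqr_arch// subrK mulr1 q1.
    have t20 : 0 <= t ^+ 2 by exact: sqr_ge0.
    have t21 : t ^+ 2 <= 1 by rewrite -real_normK ?num_real// exprn_ile1.
    have w0 : 0 <= 1 - t ^+ 2 by lra.
    have w1 : 1 - t ^+ 2 <= 1 by lra.
    have h1 : p^`()^`().[t] * (1 - t ^+ 2) ^+ 2 <= B.
      apply: le_trans (ler_norm _) _; rewrite normrM.
      by apply: le_trans (ler_piMr _ _) (B2 _ _) => //; rewrite ger0_norm ?sqr_ge0// exprn_ile1.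
    have h2 : - (p^`().[t] * t * (1 - t ^+ 2)) <= B.
      apply: le_trans (ler_norm _) _; rewrite normrN !normrM -mulrA.
      apply: le_trans (ler_piMr _ _) (B1 _ t1') => //.
      by rewrite mulr_ile1// ger0_norm.
    have := q0 _ t1'; lra.
pose f1 t := q^`().[t] * (1 - t ^+ 2) - q.[t] * (2 * t).
pose f2 t := q^`()^`().[t] * (1 - t ^+ 2) - 2 * (q^`().[t] * (2 * t)) - 2 * q.[t].
have d1 := @is_derive_1Bsqr R.
have d2 (t : R) : is_derive t 1 (fun t : R => 2 * t) 2.
  have := is_deriveZ 2 (is_derive_id t (1:R)).
  move/trigger_derive; apply; rewrite /GRing.scale/=; ring.
apply: (@concave_of_second_derivative f f1 f2) => //.
- move=> t t1.
  have := is_deriveM (is_derive_poly q t) (d1 t).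
  move=> D; apply: near_eq_is_derive (_ : is_derive t 1 (horner q * (fun t : R => 1 - t ^+ 2)) (f1 t)).
    near=> u; rewrite /f /profile sqr_arch//.
    apply: ltW; near: u; exact: (@cvgr_norm_lt _ _ _ (nbhs t) _ id t (@cvg_id _ _) 1 t1).
  move: D; move/trigger_derive; apply; rewrite /GRing.scale/= /f1; ring.
- move=> t t1.
  have := is_deriveB (is_deriveM (is_derive_poly q^`() t) (d1 t))
    (is_deriveM (is_derive_poly q t) (d2 t)).
  move/trigger_derive; apply; rewrite /GRing.scale/= /f2; ring.
- move=> t t1; have t1' := ltW t1; rewrite /f2 q1.
  have t20 : 0 <= t ^+ 2 by exact: sqr_ge0.
  have t21 : t ^+ 2 <= 1 by rewrite -real_normK ?num_real// exprn_ile1.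
  have w0 : 0 <= 1 - t ^+ 2 by lra.
  have w1 : 1 - t ^+ 2 <= 1 by lra.
  have h1 : p^`()^`().[t] * (1 - t ^+ 2) <= B.
    apply: le_trans (ler_norm _) _; rewrite normrM.
    by apply: le_trans (ler_piMr _ _) (B2 _ _) => //; rewrite ger0_norm.
  have h2 : - (p^`().[t] * t) <= B.
    apply: le_trans (ler_norm _) _; rewrite normrN !normrM.
    exact: le_trans (ler_piMr _ _) (B1 _ _).
  have := q0 _ t1'; lra.
Unshelve. all: by end_near. Qed.

End grid_profile.

Section grid_profile2.
Variable R : realType.
Implicit Types (p : {poly R}) (f Phi : R -> R).

(** At distance at most d from the ends of [-1, 1] one has 1 - t^2 <= 2 d. *)
Lemma concave_bump_profile p (B : R) k (d : R) : (k < 2)%N -> 0 < d ->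
  (forall t : R, `|t| <= 1 -> `|p.[t]| <= B) ->
  (forall t : R, `|t| <= 1 -> `|p^`().[t]| <= B) ->
  (forall t : R, `|t| <= 1 -> `|p^`()^`().[t]| <= B) ->
  concave_bump (profile (p + (4 * B)%:P) k.+1) d (5 * B * Num.sqrt (2 * d) ^+ k.+1).
Proof.
move=> k2 d0 B0 B1 B2.
have Bge0 : 0 <= B by apply: le_trans (B0 0 _); rewrite ?normr0.
have qB (t : R) : `|t| <= 1 -> 0 <= (p + (4 * B)%:P).[t] <= 5 * B.
  move=> /B0; rewrite hornerD hornerC ler_norml => /andP[? ?].
  by apply/andP; split; lra.
split.
- move=> t; have [t1|t1] := lerP `|t| 1; last by rewrite profile_out// ltW.
  by rewrite mulr_ge0 ?exprn_ge0 ?arch_ge0//; have /andP[] := qB _ t1.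
- by move=> t; exact: profile_out.
- exact: concave_profile.
- move=> t td; have [t1|t1] := leP 1 `|t|.
    by rewrite profile_out// mulr_ge0 ?exprn_ge0 ?sqrtr_ge0//; lra.
  have /andP[q0 q1] := qB _ (ltW t1).
  apply: ler_pM => //; first by rewrite exprn_ge0// arch_ge0.
  rewrite lerXn2r ?nnegrE ?sqrtr_ge0 ?arch_ge0//; apply: ler_wsqrtr.
  rewrite -[t ^+ 2]real_normK ?num_real//.
  have := mulr_ge0 (normr_ge0 t) (_ : 0 <= 1 - `|t|); rewrite expr2.
  have t0 := normr_ge0 t.
  have [d1|d1] := leP d 1; last by nra.
  nra.
Qed.

(** A profile of exponent 1 or 2 is a difference of two concave ones.  Differentiating
    lowers the exponent by two and gains a factor d in the error ([grid_lift]), which is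
    Num.sqrt d ^+ 2. *)
Lemma grid_profile p k : exists2 C : R, 0 <= C & forall (d x : R) N Phi,
  (forall x : R, is_derive x 1 Phi (profile p k.+1 x)) ->
  0 < d -> d <= 1 -> 1 + d <= d * N%:R -> 0 <= x <= 1 ->
  `|d * grid N d (profile p k.+1) x - (Phi 1 - Phi (-1))| <=
    C * (d * Num.sqrt d ^+ k.+1).
Proof.
elim/ltn_ind: k p => k IH p.
have [k2|] := ltnP k 2; last first.
  case: k IH => [//|[//|k]] IH _.
  have [C C0 CP] := IH k (leqW (leqnn _)) (lower p k.+3).
  exists C => // d x N Phi dPhi d0 d1 Nd x01.
  have f0 (t : R) : 1 <= `|t| -> profile p k.+3 t = 0 by exact: profile_out.
  have df := @is_derive_profile R p k.
  have h (y : R) : 0 <= y <= 1 ->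
      `|d * grid N d (profile (lower p k.+3) k.+1) y| <= C * (d * Num.sqrt d ^+ k.+1).
    move=> y01; have := CP d y N _ df d0 d1 Nd y01.
    by rewrite !f0 ?normrN1 ?normr1// !subr0.
  apply: le_trans (grid_lift dPhi df f0 d0 Nd h x01) _.
  rewrite mulrCA ler_wpM2l// ler_wpM2l ?(ltW d0)//.
  by rewrite [in leRHS]exprS [in leRHS]exprS mulrA -expr2 sqr_sqrtr ?(ltW d0).
have [B0 B00 B0P] := poly_bounded p.
have [B1 B10 B1P] := poly_bounded p^`().
have [B2 B20 B2P] := poly_bounded p^`()^`().
(* a common bound for p and its first two derivatives, as [concave_profile] asks *)
pose B := B0 + B1 + B2.
have {}B0P (t : R) : `|t| <= 1 -> `|p.[t]| <= B by move/B0P; rewrite /B; lra.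
have {}B1P (t : R) : `|t| <= 1 -> `|p^`().[t]| <= B by move/B1P; rewrite /B; lra.
have {}B2P (t : R) : `|t| <= 1 -> `|p^`()^`().[t]| <= B by move/B2P; rewrite /B; lra.
have Bge0 : 0 <= B by rewrite /B; lra.
exists (20 * B * Num.sqrt 2 ^+ k.+1); first by rewrite !mulr_ge0 ?exprn_ge0 ?sqrtr_ge0.
move=> d x N Phi dPhi d0 d1 Nd x01.
have fb := concave_bump_profile k2 d0 B0P B1P B2P.
have gb : concave_bump (profile (0 + (4 * B)%:P) k.+1) d (5 * B * Num.sqrt (2 * d) ^+ k.+1).
  by apply: concave_bump_profile => // t _; rewrite ?deriv0 horner0 normr0.
have g0 (t : R) : 1 <= `|t| -> profile (0 + (4 * B)%:P) k.+1 t = 0 by exact: profile_out.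
have [Psi dPsi] := antiderivative (@continuous_profile R (0 + (4 * B)%:P) k.+1) g0.
have dS (t : R) : is_derive t 1 (Phi + Psi) (profile (p + (4 * B)%:P) k.+1 t).
  have := is_deriveD (dPhi t) (dPsi t); move/trigger_derive; apply.
  by rewrite /profile !hornerD !hornerC; ring.
have h1 := grid_concave d0 d1 fb dS Nd x01.
have h2 := grid_concave d0 d1 gb dPsi Nd x01.
have e : grid N d (profile p k.+1) x = grid N d (profile (p + (4 * B)%:P) k.+1) x
   - grid N d (profile (0 + (4 * B)%:P) k.+1) x.
  rewrite /grid -sumrB; apply: eq_bigr => i _.
  by rewrite /profile !hornerD !hornerC; ring.
rewrite e.
set u := grid N d (profile (p + _) _) x in h1 *; set v := grid N d _ x in h2 *.
have -> : d * (u - v) - (Phi 1 - Phi (-1)) =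
  (d * u - ((Phi + Psi) 1 - (Phi + Psi) (-1))) - (d * v - (Psi 1 - Psi (-1))).
  by rewrite !fctE; ring.
apply: le_trans (ler_normB _ _) _; apply: le_trans (lerD h1 h2) _.
rewrite sqrtrM// exprMn le_eqVlt; apply/orP; left; apply/eqP; ring.
Qed.

End grid_profile2.

(** * Sums over the integer points of an interval *)

Section window.
Variable R : realType.
Implicit Types (c r : R).

Definition window c r : seq int :=
  let lo := Num.floor (- r - c) + 1 in
  [seq lo + i%:Z | i <- iota 0 (absz (Num.max (0:int) (Num.ceil (r - c) - lo)%R))].

Lemma mem_window c r (m : int) : (m \in window c r) = (`|m%:~R + c| < r).
Proof.
rewrite /window; set lo := _ + 1; set n := Num.max _ _.
have -> : (`|m%:~R + c| < r) = (lo <= m < Num.ceil (r - c)).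
  by rewrite ltr_norml /lo lezD1 floor_lt_int ceil_gt_int ltrBlDr ltrBrDr.
have n0 : 0 <= n by rewrite le_max lexx.
apply/mapP/idP => [[i + ->]|/andP[lom mU]].
  rewrite mem_iota add0n /= -ltz_nat gez0_abs// /n lt_max => /orP[//|ilt].
  by rewrite lerDl lez_nat/= -ltrBrDl.
exists `|m - lo|%N; last by rewrite gez0_abs ?subr_ge0// subrKC.
rewrite mem_iota add0n /= -ltz_nat !gez0_abs ?subr_ge0//.
by rewrite /n lt_max ltrD2r mU orbT.
Qed.

Lemma uniq_window c r : uniq (window c r).
Proof. by rewrite map_inj_uniq ?iota_uniq// => i j /addrI[]. Qed.

Lemma size_window c r : 0 <= r -> `|(size (window c r))%:R - 2 * r| <= 1.
Proof.
move=> r0; rewrite size_map size_iota; set lo := _ + 1; set n := Num.max _ _.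
have n0 : 0 <= n by rewrite le_max lexx.
rewrite pmulrn gez0_abs//.
have /andP[f1 f2] := floor_itv (- r - c).
have /andP[c1 c2] := ceil_itv (r - c).
rewrite -/lo in f2.
have f3 : lo%:~R <= - r - c + 1 by rewrite /lo intrD; lra.
rewrite intrB in c1.
have [h|h] := leP 0 (Num.ceil (r - c) - lo).
  by rewrite /n (max_r h) intrB ler_norml; apply/andP; split; lra.
rewrite /n (max_l (ltW h)).
have : ((Num.ceil (r - c)) - lo)%:~R < 0%:~R :> R by rewrite ltr_int.
rewrite intrB => h'.
by rewrite ler_norml; apply/andP; split; lra.
Qed.

Lemma window_shift (G : R -> R) c r (z : int) :
  \sum_(m <- window (c + z%:~R) r) G (m%:~R + (c + z%:~R)) =
  \sum_(m <- window c r) G (m%:~R + c).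
Proof.
have -> : \sum_(m <- window c r) G (m%:~R + c) =
  \sum_(m <- [seq m - z | m <- window c r]) G (m%:~R + (c + z%:~R)).
  by rewrite [RHS]big_map; apply: eq_bigr => m _; congr (G _); rewrite intrB; ring.
apply: perm_big; apply: uniq_perm; first exact: uniq_window.
  by rewrite map_inj_uniq ?uniq_window// => i j /addIr.
move=> m; apply/idP/mapP => [mw|[m' m'w ->]].
  exists (m + z); last by rewrite addrK.
  by move: mw; rewrite !mem_window intrD addrAC addrA.
by move: m'w; rewrite !mem_window intrB; congr (`|_| < _); ring.
Qed.

(** The cosets i / a + Z, i < a, make up (1 / a) Z. *)
Lemma window_refine (G : R -> R) c r (a : nat) : (0 < a)%N ->
  \sum_(i < a) \sum_(m <- window (c + i%:R / a%:R) r) G (m%:~R + (c + i%:R / a%:R)) =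
  \sum_(m <- window (a%:R * c) (a%:R * r)) G ((m%:~R + a%:R * c) / a%:R).
Proof.
move=> a0; have a0R : 0 < a%:R :> R by rewrite ltr0n.
have aN0 : a%:R != 0 :> R by rewrite gt_eqF.
rewrite -(big_mkord xpredT (fun i =>
  \sum_(m <- window (c + i%:R / a%:R) r) G (m%:~R + (c + i%:R / a%:R)))).
rewrite /index_iota subn0.
pose h (i : nat) (m : int) : int := a%:Z * m + i%:Z.
have hE i m : (h i m)%:~R = a%:R * m%:~R + i%:R :> R by rewrite /h intrD intrM.
rewrite (eq_bigr (fun i : nat => \sum_(m <- window (c + i%:R / a%:R) r)
    G (((h i m)%:~R + a%:R * c) / a%:R))); last first.
  move=> i _; apply: eq_bigr => m _; congr (G _); rewrite hE; field; exact: aN0.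
rewrite -(@big_allpairs_dep _ _ _ _ _ _ h (iota 0 a) (fun i => window (c + i%:R / a%:R) r)
   (fun m => G ((m%:~R + a%:R * c) / a%:R))).
apply: perm_big; apply: uniq_perm; last 1 first.
- move=> M; apply/allpairsPdep/idP => [[i [m [ia mw ->]]]|Mw].
    move: mw; rewrite !mem_window hE => mw.
    have -> : a%:R * m%:~R + i%:R + a%:R * c = a%:R * (m%:~R + (c + i%:R / a%:R)).
      by field; exact: aN0.
    by rewrite normrM gtr0_norm// ltr_pM2l.
  have az : a%:Z != 0 by rewrite gt_eqF.
  have m0 := modz_ge0 M az; have ma := ltz_mod M az.
  exists `|(M %% a)%Z|%N, (M %/ a)%Z; split.
  - by rewrite mem_iota add0n/= -ltz_nat gez0_abs// (lt_le_trans ma).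
  - move: Mw; rewrite !mem_window => Mw.
    rewrite -(ltr_pM2l a0R) -{1}(gtr0_norm a0R) -normrM.
    suff -> : a%:R * ((M %/ a)%Z%:~R + (c + `|(M %% a)%Z|%N%:R / a%:R)) = M%:~R + a%:R * c by [].
    have -> : `|(M %% a)%Z|%N%:R = (M %% a)%Z%:~R :> R by rewrite pmulrn gez0_abs.
    have -> : M%:~R = (M %/ a)%Z%:~R * a%:R + (M %% a)%Z%:~R :> R.
      by rewrite [in LHS](divz_eq M a) intrD intrM.
    field; exact: aN0.
  - by rewrite /h gez0_abs// mulrC -divz_eq.
- apply: allpairs_uniq_dep; [exact: iota_uniq|by move=> i _; exact: uniq_window|].
  move=> -[i m] -[j m'] /= /allpairsPdep[i1 [m1 [i1a _ [-> e1]]]].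
  move=> /allpairsPdep[j1 [m2 [j1a _ [-> e2]]]].
  move=> hh.
  have aP (i0 : nat) : i0 \in iota 0 a -> (i0%:Z %% a)%Z = i0%:Z.
    by rewrite mem_iota add0n => /= ia; rewrite modz_nat modn_small.
  have ij : i1%:Z = j1%:Z.
    rewrite -(aP _ i1a) -(aP _ j1a) -[LHS](modzMDl m) -[RHS](modzMDl m').
    by move: hh; rewrite /h !(mulrC a%:Z) => ->.
  case: ij hh => ij; rewrite /h ij => /addIr/mulfI ->//.
  by rewrite gt_eqF.
- exact: uniq_window.
Qed.

(** The volume of the unit ball of dimension k + 1 divided by that of the unit ball of
    dimension k. *)
Definition area k : R :=
  fine (\int[@lebesgue_measure R]_(t in `[(-1)%R, 1%R]) (arch t ^+ k)%:E)%E.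

Lemma continuous_archX k : continuous (fun t : R => arch t ^+ k).
Proof.
move=> t; apply: (@continuous_comp _ _ _ (@arch R) (fun x => x ^+ k)).
  exact: continuous_arch.
exact: exprn_continuous.
Qed.

Lemma area_ge0 k : 0 <= area k.
Proof. by apply/fine_ge0/integral_ge0 => t _; rewrite lee_fin exprn_ge0// arch_ge0. Qed.

Lemma area_antiderivative k (Phi : R -> R) :
  (forall x : R, is_derive x 1 Phi (arch x ^+ k)) -> area k = Phi 1 - Phi (-1).
Proof.
move=> dPhi; rewrite /area (@continuous_FTC2 _ _ Phi)//.
- exact/continuous_subspaceT/continuous_archX.
- split => [x _| |]; first exact: ex_derive.
  + apply: cvg_at_right_filter; apply: differentiable_continuous.
    apply/derivable1_diffP; exact: ex_derive.
  + apply: cvg_at_left_filter; apply: differentiable_continuous.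
    apply/derivable1_diffP; exact: ex_derive.
- by move=> x _; rewrite derive1E derive_val.
Qed.

Lemma area0 : area 0 = 2.
Proof.
by rewrite (@area_antiderivative _ id) ?opprK// => x; rewrite expr0; exact: is_derive_id.
Qed.

Lemma grid_window N (d c : R) (f : R -> R) : 0 <= c <= 1 -> 0 < d ->
  1 + d <= d * N%:R -> (forall t : R, 1 <= `|t| -> f t = 0) ->
  grid N d f c = \sum_(m <- window c d^-1) f (d * (m%:~R + c)).
Proof.
move=> /andP[c0 c1] d0 Nd f0.
pose S := [seq i%:Z - N%:Z | i <- iota 0 N.*2].
have -> : grid N d f c = \sum_(m <- S) f (d * (m%:~R + c)).
  rewrite [RHS]big_map /grid -(big_mkord xpredT (fun i => f (d * (i%:R - N%:R + c)))).
  by rewrite /index_iota subn0; apply: eq_bigr => i _; rewrite intrB.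
rewrite -(@big_rmcond _ _ _ _ _ (mem (window c d^-1))); last first.
  move=> m; rewrite inE mem_window -leNgt => h; rewrite f0// normrM gtr0_norm//.
  by rewrite -ler_pdivrMl// mulr1.
rewrite -big_filter; apply: perm_big; apply: uniq_perm.
- by rewrite filter_uniq// map_inj_uniq ?iota_uniq// => i j /addIr[].
- exact: uniq_window.
move=> m; rewrite mem_filter; apply/andb_idr => /=; rewrite mem_window ltr_norml => /andP[m1 m2].
have dN : d^-1 + 1 <= N%:R.
  by rewrite -(ler_pM2l d0) mulrDr mulr1 mulfV ?gt_eqF.
have h1 : (- N%:Z)%:~R <= m%:~R :> R by rewrite intrN; lra.
have h2 : m%:~R < N%:Z%:~R :> R by rewrite -pmulrn; lra.
rewrite ler_int in h1; rewrite ltr_int in h2.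
apply/mapP; exists (absz (m + N%:Z)); last by rewrite gez0_abs ?addrK// -lerBlDr sub0r.
rewrite mem_iota add0n/= -ltz_nat gez0_abs; last by rewrite -lerBlDr sub0r.
by rewrite -addnn PoszD ltrD2r.
Qed.

(** For d <= 1 this is [grid_profile], after a reduction of c modulo 1.  For d > 1 there
    are at most three terms, so a suitable C makes the bound exceed both quantities
    compared.  For k = 0 the sum is a count. *)
Lemma window_arch k : exists2 C : R, 0 <= C & forall d c : R, 0 < d ->
  `|d * (\sum_(m <- window c d^-1) arch (d * (m%:~R + c)) ^+ k) - area k| <=
    C * (d * Num.sqrt (Num.min d 1) ^+ k).
Proof.
case: k => [|k].
  exists 1 => // d c d0; rewrite expr0 mulr1 mul1r area0.
  rewrite (eq_bigr (fun=> 1)) => [|m _]; last by rewrite expr0.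
  rewrite big_const_seq count_predT iter_addr_0.
  have di : 0 <= d^-1 by rewrite invr_ge0 ltW.
  have := size_window c di; set n := size _ => h.
  have -> : d * n%:R - 2 = d * (n%:R - 2 * d^-1) by field; rewrite gt_eqF.
  by rewrite normrM gtr0_norm// ger_pMr.
have [C C0 CP] := grid_profile (1 : {poly R}) k.
have A0 := area_ge0 k.+1.
exists (C + (3 + area k.+1)); first by rewrite !addr_ge0.
move=> d c d0.
have [d1|d1] := leP d 1; last first.
  rewrite sqrtr1 expr1n mulr1.
  apply: le_trans (_ : (3 + area k.+1) * d <= _); last first.
    by rewrite ler_wpM2r ?(ltW d0)// lerDr.
  have di : 0 <= d^-1 by rewrite invr_ge0 ltW.
  have d1' : d^-1 <= 1 by rewrite invf_le1// ltW.
  set S := \sum_(m <- _) _.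
  have S0 : 0 <= S by apply: sumr_ge0 => m _; rewrite exprn_ge0// arch_ge0.
  have S3 : S <= 3.
    apply: (@le_trans _ _ (\sum_(m <- window c d^-1) 1)).
      by apply: ler_sum => m _; rewrite exprn_ile1 ?arch_ge0 ?arch_le1.
    rewrite big_const_seq count_predT iter_addr_0.
    have := size_window c di; rewrite ler_norml => /andP[_]; lra.
  have h1 : 0 <= d * S by rewrite mulr_ge0// ltW.
  have h2 : d * S <= d * 3 by rewrite ler_pM2l.
  have h3 : area k.+1 <= area k.+1 * d by rewrite ler_peMr// ltW.
  by rewrite ler_norml; apply/andP; split; lra.
pose c' := c - (Num.floor c)%:~R.
have c'01 : 0 <= c' <= 1.
  have /andP[f1] := floor_itv c; rewrite intrD => f2.
  by rewrite /c'; apply/andP; split; lra.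
have e : c = c' + (Num.floor c)%:~R by rewrite subrK.
have := window_shift (fun x => arch (d * x) ^+ k.+1) c' d^-1 (Num.floor c); rewrite -e => ->.
pose N := (Num.bound d^-1).+1.
have Nd : 1 + d <= d * N%:R.
  rewrite /N -natr1 mulrDr mulr1 lerD2r -ler_pdivrMl// mulr1.
  by apply/ltW/archi_boundP; rewrite invr_ge0 ltW.
have f0 (t : R) : 1 <= `|t| -> profile 1 k.+1 t = 0 by exact: profile_out.
have eP (t : R) : profile 1 k.+1 t = arch t ^+ k.+1 by rewrite /profile hornerC mul1r.
have [Phi dPhi] := antiderivative (@continuous_profile R 1 k.+1) f0.
have := CP d c' N Phi dPhi d0 d1 Nd c'01.
have dPhi' (x : R) : is_derive x 1 Phi (arch x ^+ k.+1) by rewrite -eP; exact: dPhi.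
rewrite grid_window// -(area_antiderivative dPhi').
rewrite (eq_bigr (fun m : int => arch (d * (m%:~R + c')) ^+ k.+1)) => [h|m _]; last exact: eP.
apply: le_trans h _; rewrite ler_wpM2r//; last by rewrite lerDl addr_ge0.
by rewrite mulr_ge0 ?(ltW d0)// exprn_ge0 ?sqrtr_ge0.
Qed.

End window.

(** * Counting the points of a ball one coordinate at a time *)

Section chord.
Variable R : realType.
Implicit Types (kap rho c : R) (k : nat).

(** Up to a constant factor, the sum of the volumes of the sections at heights
    kap (m + c) of a ball of dimension k + 1 and radius rho. *)
Definition chord_sum kap k rho c : R :=
  \sum_(m <- window c (rho / kap)) Num.sqrt (rho ^+ 2 - kap ^+ 2 * (m%:~R + c) ^+ 2) ^+ k.

Definition chord_err kap k rho c : R :=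
  chord_sum kap k rho c - area R k * rho ^+ k.+1 / kap.

Lemma chord_err_shift kap k rho c (z : int) :
  chord_err kap k rho (c + z%:~R) = chord_err kap k rho c.
Proof.
by rewrite /chord_err /chord_sum (window_shift (fun x => Num.sqrt (rho ^+ 2 - kap ^+ 2 * x ^+ 2) ^+ k)).
Qed.

(** The sums for the shifts i / a, i < a, form a single sum over a grid that is a times
    finer ([window_refine]), and a times the error of a Riemann sum of that mesh is
    bounded independently of a ([window_arch]). *)
Lemma chord_err_average kap k : 0 < kap -> exists2 C : R, 0 < C &
  forall T rho c (a : nat), 0 <= rho -> rho <= T -> (0 < a)%N ->
  `|\sum_(i < a) chord_err kap k rho (c + i%:R / a%:R)| <= C * Num.sqrt T ^+ k.
Proof.
move=> kap0; have [C C0 CP] := window_arch R k.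
exists ((C + 1) * Num.sqrt kap ^+ k).
  by rewrite mulr_gt0 ?exprn_gt0 ?sqrtr_gt0//; lra.
move=> T rho c a rho0 rhoT a0.
have a0R : 0 < a%:R :> R by rewrite ltr0n.
have T0 : 0 <= T by apply: le_trans rhoT.
rewrite /chord_err sumrB sumr_const card_ord /chord_sum.
pose G x := Num.sqrt (rho ^+ 2 - kap ^+ 2 * x ^+ 2) ^+ k.
rewrite (window_refine G c (rho / kap) a0).
have rhs0 : 0 <= (C + 1) * Num.sqrt kap ^+ k * Num.sqrt T ^+ k.
  by rewrite !mulr_ge0 ?exprn_ge0 ?sqrtr_ge0//; lra.
move: rho0; rewrite le_eqVlt => /predU1P[rhoE|rho0].
  rewrite -rhoE mul0r mulr0 expr0n/= mulr0 mul0r mul0rn subr0 big_seq big1 ?normr0// => m.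
  by rewrite mem_window ltNge normr_ge0.
pose d := kap / (a%:R * rho).
have d0 : 0 < d by rewrite divr_gt0// mulr_gt0.
have dV : d^-1 = a%:R * (rho / kap) by rewrite /d invf_div mulrA.
have rs : Num.sqrt (rho ^+ 2) = rho by rewrite sqrtr_sqr gtr0_norm.
have GE (m : int) : G ((m%:~R + a%:R * c) / a%:R) = rho ^+ k * arch (d * (m%:~R + a%:R * c)) ^+ k.
  rewrite /G /arch -[RHS]exprMn; congr (_ ^+ k).
  rewrite -[X in _ = X * _]rs -sqrtrM ?sqr_ge0//.
  congr (Num.sqrt _); rewrite /d; field.
  by rewrite !gt_eqF.
rewrite (eq_bigr _ (fun m _ => GE m)) -mulr_sumr -dV.
have := CP d (a%:R * c) d0; set S := \sum_(m <- _) _ => h.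
have -> : rho ^+ k * S - area R k * rho ^+ k.+1 / kap *+ a = rho ^+ k / d * (d * S - area R k).
  rewrite /d exprS -mulr_natr; field.
  by rewrite !gt_eqF.
rewrite normrM ger0_norm; last by rewrite divr_ge0 ?exprn_ge0// ltW.
apply: le_trans (ler_wpM2l _ h) _; first by rewrite divr_ge0 ?exprn_ge0// ltW.
have -> : rho ^+ k / d * (C * (d * Num.sqrt (Num.min d 1) ^+ k)) =
   C * (rho * Num.sqrt (Num.min d 1)) ^+ k.
  by rewrite exprMn; field; rewrite gt_eqF.
rewrite -mulrA -exprMn; apply: ler_pM => //.
- rewrite exprn_ge0// mulr_ge0 ?sqrtr_ge0//; exact: ltW.
- by rewrite lerDl.
rewrite lerXn2r ?nnegrE ?mulr_ge0 ?sqrtr_ge0 ?(ltW rho0)//.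
rewrite -[X in X * _]rs -!sqrtrM ?sqr_ge0 ?(ltW kap0)//.
apply: ler_wsqrtr; apply: (@le_trans _ _ (rho ^+ 2 * d)).
  by rewrite ler_wpM2l ?sqr_ge0// ge_min lexx.
have -> : rho ^+ 2 * d = kap * rho / a%:R.
  by rewrite /d; field; rewrite !gt_eqF.
rewrite ler_pdivrMr//; apply: le_trans (_ : kap * T * 1 <= _).
  by rewrite mulr1 ler_pM2l.
by rewrite ler_wpM2l ?mulr_ge0 ?(ltW kap0)// ler1n.
Qed.

Lemma area_gt0 k : 0 < area R k.
Proof.
case: k => [|k]; first by rewrite area0.
have eP (t : R) : profile 1 k.+1 t = arch t ^+ k.+1 by rewrite /profile hornerC mul1r.
have f0 (t : R) : 1 <= `|t| -> profile 1 k.+1 t = 0 by exact: profile_out.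
have [Phi dPhi] := antiderivative (@continuous_profile R 1 k.+1) f0.
have fge0 (t : R) : 0 <= profile 1 k.+1 t by rewrite eP exprn_ge0// arch_ge0.
have Pm := antiderivative_mono dPhi fge0.
have dPhi' (x : R) : is_derive x 1 Phi (arch x ^+ k.+1) by rewrite -eP; exact: dPhi.
rewrite (area_antiderivative dPhi').
have h : -(1/2) <= 1/2 :> R by lra.
have [c [c1 c2 e]] := mean_value h dPhi'.
have : 0 < Phi (1/2) - Phi (-(1/2)).
  rewrite e; have -> : 1 / 2 - - (1 / 2) = 1 :> R by field.
  rewrite mulr1.
  by rewrite exprn_gt0// arch_gt0// ltr_norml; apply/andP; split; lra.
have := Pm (-1) (-(1/2)); have := Pm (1/2) 1; lra.
Qed.

End chord.

Section tree.
Variable R : realType.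
Implicit Types (kap : nat -> R) (th : seq int -> R) (T : R) (n : seq int).

(** What is left of T^2 for the coordinates that come after those in n.  An integer
    vector is stored with its latest coordinate at the head, and th n is the shift that
    the earlier coordinates n impose on the next one. *)
Fixpoint slack kap th T n : R :=
  if n is m :: n' then slack kap th T n' - (kap (size n') * (m%:~R + th n')) ^+ 2
  else T ^+ 2.

Fixpoint tree kap th T j : seq (seq int) :=
  if j is j'.+1 then
    [seq m :: n | n <- tree kap th T j',
                  m <- window (th n) (Num.sqrt (slack kap th T n) / kap j')]
  else [:: [::]].

Lemma slack_le kap th T n : slack kap th T n <= T ^+ 2.
Proof.
elim: n => //= m n IH; apply: le_trans IH; by rewrite gerBl sqr_ge0.
Qed.

Lemma mem_window_slack kap th T n m : 0 < kap (size n) -> 0 < slack kap th T n ->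
  (m \in window (th n) (Num.sqrt (slack kap th T n) / kap (size n))) =
  (0 < slack kap th T (m :: n)).
Proof.
move=> k0 s0; rewrite mem_window /= subr_gt0 ltr_pdivlMr// mulrC -{1}(gtr0_norm k0) -normrM.
rewrite -[X in _ = (X < _)]real_normK ?num_real//.
by rewrite -[X in _ = (_ < X)](sqr_sqrtr (ltW s0)) ltr_pXn2r ?nnegrE ?sqrtr_ge0.
Qed.

Lemma mem_tree kap th T j n : (forall i, 0 < kap i) -> 0 < T ->
  (n \in tree kap th T j) = (size n == j) && (0 < slack kap th T n).
Proof.
move=> k0 T0; elim: j n => [|j IH] n.
  by case: n => [|m n]; rewrite inE//= exprn_gt0.
apply/allpairsPdep/idP => [[n' [m [n'T mw ->]]]|].
  move: n'T; rewrite IH => /andP[/eqP sn s0] /=.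
  by rewrite eqSS sn eqxx /=; move: mw; rewrite -sn mem_window_slack.
case: n => [|m n]//= /andP[/eqP[sn] s0].
have s1 : 0 < slack kap th T n by apply: lt_le_trans s0 _; rewrite gerBl sqr_ge0.
exists n, m; split => //; first by rewrite IH sn eqxx.
by rewrite -sn mem_window_slack.
Qed.

Lemma uniq_tree kap th T j : uniq (tree kap th T j).
Proof.
elim: j => // j IH; apply: allpairs_uniq_dep => //.
  by move=> n _; exact: uniq_window.
by move=> -[n m] -[n' m'] /= _ _ [-> ->].
Qed.

(** When the first j coordinates are fixed with slack r^2, the remaining ones fill an
    ellipsoid of dimension d - j and volume fibre_coef kap d j * r^(d - j). *)
Definition fibre_coef kap d j : R := \prod_(j <= i < d) (area R (d - i.+1) / kap i).

Lemma fibre_coef_gt0 kap d j : (forall i, 0 < kap i) -> 0 < fibre_coef kap d j.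
Proof. by move=> k0; apply: prodr_gt0 => i _; rewrite divr_gt0// area_gt0. Qed.

(** The first j coordinates are summed over the integers and the others are integrated
    over the reals: this interpolates between a volume and a number of points. *)
Definition fibre_sum kap th T d j : R :=
  \sum_(n <- tree kap th T j) fibre_coef kap d j * Num.sqrt (slack kap th T n) ^+ (d - j).

Lemma fibre_sum0 kap th T d : 0 < T -> fibre_sum kap th T d 0 = fibre_coef kap d 0 * T ^+ d.
Proof.
by move=> T0; rewrite /fibre_sum big_seq1 /= sqrtr_sqr gtr0_norm// subn0.
Qed.

Lemma fibre_sum_full kap th T d : fibre_sum kap th T d d = (size (tree kap th T d))%:R.
Proof.
rewrite /fibre_sum subnn /fibre_coef big_geq//.
under eq_bigr do rewrite expr0 mulr1.
by rewrite big_const_seq count_predT iter_addr_0.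
Qed.

(** In every fibre the integral over coordinate j becomes a sum over the integers. *)
Lemma fibre_sumS kap th T d j : (forall i, 0 < kap i) -> 0 < T -> (j < d)%N ->
  fibre_sum kap th T d j.+1 = fibre_sum kap th T d j +
  fibre_coef kap d j.+1 * \sum_(n <- tree kap th T j)
    chord_err (kap j) (d - j.+1) (Num.sqrt (slack kap th T n)) (th n).
Proof.
move=> k0 T0 jd; rewrite /fibre_sum [LHS]big_allpairs_dep mulr_sumr -big_split/=.
apply: eq_big_seq => n; rewrite mem_tree// => /andP[/eqP sn s0].
rewrite /chord_err /chord_sum -mulr_sumr mulrBr.
rewrite sn sqr_sqrtr ?ltW//.
under eq_bigr do rewrite exprMn.
have -> : fibre_coef kap d j = area R (d - j.+1) / kap j * fibre_coef kap d j.+1.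
  by rewrite /fibre_coef big_ltn.
rewrite subnSK//; set X := _ * \sum_(m <- _) _; ring.
Qed.

End tree.

(** * Integrals over the unit cube *)

Section lower_integral.
Local Open Scope ereal_scope.
Import HBNNSimple.

(** The integral of a nonnegative function is by definition a supremum over the simple
    functions below it, hence monotone even on functions that are not measurable.  This
    dispenses with the measurability of lattice point counts in the entries of the
    unipotent matrix. *)
Lemma ge0_le_integral_any d (T : measurableType d) (R : realType)
    (mu : {measure set T -> \bar R}) (D : set T) (f g : T -> \bar R) :
  (forall x, 0 <= f x) -> (forall x, f x <= g x) ->
  \int[mu]_(x in D) f x <= \int[mu]_(x in D) g x.
Proof.
move=> f0 fg; have g0 x : 0 <= g x by exact: le_trans (f0 x) (fg x).
rewrite !ge0_integralE//; apply: le_ereal_sup => _ [h hf <-].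
exists h => // x; apply: le_trans (hf x) _.
by rewrite /patch; case: ifP.
Qed.

Variable R : realType.
Local Notation mu := (@lebesgue_measure R).
Local Notation RM := (measurableTypeR R).

Lemma measurable_unit_cube n : measurable (@unit_cube R n : set (n.-tuple RM)).
Proof.
rewrite (_ : @unit_cube R n = \bigcap_(i in [set: 'I_n])
    ((fun t : n.-tuple RM => tnth t i) @^-1` `[0%R, 1%R[)).
  apply: fin_bigcap_measurable => // i _; rewrite -[X in measurable X]setTI.
  exact: measurable_tnth.
apply/seteqP; split => t /= ht i; first by move=> _ /=; rewrite in_itv/=; exact: ht.
by have := ht i Logic.I; rewrite /= in_itv.
Qed.

Lemma unit_cube_cons n (x : R) (t : n.-tuple R) :
  unit_cube [tuple of x :: t] <-> (0 <= x < 1)%R /\ unit_cube t.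
Proof.
split=> [h|[h1 h2] i]; last by have [j ->|->] := unliftP ord0 i; rewrite ?tnthS.
by split=> [|i]; [exact: (h ord0)|have := h (lift ord0 i); rewrite tnthS].
Qed.

(** The integrand takes sequences, because the entries of the unipotent matrix are split
    into columns of varying lengths. *)
Definition cube_integral n (f : seq R -> \bar R) : \bar R :=
  \int[lebesgue_tuple R n]_(t in @unit_cube R n) f (tval t).

Lemma cube_integral0 (f : seq R -> \bar R) : cube_integral 0 f = f [::].
Proof.
rewrite /cube_integral (eq_integral (cst (f [::]))); last first.
  by move=> t _; rewrite (tuple0 t).
rewrite -[LHS]/(\int[dirac ([tuple] : 0.-tuple RM)]_(t in @unit_cube R 0) cst (f [::]) t).
rewrite integral_dirac//; last exact: measurable_unit_cube.
by rewrite diracE mem_set ?mul1e// => -[].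
Qed.

Lemma tonelli_tuple n (f : n.+1.-tuple RM -> \bar R) :
  measurable_fun [set: n.+1.-tuple RM] f -> (forall t, 0 <= f t) ->
  \int[lebesgue_tuple R n.+1]_t f t =
  \int[mu]_x \int[lebesgue_tuple R n]_t f [tuple of x :: t].
Proof.
move=> mf f0.
rewrite -[LHS]/(\int[pushforward (mu \x lebesgue_tuple R n) (@pair_cons R n)]_t f t).
rewrite ge0_integral_pushforward//; last exact: measurable_pair_cons.
rewrite preimage_setT fubini_tonelli1//; last by move=> p; exact: f0.
by apply: measurableT_comp => //; exact: measurable_pair_cons.
Qed.

(** The half of Tonelli's theorem that survives without measurability: a simple function
    below f is measurable, so its integral is iterated, and [ge0_le_integral_any]
    applies. *)
Lemma cube_integral_consE n (f : seq R -> \bar R) : (forall s, 0 <= f s) ->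
  cube_integral n.+1 f <=
  \int[mu]_(x in `[0%R, 1%R[) cube_integral n (fun s => f (x :: s)).
Proof.
move=> f0; rewrite /cube_integral [leLHS]ge0_integralE//.
apply: ge_ereal_sup => _ [h hf <-].
have -> : sintegral (lebesgue_tuple R n.+1) h = \int[lebesgue_tuple R n.+1]_t (h t)%:E.
  by rewrite integral_nnsfun// patch_setT.
have mh : measurable_fun [set: n.+1.-tuple RM] (fun t => (h t)%:E).
  exact/measurable_EFinP.
have h0 t : 0 <= (h t)%:E by rewrite lee_fin.
rewrite (tonelli_tuple mh h0).
rewrite [leRHS]integral_mkcond; apply: ge0_le_integral_any => x.
  by apply: integral_ge0 => t _; rewrite lee_fin.
rewrite patchE; case: ifPn => [_|].
  rewrite [leRHS]integral_mkcond; apply: ge0_le_integral_any => t; first by rewrite lee_fin.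
  apply: le_trans (hf _) _; rewrite !patchE; case: ifPn => [|_]; last first.
    by case: ifPn.
  by rewrite !inE => /unit_cube_cons[_ ht]; rewrite mem_set.
rewrite notin_setE /= in_itv/= => xn.
rewrite integral0_eq// => t _; apply/eqP; rewrite eq_le h0 andbT.
by apply: le_trans (hf _) _; rewrite patchE memNset// => /unit_cube_cons[].
Qed.

Lemma cube_integral_ge0 n (f : seq R -> \bar R) : (forall s, 0 <= f s) ->
  0 <= cube_integral n f.
Proof. by move=> f0; apply: integral_ge0. Qed.

End lower_integral.

Section translation.
Local Open Scope ereal_scope.
Variable R : realType.
Local Notation mu := (@lebesgue_measure R).
Local Notation RM := (measurableTypeR R).

Lemma measurable_addr (v : R) : measurable_fun [set: RM] (fun x : RM => (x + v)%R : RM).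
Proof. by apply: measurable_funD => //; exact: measurable_cst. Qed.

(** Lebesgue measure is c times its own image under x |-> c x + v, since the two agree on
    intervals. *)
Lemma integral_affine1 (c v : R) (f : RM -> \bar R) : (0 < c)%R ->
  measurable_fun setT f -> (forall x, 0 <= f x) ->
  \int[mu]_x f (c * x + v)%R = (c^-1)%:E * \int[mu]_x f x.
Proof.
move=> c0 mf f0; pose phi : RM -> RM := fun x => (c * x + v)%R.
have mphi : measurable_fun setT phi.
  by apply: measurable_funD => //; exact: measurable_funM.
pose phim : {mfun RM >-> RM} := HB.pack phi (isMeasurableFun.Build _ _ _ _ _ mphi).
have cn : (0 <= c)%R := ltW c0.
have nuE A : measurable A -> mu A = c%:E * mu (phi @^-1` A).
  move=> mA; apply: (@lebesgue_measure_unique R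
    (mscale (NngNum cn) (pushforward mu phim))) => // X [[a b] _ <-].
  rewrite -[RHS]/(c%:E * mu (phi @^-1` `]a, b]%classic)) /=.
  rewrite (_ : phi @^-1` `]a, b]%classic = `](c^-1 * (a - v))%R, (c^-1 * (b - v))%R]%classic).
    rewrite !lebesgue_measure_itv/= !lte_fin ltr_pM2l ?invr_gt0// ltrD2r.
    case: ifPn => // ab; last by rewrite mule0.
    rewrite -!EFinB -EFinM; congr EFin; field; by rewrite gt_eqF.
  by apply/seteqP; split => x /=; rewrite !in_itv/= /phi ltr_pdivrMl// ler_pdivlMl// ltrBlDr lerBrDr.
rewrite [X in _ = _ * X](@eq_measure_integral _ _ _ _
  (mscale (NngNum cn) (pushforward mu phim))); last first.
  by move=> A mA _; exact: nuE.
rewrite ge0_integral_mscale// muleA -EFinM/= mulVf ?gt_eqF// mul1e.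
by rewrite ge0_integral_pushforward.
Qed.

Lemma integral_shift (v : R) (f : RM -> \bar R) : measurable_fun setT f ->
  (forall x, 0 <= f x) -> \int[mu]_x f (x + v)%R = \int[mu]_x f x.
Proof.
move=> mf f0; have := integral_affine1 v (@ltr01 R) mf f0.
by rewrite invr1 mul1e => <-; apply: eq_integral => x _; rewrite mul1r.
Qed.

Lemma integral_set_shift (v : R) (A : set RM) (f : RM -> \bar R) :
  measurable A -> measurable_fun setT f -> (forall x, 0 <= f x) ->
  \int[mu]_(x in A) f x = \int[mu]_(x in (fun x => (x + v)%R) @^-1` A) f (x + v)%R.
Proof.
move=> mA mf f0; rewrite integral_mkcond -(integral_shift v).
- by rewrite [RHS]integral_mkcond.
- exact/(measurable_restrictT _ _).1/(measurable_funS measurableT).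
- by move=> x; rewrite patchE; case: ifP.
Qed.

Lemma integral_period_shift (v : R) (f : RM -> \bar R) : measurable_fun setT f ->
  (forall x, 0 <= f x) -> (forall x (z : int), f (x + z%:~R)%R = f x) ->
  \int[mu]_(x in `[0%R, 1%R[) f (x + v)%R = \int[mu]_(x in `[0%R, 1%R[) f x.
Proof.
move=> mf f0 fp.
wlog /andP[v0 v1] : v / (0 <= v < 1)%R => [H|].
  have /andP[h1] := floor_itv v; rewrite intrD => h2.
  rewrite -(H (v - (Num.floor v)%:~R)%R); last by apply/andP; split; lra.
  apply: eq_integral => x _.
  by rewrite -[in LHS](subrK (Num.floor v)%:~R v) addrA fp.
have split2 (a b c : R) : (a <= b)%R -> (b <= c)%R ->
   \int[mu]_(x in `[a, c[) f x = \int[mu]_(x in `[a, b[) f x + \int[mu]_(x in `[b, c[) f x.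
  move=> ab bc.
  rewrite (@itv_bndbnd_setU _ _ (BLeft a) (BLeft b) (BLeft c))//.
  rewrite ge0_integral_setU//; first exact: measurable_funS mf.
  apply/disj_setPRL => z/=; rewrite !in_itv/= => /andP[bz _]; apply/negP.
  by rewrite negb_and -!leNgt bz orbT.
have -> : \int[mu]_(x in `[0%R, 1%R[) f (x + v)%R = \int[mu]_(x in `[v, (1 + v)%R[) f x.
  rewrite [RHS](integral_set_shift v)//; congr (integral _ _ _).
  by apply/seteqP; split => x /=; rewrite !in_itv/= ltrD2r lerDr.
rewrite (split2 0 v 1)%R ?(ltW v1)// (split2 v 1 (1 + v))%R ?(ltW v1) ?lerDl//.
rewrite addeC; congr (_ + _).
rewrite (integral_set_shift 1)//.
have -> : (fun x : R => x + 1)%R @^-1` `[1%R, (1 + v)%R[%classic = `[0%R, v[%classic.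
  by apply/seteqP; split => x /=; rewrite !in_itv/= (addrC 1%R) ltrD2r lerDr.
by apply: eq_integral => x _; rewrite -[in RHS](fp x 1%:Z).
Qed.

(** On functions that are not measurable it may exceed [cube_integral], but it can be cut
    at any coordinate ([iter_integral_cat]). *)
Fixpoint iter_integral n (f : seq R -> \bar R) : \bar R :=
  if n is n'.+1 then \int[mu]_(x in `[0%R, 1%R[) iter_integral n' (fun s => f (x :: s))
  else f [::].

Lemma iter_integral_ge0 n (f : seq R -> \bar R) : (forall s, 0 <= f s) ->
  0 <= iter_integral n f.
Proof. by elim: n f => //= n IH f f0; apply: integral_ge0 => x _; exact: IH. Qed.

Lemma le_iter_integral n (f g : seq R -> \bar R) : (forall s, 0 <= f s) ->
  (forall s, size s = n -> f s <= g s) -> iter_integral n f <= iter_integral n g.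
Proof.
elim: n f g => /= [|n IH] f g f0 fg; first exact: fg.
apply: ge0_le_integral_any => x; first exact: iter_integral_ge0.
by apply: IH => // s sn; apply: fg; rewrite /= sn.
Qed.

Lemma iter_integral_cat p q (f : seq R -> \bar R) :
  iter_integral (p + q) f =
  iter_integral p (fun s => iter_integral q (fun s' => f (s ++ s'))).
Proof. by elim: p f => //= p IH f; apply: eq_integral => x _; rewrite IH. Qed.

Lemma cube_integral_le_iter n (f : seq R -> \bar R) : (forall s, 0 <= f s) ->
  cube_integral n f <= iter_integral n f.
Proof.
elim: n f => [|n IH] f f0; first by rewrite cube_integral0.
apply: le_trans (cube_integral_consE _ f0) _.
apply: ge0_le_integral_any => x; first exact: cube_integral_ge0.
exact: IH.
Qed.

Definition tuple_measurable n (f : seq R -> \bar R) :=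
  measurable_fun [set: n.-tuple RM] (fun t => f (tval t)).

Lemma tuple_measurable_cons n (f : seq R -> \bar R) (x : R) :
  tuple_measurable n.+1 f -> tuple_measurable n (fun s => f (x :: s)).
Proof.
move=> mf.
apply: (measurableT_comp mf 
  (_ : measurable_fun [set: n.-tuple RM]
    (fun t : n.-tuple RM => [tuple of x :: t] : n.+1.-tuple RM))).
by apply: measurable_cons.
Qed.

Lemma cube_integral_cons n (f : seq R -> \bar R) : tuple_measurable n.+1 f ->
  (forall s, 0 <= f s) -> cube_integral n.+1 f =
  \int[mu]_(x in `[0%R, 1%R[) cube_integral n (fun s => f (x :: s)).
Proof.
move=> mf f0; rewrite /cube_integral integral_mkcond.
have m1 : measurable_fun [set: n.+1.-tuple RM]
    ((fun t : n.+1.-tuple RM => f (tval t)) \_ (@unit_cube R n.+1)).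
  apply/(measurable_restrictT _ _).1; first exact: measurable_unit_cube.
  exact: (measurable_funS measurableT).
rewrite (tonelli_tuple m1); last by move=> t; rewrite patchE; case: ifP.
rewrite [RHS]integral_mkcond; apply: eq_integral => x _.
rewrite [RHS]patchE; case: ifPn => [|].
  rewrite inE/= in_itv/= => x01; rewrite [RHS]integral_mkcond.
  apply: eq_integral => t _; rewrite !patchE; congr (if _ then _ else _).
  by apply/idP/idP; rewrite !inE unit_cube_cons; [case|].
rewrite notin_setE/= in_itv/= => x01; rewrite integral0_eq// => t _.
by rewrite patchE memNset// => /unit_cube_cons[].
Qed.

Lemma measurable_cube_integral_cons n (f : seq R -> \bar R) : tuple_measurable n.+1 f ->
  (forall s, 0 <= f s) ->
  measurable_fun [set: RM] (fun x => cube_integral n (fun s => f (x :: s))).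
Proof.
move=> mf f0.
pose f1 (p : RM * n.-tuple RM) : \bar R := f (p.1 :: p.2).
pose D : set (RM * n.-tuple RM) := [set p | unit_cube p.2].
pose g : RM * n.-tuple RM -> \bar R := f1 \_ D.
have mD : measurable D.
  rewrite -[X in measurable X]setTI; apply: measurable_snd => //.
  exact: measurable_unit_cube.
have mf1 : measurable_fun [set: RM * n.-tuple RM] f1.
  exact: (measurableT_comp mf (@measurable_pair_cons R n)).
have mg : measurable_fun [set: RM * n.-tuple RM] g.
  have mfD : measurable_fun D f1 by apply: measurable_funS mf1.
  exact: ((measurable_restrictT f1 mD).1 mfD).
have g0 p : 0 <= g p by rewrite /g patchE; case: ifP => // _; exact: f0.
have := @measurable_fun_fubini_tonelli_F _ _ _ _ _ (lebesgue_tuple R n) g mg g0.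
congr (measurable_fun _ _); apply/funext => x.
rewrite /fubini_F /cube_integral [RHS]integral_mkcond.
apply: eq_integral => t _; by rewrite /g !patchE.
Qed.

Lemma iter_integralE n (f : seq R -> \bar R) : tuple_measurable n f ->
  (forall s, 0 <= f s) -> cube_integral n f = iter_integral n f.
Proof.
elim: n f => [|n IH] f mf f0; first exact: cube_integral0.
rewrite cube_integral_cons//=; apply: eq_integral => x _.
by apply: IH => //; exact: tuple_measurable_cons.
Qed.

Fixpoint sadd (v : nat -> R) (s : seq R) : seq R :=
  if s is x :: s' then (x + v 0)%R :: sadd (fun i => v i.+1) s' else [::].

Lemma size_sadd v s : size (sadd v s) = size s.
Proof. by elim: s v => //= x s IH v; rewrite IH. Qed.

Lemma nth_sadd v s i : (i < size s)%N -> nth 0%R (sadd v s) i = (nth 0%R s i + v i)%R.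
Proof. by elim: s v i => //= x s IH v [|i]//= /IH ->. Qed.

Lemma sadd_tupleP v n (t : n.-tuple R) : size (sadd v t) == n.
Proof. by rewrite size_sadd size_tuple. Qed.

Lemma tuple_measurable_shift n (f : seq R -> \bar R) v :
  tuple_measurable n f -> tuple_measurable n (f \o sadd v).
Proof.
move=> mf; pose g (t : n.-tuple RM) : n.-tuple RM := Tuple (sadd_tupleP v t).
apply: (measurableT_comp mf (_ : measurable_fun setT g)).
apply/measurable_fun_tnthP => i.
rewrite (_ : _ \o _ = (fun t : n.-tuple RM => (tnth t i + v i)%R : RM)); last first.
  by apply/funext => t /=; rewrite !(tnth_nth 0%R) nth_sadd ?size_tuple.
by apply: measurable_funD => //; exact: measurable_tnth.
Qed.

Lemma cube_integral_shift n (f : seq R -> \bar R) (v : nat -> R) :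
  tuple_measurable n f -> (forall s, 0 <= f s) ->
  (forall s (z : nat -> int), f (sadd (fun i => (z i)%:~R) s) = f s) ->
  cube_integral n (f \o sadd v) = cube_integral n f.
Proof.
elim: n f v => [|n IH] f v mf f0 fp; first by rewrite !cube_integral0.
have s0 s : sadd (fun=> 0%R) s = s by elim: s => //= x s ->; rewrite addr0.
have fpx x s (z : nat -> int) : f (x :: sadd (fun i => (z i)%:~R) s) = f (x :: s).
  have := fp (x :: s) (fun i => if i is i'.+1 then z i' else 0%Z).
  by rewrite /= addr0.
rewrite (cube_integral_cons (tuple_measurable_shift v mf)); last by move=> s; exact: f0.
rewrite (eq_integral (fun x : RM => cube_integral n (fun s => f ((x + v 0)%R :: s)))); last first.
  move=> x _; rewrite -(IH (fun s => f ((x + v 0)%R :: s)) (fun i => v i.+1))//.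
  exact: tuple_measurable_cons.
rewrite (integral_period_shift (v 0%N) (f := fun x : RM => cube_integral n (fun s => f (x :: s)))).
- by rewrite cube_integral_cons.
- exact: measurable_cube_integral_cons.
- by move=> x; exact: cube_integral_ge0.
- move=> x z; apply: eq_integral => t _.
  by have := fp (x :: t) (fun i => if i is i'.+1 then 0%Z else z); rewrite /= s0.
Qed.

End translation.

Section cube_mean.
Variable R : realType.
Local Notation RM := (measurableTypeR R).

Definition bounded_measurable n (G : seq R -> R) :=
  measurable_fun [set: n.-tuple RM] (fun t => G (tval t) : RM) /\
  exists M : R, forall s, `|G s| <= M.

Definition cube_mean n (G : seq R -> R) : R :=
  (\int[lebesgue_tuple R n]_(t in @unit_cube R n) G (tval t))%R.

Lemma cube_measure n : lebesgue_tuple R n (@unit_cube R n) = 1%E.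
Proof.
have H := @lebesgue_tuple_box R n (fun=> `[0, 1[%classic) (fun=> measurable_itv _).
apply: etrans (etrans _ H) _; last first.
  by rewrite big1// => i _; rewrite lebesgue_measure_itv/= lte_fin ltr01 oppr0 adde0.
by congr (lebesgue_tuple R n _).
Qed.

Lemma bounded_measurable_integrable n G : bounded_measurable n G ->
  (lebesgue_tuple R n).-integrable (@unit_cube R n) (fun t => (G (tval t))%:E).
Proof.
move=> [mG [M GM]].
apply: (@measurable_bounded_integrable _ (n.-tuple RM)).
- exact: measurable_unit_cube.
- by rewrite [ltLHS](cube_measure n) ltry.
- by apply: measurable_funS mG.
- exists M; split; first exact: num_real.
  by move=> y My t _ /=; exact: le_trans (GM _) (ltW My).
Qed.

Lemma cube_meanE n G : bounded_measurable n G ->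
  cube_integral n (fun s => (G s)%:E) = (cube_mean n G)%:E.
Proof.
move=> bG; rewrite /cube_mean /Rintegral fineK//.
by apply: integrable_fin_num => //; [exact: measurable_unit_cube|exact: bounded_measurable_integrable].
Qed.

Lemma bounded_measurableM n G H : bounded_measurable n G -> bounded_measurable n H ->
  bounded_measurable n (fun s => G s * H s).
Proof.
move=> [mG [M GM]] [mH [N HN]]; split; first exact: measurable_funM.
by exists (M * N) => s; rewrite normrM ler_pM.
Qed.

Lemma bounded_measurableD n G H : bounded_measurable n G -> bounded_measurable n H ->
  bounded_measurable n (fun s => G s + H s).
Proof.
move=> [mG [M GM]] [mH [N HN]]; split; first exact: measurable_funD.
by exists (M + N) => s; rewrite (le_trans (ler_normD _ _)) ?lerD.
Qed.

Lemma bounded_measurable_cst n c : bounded_measurable n (fun=> c).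
Proof. by split; [exact: measurable_cst|exists `|c|]. Qed.

Lemma bounded_measurable_sum n (I : eqType) (r : seq I) (G : I -> seq R -> R) :
  (forall i, i \in r -> bounded_measurable n (G i)) ->
  bounded_measurable n (fun s => \sum_(i <- r) G i s).
Proof.
elim: r => [|i r IH] h.
  by under eq_fun do rewrite big_nil; exact: bounded_measurable_cst.
under eq_fun do rewrite big_cons; apply: bounded_measurableD.
  by apply: h; rewrite mem_head.
by apply: IH => j jr; apply: h; rewrite inE jr orbT.
Qed.

Lemma cube_meanD n G H : bounded_measurable n G -> bounded_measurable n H ->
  cube_mean n (fun s => G s + H s) = cube_mean n G + cube_mean n H.
Proof.
move=> bG bH; rewrite /cube_mean RintegralD//; first exact: measurable_unit_cube.
  exact: bounded_measurable_integrable.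
exact: bounded_measurable_integrable.
Qed.

Lemma cube_mean_cst n c : cube_mean n (fun=> c) = c.
Proof.
rewrite /cube_mean Rintegral_cst; last exact: measurable_unit_cube.
by rewrite [X in fine X](cube_measure n) mulr1.
Qed.

Lemma cube_mean_sum n (I : eqType) (r : seq I) (G : I -> seq R -> R) :
  (forall i, i \in r -> bounded_measurable n (G i)) ->
  cube_mean n (fun s => \sum_(i <- r) G i s) = \sum_(i <- r) cube_mean n (G i).
Proof.
elim: r => [|i r IH] h.
  by under eq_fun do rewrite big_nil; rewrite cube_mean_cst big_nil.
under eq_fun do rewrite big_cons; rewrite cube_meanD.
- by rewrite big_cons IH// => j jr; apply: h; rewrite inE jr orbT.
- by apply: h; rewrite mem_head.
- by apply: bounded_measurable_sum => j jr; apply: h; rewrite inE jr orbT.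
Qed.

Lemma cube_mean_norm n G M : bounded_measurable n G -> (forall s, `|G s| <= M) ->
  `|cube_mean n G| <= M.
Proof.
move=> bG GM; have iG := bounded_measurable_integrable bG.
apply: le_trans (le_normr_Rintegral _ iG) _; first exact: measurable_unit_cube.
rewrite -[leRHS](cube_mean_cst n); apply: le_Rintegral => //.
- exact: measurable_unit_cube.
- exact: integrable_norm.
- exact: (bounded_measurable_integrable (bounded_measurable_cst n M)).
Qed.

Lemma bounded_measurable_shift n G v : bounded_measurable n G ->
  bounded_measurable n (G \o sadd v).
Proof.
move=> [mG [M GM]]; split; last by exists M => s; exact: GM.
have := @tuple_measurable_shift R n (fun s => (G s)%:E) v.
rewrite /tuple_measurable => /(_ _)/measurable_EFinP; apply.
exact/measurable_EFinP.
Qed.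

Lemma cube_mean_shift n G v : bounded_measurable n G ->
  (forall s (z : nat -> int), G (sadd (fun i => (z i)%:~R) s) = G s) ->
  cube_mean n (G \o sadd v) = cube_mean n G.
Proof.
move=> bG Gp; have [mG [M GM]] := bG.
(* the translation invariance is known for nonnegative functions, hence the constant M *)
have bGM : bounded_measurable n (fun s => G s + M).
  by apply: bounded_measurableD => //; exact: bounded_measurable_cst.
have bGs := bounded_measurable_shift v bG.
have bGMs := bounded_measurable_shift v bGM.
apply: (@addIr _ M); rewrite -{1}[M](cube_mean_cst n) -{2}[M](cube_mean_cst n).
rewrite -!cube_meanD//; try exact: bounded_measurable_cst.
apply: EFin_inj; rewrite -!cube_meanE//.
apply: (@cube_integral_shift R n (fun s => (G s + M)%:E)).
- by apply/measurable_EFinP; have [] := bGM.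
- by move=> s; rewrite lee_fin; have := GM s; rewrite ler_norml => /andP[]; lra.
- by move=> s z; rewrite Gp.
Qed.

End cube_mean.

(** * Correlations of equidistributed functions of linear forms *)

Section pairs.
Variable R : realType.
Local Notation RM := (measurableTypeR R).
Implicit Types (n m p : seq int) (c v : nat -> R).

(** The reversal puts the coordinates back in increasing order: sequences of integers
    have their latest coordinate first. *)
Definition dot n c : R := \sum_(i < size n) (nth 0 (rev n) i)%:~R * c i.

Lemma dotD n c v : dot n (fun i => c i + v i) = dot n c + dot n v.
Proof. by rewrite /dot -big_split; apply: eq_bigr => i _ /=; rewrite mulrDr. Qed.

Lemma dotZ n (r : R) v : dot n (fun i => r * v i) = r * dot n v.
Proof. by rewrite /dot mulr_sumr; apply: eq_bigr => i _; rewrite mulrCA. Qed.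

Lemma eq_dot n c v : (forall i, (i < size n)%N -> c i = v i) -> dot n c = dot n v.
Proof. by move=> h; apply: eq_bigr => i _; rewrite h. Qed.

Lemma dot_int n (z : nat -> int) : exists w : int, dot n (fun i => (z i)%:~R) = w%:~R.
Proof.
exists (\sum_(i < size n) nth 0 (rev n) i * z i).
by rewrite rmorph_sum; apply: eq_bigr => i _; rewrite rmorphM.
Qed.

Lemma dot_delta n (i : nat) (r : R) : (i < size n)%N ->
  dot n (fun j => if j == i then r else 0) = (nth 0 (rev n) i)%:~R * r.
Proof.
move=> i_n; rewrite /dot (bigD1 (Ordinal i_n))//= eqxx big1 ?addr0// => j ji.
by rewrite -val_eqE/= in ji; rewrite (negbTE ji) mulr0.
Qed.

Lemma dot_map (a : int) n c : dot (map ( *%R a) n) c = a%:~R * dot n c.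
Proof.
rewrite /dot size_map mulr_sumr; apply: eq_bigr => i _.
by rewrite -map_rev (nth_map 0) ?size_rev// intrM mulrA.
Qed.

Lemma dot_sadd n v s : dot n (nth 0 (sadd v s)) =
  dot n (nth 0 s) + dot n (fun i => if (i < size s)%N then v i else 0).
Proof.
rewrite -dotD; apply: eq_dot => i _; case: ifP => h; first by rewrite nth_sadd.
by rewrite !nth_default ?size_sadd ?addr0// leqNgt h.
Qed.

(** Quantifies that F has mean zero on the circle: its mean over any coset of
    (1 / a) Z / Z is at most K / a. *)
Definition equidistributed (K : R) (F : R -> R) :=
  [/\ measurable_fun [set: RM] (F : RM -> RM),
      forall (x : R) (z : int), F (x + z%:~R) = F x &
      forall (x : R) (a : nat), (0 < a)%N -> `|\sum_(i < a) F (x + i%:R / a%:R)| <= K].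

Lemma equidistributed_le K F x : equidistributed K F -> `|F x| <= K.
Proof. by move=> [_ _ /(_ x 1%N isT)]; rewrite big_ord1 mul0r addr0. Qed.

Lemma equidistributed_shift K F (c : R) : equidistributed K F ->
  equidistributed K (fun x => F (x + c)).
Proof.
move=> [mF Fp Fa]; split.
- exact: (measurableT_comp mF (measurable_addr _)).
- by move=> x w; rewrite addrAC Fp.
- move=> x b b0; rewrite (eq_bigr (fun k : 'I_b => F (x + c + k%:R / b%:R))).
    exact: Fa.
  by move=> k _; rewrite addrAC.
Qed.

Lemma measurable_dot J n : measurable_fun [set: J.-tuple RM]
  ((fun t => dot n (nth 0 (tval t))) : J.-tuple RM -> RM).
Proof.
rewrite /dot; apply: measurable_sum => i.
apply: measurable_funM; first exact: measurable_cst.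
have [iJ|Ji] := ltnP i J.
  rewrite (_ : (fun _ => _) = (fun t => tnth t (Ordinal iJ))); first exact: measurable_tnth.
  by apply/funext => t; rewrite (tnth_nth 0).
rewrite (_ : (fun _ => _) = cst 0); first exact: measurable_cst.
by apply/funext => t; rewrite nth_default// size_tuple.
Qed.

Lemma bounded_measurable_dot K F J n : equidistributed K F ->
  bounded_measurable J (fun s => F (dot n (nth 0 s))).
Proof.
move=> eF; have [mF _ _] := eF; split; last first.
  by exists K => s; exact: equidistributed_le.
exact: (measurableT_comp mF (@measurable_dot J n)).
Qed.

(** Translation by v fixes the value of the form n modulo 1 and moves that of m by
    1 / a. *)
Definition reaches n m (a : nat) :=
  exists v : nat -> R, exists z z' : int, dot n v = z%:~R /\ dot m v = a%:R^-1 + z'%:~R.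

(** Translating by the multiples i v, i < a, preserves the mean and, taken together,
    replaces G by its mean over a coset of (1 / a) Z, which is at most K / a. *)
Lemma mean_pair K F G J n m a : equidistributed K F -> equidistributed K G ->
  size n = J -> size m = J -> (0 < a)%N -> reaches n m a ->
  `|cube_mean J (fun s => F (dot n (nth 0 s)) * G (dot m (nth 0 s)))| <= K ^+ 2 / a%:R.
Proof.
move=> eF eG nJ mJ a0 [v [z [z' [nv mv]]]].
have [_ Fp _] := eF; have [_ Gp Ga] := eG.
pose P s := F (dot n (nth 0 s)) * G (dot m (nth 0 s)).
have bP : bounded_measurable J P.
  by apply: bounded_measurableM; apply: bounded_measurable_dot; [exact: eF|exact: eG].
have Pp s (w : nat -> int) : P (sadd (fun i => (w i)%:~R) s) = P s.
  rewrite /P !dot_sadd.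
  have e q : dot q (fun i => if (i < size s)%N then (w i)%:~R else 0) =
     dot q (fun i => (if (i < size s)%N then w i else 0)%:~R).
    by apply: eq_dot => i _; case: ifP.
  rewrite !e; have [w1 ->] := dot_int n (fun i => if (i < size s)%N then w i else 0).
  have [w2 ->] := dot_int m (fun i => if (i < size s)%N then w i else 0).
  by rewrite Fp Gp.
rewrite ler_pdivlMr ?ltr0n// -[X in _ * X](@ger0_norm _ a%:R)// -normrM.
have e (i : 'I_a) : cube_mean J P = cube_mean J (fun s =>
    F (dot n (nth 0 s)) * G (dot m (nth 0 s) + i%:R / a%:R)).
  rewrite -(cube_mean_shift (fun k => i%:R * v k) bP Pp).
  apply: eq_Rintegral => t _; rewrite /P /= !dot_sadd.
  have h q : size q = J -> dot q (fun k => if (k < size (tval t))%N then i%:R * v k else 0) =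
     i%:R * dot q v.
    by move=> qJ; rewrite -dotZ; apply: eq_dot => k; rewrite size_tuple qJ => ->.
  rewrite !h// nv mv; congr (_ * _).
    have -> : i%:R * z%:~R = (i%:Z * z)%:~R :> R by rewrite intrM.
    by rewrite Fp.
  have -> : i%:R * (a%:R^-1 + z'%:~R) = i%:R / a%:R + (i%:Z * z')%:~R :> R.
    by rewrite mulrDr intrM.
  by rewrite addrA Gp.
have bi i : bounded_measurable J (fun s =>
    F (dot n (nth 0 s)) * G (dot m (nth 0 s) + i%:R / a%:R)).
  apply: bounded_measurableM; first exact: bounded_measurable_dot eF.
  exact: (bounded_measurable_dot J m (equidistributed_shift (i%:R / a%:R) eG)).
have -> : cube_mean J P * a%:R = cube_mean J (fun s =>
    \sum_(i <- enum 'I_a) F (dot n (nth 0 s)) * G (dot m (nth 0 s) + i%:R / a%:R)).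
  rewrite cube_mean_sum => [|i _]; last exact: bi.
  by rewrite big_enum/= -(eq_bigr _ (fun i _ => e i)) sumr_const card_ord mulr_natr.
apply: cube_mean_norm; first by apply: bounded_measurable_sum => i _; exact: bi.
move=> s; rewrite -mulr_sumr normrM expr2 ler_pM//; first exact: equidistributed_le.
by rewrite big_enum; exact: Ga.
Qed.

End pairs.

Section second_moment.
Variable R : realType.
Local Notation RM := (measurableTypeR R).
Implicit Types (n m p : seq int).

Definition null n := all (pred1 (0 : int)) n.

Lemma nullPn n : ~~ null n -> exists2 i, (i < size n)%N & nth 0 (rev n) i != 0.
Proof.
rewrite /null -(all_rev _ n) => /allPn[x xn x0]; exists (index x (rev n)).
  by rewrite -(size_rev n) index_mem.
by rewrite nth_index.
Qed.

Lemma null_nth n i : null n -> nth 0 (rev n) i = 0.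
Proof.
rewrite /null -(all_rev _ n) => /allP n0; have [h|h] := ltnP i (size (rev n)).
  exact/eqP/n0/mem_nth.
by rewrite nth_default.
Qed.

(** If u a + w b = 1, then a vector v with p.v = w / a works, since w b / a is 1 / a - u.
    The sign of a is absorbed in v. *)
Lemma reaches_multiple p (a b : int) : coprimez a b -> a != 0 -> ~~ null p ->
  reaches R (map ( *%R a) p) (map ( *%R b) p) `|a|%N.
Proof.
move=> /coprimezP[[u w] /= uw] a0 /nullPn[i ip pi0].
have aR0 : a%:~R != 0 :> R by rewrite intr_eq0.
have pR0 : (nth 0 (rev p) i)%:~R != 0 :> R by rewrite intr_eq0.
pose s : int := Num.sg a.
have sa : s%:~R / a%:~R = (`|a|%N%:R)^-1 :> R.
  rewrite pmulrn abszE /s; have [a1|a1|a1] := ltgtP a 0.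
  - by rewrite ltr0_sg// ltr0_norm// !intrN invrN mulN1r.
  - by rewrite gtr0_sg// gtr0_norm// mul1r.
  - by rewrite a1 eqxx in a0.
exists (fun j => if j == i then (s * w)%:~R / (a%:~R * (nth 0 (rev p) i)%:~R) else 0).
exists (s * w), (- (s * u)); rewrite !dot_map !dot_delta//; split.
  by field; rewrite aR0 pR0.
rewrite -sa.
have -> : b%:~R * ((nth 0 (rev p) i)%:~R * ((s * w)%:~R / (a%:~R * (nth 0 (rev p) i)%:~R))) =
    s%:~R * (w * b)%:~R / a%:~R :> R.
  by rewrite !intrM; field; rewrite aR0 pR0.
have -> : (w * b) = 1 - u * a by rewrite -uw addrC addKr.
rewrite intrB intrN !intrM; field; exact: aR0.
Qed.

(** A nonzero 2 x 2 minor of the matrix with rows n and m allows one to prescribe both values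
    n.v and m.v. *)
Lemma reaches_minor n m i k (a : nat) : (i < size n)%N -> (k < size n)%N -> size m = size n ->
  nth 0 (rev n) i * nth 0 (rev m) k != nth 0 (rev n) k * nth 0 (rev m) i ->
  (0 < a)%N -> reaches R n m a.
Proof.
move=> i_n k_n mn; rewrite -subr_eq0 => D0 a0.
set x := nth 0 (rev n) in D0 *; set y := nth 0 (rev m) in D0 *.
have [D DE] : exists D : R, D = (x i)%:~R * (y k)%:~R - (x k)%:~R * (y i)%:~R by eexists.
have DR0 : D != 0 by rewrite DE -!intrM -intrB intr_eq0.
have aR0 : a%:R != 0 :> R by rewrite pnatr_eq0 -lt0n.
pose v1 (j : nat) : R := if j == i then - ((x k)%:~R / (a%:R * D)) else 0.
pose v2 (j : nat) : R := if j == k then (x i)%:~R / (a%:R * D) else 0.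
exists (fun j => v1 j + v2 j), 0, 0; rewrite !dotD !dot_delta ?mn//; split.
  by rewrite -/x; field; rewrite DR0 aR0.
rewrite -/y.
have -> : (y i)%:~R * - ((x k)%:~R / (a%:R * D)) + (y k)%:~R * ((x i)%:~R / (a%:R * D)) =
  ((x i)%:~R * (y k)%:~R - (x k)%:~R * (y i)%:~R) / (a%:R * D) by ring.
by rewrite -DE addr0; field; rewrite DR0 aR0.
Qed.

Lemma reaches_null n m (a : nat) : null n -> ~~ null m -> size m = size n -> (0 < a)%N ->
  reaches R n m a.
Proof.
move=> n0 /nullPn[k km mk0] mn a0.
have kn : (k < size n)%N by rewrite -mn.
have aR0 : a%:R != 0 :> R by rewrite pnatr_eq0 -lt0n.
exists (fun j => if j == k then (a%:R * (nth 0 (rev m) k)%:~R)^-1 else 0), 0, 0.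
rewrite !dot_delta// null_nth// mul0r addr0; split => //.
by field; rewrite aR0 intr_eq0.
Qed.

(** Two nonzero vectors either have a nonzero 2 x 2 minor or are multiples of a common
    vector by coprime integers, namely by their coordinates at one index divided by the
    gcd of these. *)
Lemma pair_cases n m : size n = size m ->
  [\/ null n && null m,
      (forall a, (0 < a)%N -> reaches R n m a),
      (forall a, (0 < a)%N -> reaches R m n a) |
      exists p (a b : int), [/\ a != 0, b != 0, ~~ null p & 
        [/\ n = map ( *%R a) p, m = map ( *%R b) p,
        reaches R n m `|a|%N & reaches R m n `|b|%N]]].
Proof.
move=> nm.
have [n0|n0] := boolP (null n); have [m0|m0] := boolP (null m).
- by apply: Or41.
- by apply: Or42 => a a0; apply: reaches_null.
- by apply: Or43 => a a0; apply: reaches_null.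
set x := nth 0 (rev n); set y := nth 0 (rev m).
have [H|/existsPn H] := boolP [exists i : 'I_(size n), exists k : 'I_(size n), x i * y k != x k * y i].
  apply: Or42 => a a0; have /existsP[i /existsP[k ik]] := H.
  exact: (@reaches_minor n m i k).
have {}H i k : (i < size n)%N -> (k < size n)%N -> x i * y k = x k * y i.
  move=> i_n k_n; have := H (Ordinal i_n) => /existsPn/(_ (Ordinal k_n)).
  by rewrite negbK => /eqP.
apply: Or44.
have [i im yi0] := nullPn m0; rewrite -/y in yi0.
have i_n : (i < size n)%N by rewrite nm.
have xi0 : x i != 0.
  have [k kn xk0] := nullPn n0.
  by apply: contraNneq (mulf_neq0 xk0 yi0) => xi; rewrite -(H i k)// xi mul0r.
pose g := gcdz (x i) (y i).
have g0 : g != 0 by rewrite gcdz_eq0 negb_and xi0.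
have [a xa] := dvdzP (dvdz_gcdl (x i) (y i)).
have [b yb] := dvdzP (dvdz_gcdr (x i) (y i)).
rewrite -/g in xa yb.
have a0 : a != 0 by apply: contraNneq xi0 => a0; rewrite xa a0 mul0r.
have b0 : b != 0 by apply: contraNneq yi0 => b0; rewrite yb b0 mul0r.
have cab : coprimez a b.
  have gg : gcdz a b * g = g.
    have gE : (`|g|%N : int) = g by rewrite gez0_abs.
    by rewrite -{1}gE mulz_gcdl -xa -yb.
  by apply/eqP/(mulIf g0); rewrite gg mul1r.
have ab k : (k < size n)%N -> x k * b = a * y k.
  move=> kn; have := H i k i_n kn; rewrite xa yb => h.
  by apply: (mulfI g0); rewrite !mulrA (mulrC g) (mulrC g) h; ring.
have ax k : (k < size n)%N -> (a %| x k)%Z.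
  move=> kn; rewrite -(Gauss_dvdzl _ cab); apply/dvdzP; exists (y k).
  by rewrite ab// mulrC.
pose p := map (fun z => (z %/ a)%Z) n.
have np : n = map ( *%R a) p.
  apply: (@eq_from_nth _ 0); first by rewrite !size_map.
  move=> k kn; rewrite (nth_map 0) ?size_map// (nth_map 0)// mulrC divzK//.
  have sk : (size n - k.+1 < size n)%N by rewrite ltn_subrL (leq_ltn_trans _ kn).
  by have := ax _ sk; rewrite /x nth_rev// subnSK// subKn ?(ltnW kn).
have mp : m = map ( *%R b) p.
  apply: (@eq_from_nth _ 0); first by rewrite !size_map nm.
  move=> k km; have kn : (k < size n)%N by rewrite nm.
  rewrite (nth_map 0) ?size_map//; apply: (mulfI a0).
  have sk : (size n - k.+1 < size n)%N by rewrite ltn_subrL (leq_ltn_trans _ kn).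
  have := ab _ sk; rewrite /x /y !nth_rev -?nm//.
  rewrite subnSK// subKn ?(ltnW kn)// => <-.
  by rewrite [in LHS]np (nth_map 0) ?size_map// mulrCA mulrC mulrA.
have p0 : ~~ null p.
  apply: contraNN n0 => /allP p0; rewrite np; apply/allP => z /mapP[w /p0/eqP -> ->].
  by rewrite /= mulr0.
exists p, a, b; split => //; split => //.
  by rewrite np mp; exact: reaches_multiple.
by rewrite np mp; apply: reaches_multiple => //; rewrite coprimez_sym.
Qed.

End second_moment.

Section second_moment_sum.
Variable R : realType.
Implicit Types (n m p : seq int) (S : seq (seq int)).

Lemma sum_pred1_uniq (T : eqType) (S : seq T) (x : T) : uniq S ->
  \sum_(n <- S) (n == x)%:R = (x \in S)%:R :> R.
Proof.
move=> uS; rewrite -natr_sum -(count_uniq_mem x uS) -sum1_count [in RHS]big_mkcond.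
by congr (_%:R); apply: eq_bigr => n _; rewrite /=; case: eqP.
Qed.

Lemma count_norm_le (A : seq int) (a : int) : uniq A -> a != 0 ->
  \sum_(b <- A | b != 0) (`|b| <= `|a|)%N%:R <= 4 * `|a|%N%:R :> R.
Proof.
move=> uA a0.
have a1 : 1 <= `|a|%N%:R :> R by rewrite ler1n absz_gt0.
pose B := [seq b <- A | (b != 0) && (`|b| <= `|a|)%N].
have -> : \sum_(b <- A | b != 0) (`|b| <= `|a|)%N%:R = (size B)%:R :> R.
  rewrite -natr_sum /B size_filter -sum1_count [in RHS]big_mkcondr/=.
  by congr (_%:R); apply: eq_bigr => b _; case: leqP.
have BW : (size B <= size (window 0 (`|a|%N%:R + 1 / 2 : R)))%N.
  apply: uniq_leq_size; first exact: filter_uniq.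
  move=> b; rewrite mem_filter mem_window addr0 => /andP[/andP[_ ba] _].
  have : `|b|%N%:R <= `|a|%N%:R :> R by rewrite ler_nat.
  by rewrite !(pmulrn _ `|b|%N) abszE intr_norm; lra.
have BR : (size B)%:R <= (size (window 0 (`|a|%N%:R + 1 / 2 : R)))%:R :> R by rewrite ler_nat.
have r0 : 0 <= `|a|%N%:R + 1 / 2 :> R by lra.
have := size_window 0 r0; rewrite ler_norml => /andP[_]; lra.
Qed.

(** 1 / max(|a|, |b|), or twice that when |a| = |b|. *)
Definition pair_weight (a b : int) : R :=
  (`|b| <= `|a|)%N%:R / `|a|%N%:R + (`|a| <= `|b|)%N%:R / `|b|%N%:R.

Lemma archimedean_eq0 (x c : R) : 0 <= x ->
  (forall a : nat, (0 < a)%N -> x <= c / a%:R) -> x = 0.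
Proof.
move=> x0 h; apply/eqP; rewrite eq_le x0 andbT leNgt; apply/negP => xp.
have c0 : 0 <= c by have := h 1%N isT; rewrite divr1; apply: le_trans.
have cx : 0 <= c / x by rewrite divr_ge0.
have := archi_boundP cx; set N := Num.bound _ => hN.
have N0 : (0 < N)%N.
  by rewrite lt0n; apply/eqP => N0; rewrite N0 ltNge cx in hN.
have := h N N0; rewrite ler_pdivlMr ?ltr0n//.
rewrite ltr_pdivrMr// in hN; rewrite mulrC; lra.
Qed.

Section pair_bound.
Variables (J : nat) (S : seq (seq int)) (F : seq int -> R -> R) (K : R) (A : seq int).
Hypothesis uS : uniq S.
Hypothesis uA : uniq A.
Hypothesis sizeS : forall n, n \in S -> size n = J.
Hypothesis eF : forall n, n \in S -> equidistributed K (F n).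
Hypothesis SA : forall p (a : int), a != 0 -> ~~ null p -> map ( *%R a) p \in S ->
  p \in S /\ a \in A.

Let I n m := cube_mean J (fun s => F n (dot n (nth 0 s)) * F m (dot m (nth 0 s))).

(** A pair with an arbitrary a in [mean_pair] contributes nothing, and two null vectors at
    most K^2.  The other pairs are parametrized by a common vector p and two multipliers,
    and SA says where these lie. *)
Lemma pair_bound n m : n \in S -> m \in S ->
  I n m <= K ^+ 2 * ((null n && null m)%:R +
   \sum_(p <- S | ~~ null p) \sum_(a <- A | a != 0) \sum_(b <- A | b != 0)
     (n == map ( *%R a) p)%:R * (m == map ( *%R b) p)%:R * pair_weight a b).
Proof.
move=> nS mS; have nm : size n = size m by rewrite !sizeS.
have K2 : 0 <= K ^+ 2 by exact: sqr_ge0.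
have W0 a b : 0 <= pair_weight a b by rewrite addr_ge0// divr_ge0.
have T0 p a b : 0 <= (n == map ( *%R a) p)%:R * (m == map ( *%R b) p)%:R * pair_weight a b.
  by rewrite !mulr_ge0.
have Sg0 : 0 <= \sum_(p <- S | ~~ null p) \sum_(a <- A | a != 0) \sum_(b <- A | b != 0)
     (n == map ( *%R a) p)%:R * (m == map ( *%R b) p)%:R * pair_weight a b.
  by do 3 (apply: sumr_ge0 => ? _).
have Ile a : (0 < a)%N -> reaches R n m a -> `|I n m| <= K ^+ 2 / a%:R.
  by move=> a0 ra; apply: (mean_pair (eF nS) (eF mS) (sizeS nS) (sizeS mS) a0 ra).
have Ile' a : (0 < a)%N -> reaches R m n a -> `|I n m| <= K ^+ 2 / a%:R.
  move=> a0 ra; have := mean_pair (eF mS) (eF nS) (sizeS mS) (sizeS nS) a0 ra.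
  by congr (`|_| <= _); apply: eq_Rintegral => s _; rewrite mulrC.
have := pair_cases R nm.
case=> [/andP[n0 m0]|h|h|[p [a [b [a0 b0 p0 [np mp ra rb]]]]]].
- rewrite n0 m0; apply: le_trans (ler_norm _) _.
  apply: (@le_trans _ _ (K ^+ 2 * 1)); last by rewrite ler_wpM2l// lerDl.
  rewrite mulr1; apply: cube_mean_norm.
    by apply: bounded_measurableM; apply: bounded_measurable_dot; [exact: eF nS|exact: eF mS].
  by move=> s; rewrite normrM expr2 ler_pM//; apply: equidistributed_le; exact: eF.
- have /normr0_eq0 -> : `|I n m| = 0.
    by apply: (@archimedean_eq0 _ (K ^+ 2)) => // a a0; exact: Ile (h a a0).
  by rewrite mulr_ge0// addr_ge0.
- have /normr0_eq0 -> : `|I n m| = 0.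
    by apply: (@archimedean_eq0 _ (K ^+ 2)) => // a a0; exact: Ile' (h a a0).
  by rewrite mulr_ge0// addr_ge0.
have [pS aA] := SA a0 p0 (eq_ind _ (fun x => x \in S) nS _ np).
have [_ bA] := SA b0 p0 (eq_ind _ (fun x => x \in S) mS _ mp).
apply: le_trans (ler_norm _) _.
apply: (@le_trans _ _ (K ^+ 2 * pair_weight a b)); last first.
  rewrite ler_wpM2l// ler_wpDl//.
  rewrite (big_rem p)//= p0 (big_rem a)//= a0 (big_rem b)//= b0 -np -mp !eqxx !mul1r.
  apply: ler_wpDr; first by do 3 (apply: sumr_ge0 => ? _).
  apply: ler_wpDr; first by do 2 (apply: sumr_ge0 => ? _).
  by apply: ler_wpDr => //; apply: sumr_ge0 => ? _; rewrite !mulr_ge0.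
have ab0 (c : int) : c != 0 -> (0 < `|c|)%N by rewrite absz_gt0.
have [ab|ba] := leqP `|b|%N `|a|%N.
  apply: le_trans (Ile _ (ab0 _ a0) ra) _; rewrite ler_wpM2l//.
  by rewrite /pair_weight ab mul1r lerDl divr_ge0.
apply: le_trans (Ile' _ (ab0 _ b0) rb) _; rewrite ler_wpM2l//.
by rewrite /pair_weight (ltnW ba) mul1r lerDr divr_ge0.
Qed.

(** For every multiple a p the weights 1 / |a| of the pairs with |b| <= |a| add up to at
    most 4 by [count_norm_le], so that only the number of the pairs (a, p) matters. *)
Lemma second_moment : cube_mean J (fun s => (\sum_(n <- S) F n (dot n (nth 0 s))) ^+ 2) <=
  K ^+ 2 * (1 + 8 * \sum_(a <- A | a != 0)
     \sum_(p <- S | ~~ null p) (map ( *%R a) p \in S)%:R).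
Proof.
have K2 : 0 <= K ^+ 2 by exact: sqr_ge0.
have bF n : n \in S -> bounded_measurable J (fun s => F n (dot n (nth 0 s))).
  by move=> nS; apply: bounded_measurable_dot; exact: eF nS.
have -> : cube_mean J (fun s => (\sum_(n <- S) F n (dot n (nth 0 s))) ^+ 2) =
    \sum_(n <- S) \sum_(m <- S) I n m.
  have -> : (fun s => (\sum_(n <- S) F n (dot n (nth 0 s))) ^+ 2) =
     (fun s => \sum_(n <- S) \sum_(m <- S) F n (dot n (nth 0 s)) * F m (dot m (nth 0 s))).
    apply/funext => s; rewrite expr2 mulr_suml; apply: eq_bigr => n _.
    by rewrite mulr_sumr.
  rewrite cube_mean_sum.
    apply: eq_big_seq => n nS; rewrite cube_mean_sum// => m mS.
    by apply: bounded_measurableM; apply: bF.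
  move=> n nS; apply: bounded_measurable_sum => m mS.
  by apply: bounded_measurableM; apply: bF.
apply: (@le_trans _ _ (\sum_(n <- S) \sum_(m <- S) K ^+ 2 * ((null n && null m)%:R +
   \sum_(p <- S | ~~ null p) \sum_(a <- A | a != 0) \sum_(b <- A | b != 0)
     (n == map ( *%R a) p)%:R * (m == map ( *%R b) p)%:R * pair_weight a b))).
  rewrite big_seq [leRHS]big_seq; apply: ler_sum => n nS.
  rewrite big_seq [leRHS]big_seq; apply: ler_sum => m mS.
  exact: pair_bound.
under eq_bigr do rewrite -mulr_sumr.
rewrite -mulr_sumr ler_wpM2l//.
under eq_bigr do rewrite big_split/=.
rewrite big_split/=; apply: lerD.
  pose z : seq int := nseq J 0.
  have nz n : n \in S -> null n = (n == z).
    move=> /sizeS sn; apply/idP/eqP => [n0|->]; last by rewrite /null all_nseq orbT.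
    by rewrite /z -sn; apply/all_pred1P.
  have -> : \sum_(n <- S) \sum_(m <- S) (null n && null m)%:R =
     (\sum_(n <- S) (n == z)%:R) * (\sum_(n <- S) (n == z)%:R) :> R.
    rewrite mulr_suml; apply: eq_big_seq => n nS; rewrite mulr_sumr.
    by apply: eq_big_seq => m mS; rewrite -natrM mulnb !nz.
  by rewrite sum_pred1_uniq// -natrM mulnb lern1 leq_b1.
pose E (a : int) p : R := (map ( *%R a) p \in S)%:R.
have E0 a p : 0 <= E a p by [].
have E1 a p : E a p <= 1 by rewrite /E lern1 leq_b1.
have -> : \sum_(n <- S) \sum_(m <- S) \sum_(p <- S | ~~ null p)
    \sum_(a <- A | a != 0) \sum_(b <- A | b != 0)
     (n == map ( *%R a) p)%:R * (m == map ( *%R b) p)%:R * pair_weight a b =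
   \sum_(p <- S | ~~ null p) \sum_(a <- A | a != 0) \sum_(b <- A | b != 0)
     E a p * E b p * pair_weight a b.
  under eq_bigr do rewrite exchange_big/=.
  rewrite exchange_big/=; apply: eq_bigr => p _.
  under eq_bigr do rewrite exchange_big/=.
  rewrite exchange_big/=; apply: eq_bigr => a _.
  under eq_bigr do rewrite exchange_big/=.
  rewrite exchange_big/=; apply: eq_bigr => b _.
  rewrite /E -!(sum_pred1_uniq _ uS) !mulr_suml; apply: eq_bigr => n _.
  by rewrite mulr_sumr mulr_suml.
have half p : \sum_(a <- A | a != 0) \sum_(b <- A | b != 0)
    E a p * E b p * ((`|b| <= `|a|)%N%:R / `|a|%N%:R) <= 4 * \sum_(a <- A | a != 0) E a p.
  rewrite mulr_sumr; apply: ler_sum => a a0.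
  have ap : 0 < `|a|%N%:R :> R by rewrite ltr0n absz_gt0.
  apply: (@le_trans _ _ (\sum_(b <- A | b != 0) E a p * ((`|b| <= `|a|)%N%:R / `|a|%N%:R))).
    apply: ler_sum => b b0; rewrite ler_wpM2r ?divr_ge0//.
    by rewrite ler_piMr.
  rewrite -mulr_sumr mulrC ler_wpM2r//.
  by rewrite -mulr_suml ler_pdivrMr// count_norm_le.
rewrite [X in _ <= _ * X]exchange_big/= mulr_sumr; apply: ler_sum => p _.
have -> : \sum_(a <- A | a != 0) \sum_(b <- A | b != 0) E a p * E b p * pair_weight a b =
  \sum_(a <- A | a != 0) \sum_(b <- A | b != 0) E a p * E b p * ((`|b| <= `|a|)%N%:R / `|a|%N%:R)
  + \sum_(a <- A | a != 0) \sum_(b <- A | b != 0) E a p * E b p * ((`|b| <= `|a|)%N%:R / `|a|%N%:R).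
  rewrite [X in _ = _ + X]exchange_big/= -big_split; apply: eq_bigr => a _ /=.
  rewrite -big_split; apply: eq_bigr => b _ /=.
  by rewrite /pair_weight mulrDr (mulrC (E b p)).
have := half p; lra.
Qed.

End pair_bound.
End second_moment_sum.

(** * The second moment contributed by one column *)

Section column.
Variable R : realType.
Local Notation RM := (measurableTypeR R).
Implicit Types (kap : nat -> R) (th : seq int -> R) (T : R) (n p : seq int).

(** A limit of sums over ranges of integers that do not depend on x. *)
Lemma measurable_chord_err (kap rho : R) k :
  measurable_fun [set: RM] (chord_err kap k rho : RM -> RM).
Proof.
pose r := rho / kap.
pose g (m : int) (x : R) : R :=
  if `|m%:~R + x| < r then Num.sqrt (rho ^+ 2 - kap ^+ 2 * (m%:~R + x) ^+ 2) ^+ k else 0.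
have mg m : measurable_fun [set: RM] (g m : RM -> RM).
  have cG : continuous (fun x : R => Num.sqrt (rho ^+ 2 - kap ^+ 2 * (m%:~R + x) ^+ 2) ^+ k).
    move=> x.
    apply: (@continuous_comp _ _ _
      (fun x : R => Num.sqrt (rho ^+ 2 - kap ^+ 2 * (m%:~R + x) ^+ 2))
      (fun x : R => x ^+ k)); last exact: exprn_continuous.
    apply: (@continuous_comp _ _ _
      (fun x : R => (rho ^+ 2 - kap ^+ 2 * (m%:~R + x) ^+ 2)) (@Num.sqrt R)); last exact: sqrt_continuous.
    apply: cvgB; first exact: cvg_cst.
    apply: cvgM; first exact: cvg_cst.
    apply: (@continuous_comp _ _ _
      (fun x : R => m%:~R + x) (fun x : R => x ^+ 2)); last exact: exprn_continuous.
    by apply: cvgD; [exact: cvg_cst|exact: cvg_id].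
  apply: measurable_fun_ifT.
  - apply: measurable_fun_ltr; last exact: measurable_cst.
    by apply: measurableT_comp => //; apply: measurable_funD => //; exact: measurable_cst.
  - exact: (continuous_measurable_fun cG).
  - exact: measurable_cst.
pose H (N : nat) (x : R) : R := \sum_(m <- window (0 : R) N%:R) g m x - area R k * rho ^+ k.+1 / kap.
apply: (@measurable_fun_cvg _ _ _ _ H).
  by move=> N; apply: measurable_funB => //; apply: measurable_sum => m; exact: mg.
move=> x _; apply: cvg_near_cst; near=> N.
have Nx : `|x| + r <= N%:R by near: N; exact: nbhs_infty_ger.
rewrite /H /chord_err; congr (_ - _).
rewrite /chord_sum /g -big_mkcond/= -[LHS]big_filter; apply: perm_big.
apply: uniq_perm; [exact/filter_uniq/uniq_window|exact: uniq_window|].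
move=> m; rewrite mem_filter !mem_window addr0; apply/andb_idr => h.
have -> : m%:~R = (m%:~R + x) - x :> R by rewrite addrK.
by apply: le_lt_trans (ler_normB _ _) _; rewrite -/r in h; lra.
Unshelve. all: by end_near. Qed.

Lemma chord_err_equidistributed (kap : R) k : 0 < kap -> exists2 C : R, 0 < C &
  forall T rho c : R, 0 <= rho -> rho <= T ->
  equidistributed (C * Num.sqrt T ^+ k) (fun x => chord_err kap k rho (x + c)).
Proof.
move=> kap0; have [C C0 CP] := chord_err_average k kap0; exists C => // T rho c rho0 rhoT.
apply: equidistributed_shift; split; first exact: measurable_chord_err.
- exact: chord_err_shift.
- by move=> x a a0; exact: CP.
Qed.

Lemma sum_subseq_le (I : eqType) (A B : seq I) (f : I -> R) : uniq A -> uniq B ->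
  {subset A <= B} -> (forall i, 0 <= f i) -> \sum_(i <- A) f i <= \sum_(i <- B) f i.
Proof.
move=> uA uB AB f0.
have -> : \sum_(i <- A) f i = \sum_(i <- [seq b <- B | b \in A]) f i.
  apply: perm_big; apply: uniq_perm => //; first exact: filter_uniq.
  by move=> x; rewrite mem_filter andb_idr// => /AB.
rewrite big_filter big_mkcond; apply: ler_sum => i _; by case: ifP.
Qed.

(** Each step uses ln (1 - 1 / (N + 2)) <= - 1 / (N + 2). *)
Lemma harmonic_le (N : nat) : (0 < N)%N ->
  \sum_(1 <= i < N.+1) (i%:R)^-1 <= 1 + ln (N%:R : R).
Proof.
elim: N => // -[_ _|N IH _]; first by rewrite big_nat1 invr1 ln1 addr0.
rewrite big_nat_recr//=; apply: le_trans (lerD (IH isT) (lexx _)) _.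
rewrite -addrA lerD2l.
have h : ln (1 + - (N.+2%:R)^-1 : R) <= - (N.+2%:R)^-1.
  by apply: le_ln1Dx; rewrite ltrN2 invf_lt1 ?ltr0n// ltr1n.
have e : 1 + - (N.+2%:R)^-1 = N.+1%:R / N.+2%:R :> R.
  have N0 : N.+1%:R + 1 != 0 :> R by rewrite natr1 pnatr_eq0.
  by rewrite -[N.+2%:R]natr1; move: N0; set y : R := N.+1%:R => N0; field.
rewrite e ln_div ?posrE ?ltr0n// in h.
by move: h; rewrite lerBlDr -lerBrDr addrC.
Qed.

Lemma sum_inv_window (X : R) : 1 <= X ->
  \sum_(a <- window 0 X | a != 0) (`|a|%N%:R)^-1 <= 2 * (1 + ln X).
Proof.
move=> X1; have X0 : 0 <= X by lra.
pose N := Num.truncn X.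
have /andP[N1 N2] := truncn_itv X0; rewrite -/N in N1 N2.
have N0 : (0 < N)%N by rewrite /N truncn_gt0.
(* the nonzero integers of absolute value at most N, by sign *)
pose B : seq int := [seq i%:Z | i <- iota 1 N] ++ [seq - i%:Z | i <- iota 1 N].
rewrite -big_filter; apply: (@le_trans _ _ (\sum_(a <- B) (`|a|%N%:R)^-1)).
  apply: sum_subseq_le => //.
  - by rewrite filter_uniq// uniq_window.
  - rewrite cat_uniq !map_inj_uniq ?iota_uniq//=; last 2 first.
      by move=> i j /eqP; rewrite eqr_opp => /eqP[].
      by move=> i j [].
    rewrite andbT -all_predC; apply/allP => a /mapP[i + ->] /=.
    rewrite mem_iota => /andP[i0 _]; apply/mapP => -[j _ e].
    have : - i%:Z < 0 by rewrite oppr_lt0 ltz_nat.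
    by rewrite e.
  - move=> a; rewrite mem_filter mem_window addr0 -intr_norm -abszE -pmulrn => /andP[a0 aX].
    have aN : (`|a| <= N)%N.
      by rewrite -ltnS -(ltr_nat R) (lt_trans aX).
    have a1 : (0 < `|a|)%N by rewrite absz_gt0.
    rewrite mem_cat; apply/orP; have [a2|a2] := leP 0 a.
      left; apply/mapP; exists `|a|%N; last by rewrite gez0_abs.
      by rewrite mem_iota a1 add1n ltnS.
    right; apply/mapP; exists `|a|%N; last by rewrite ltz0_abs// opprK.
    by rewrite mem_iota a1 add1n ltnS.
rewrite big_cat !big_map/=.
rewrite [X in _ + X](eq_bigr (fun i : nat => (`|i|%N%:R)^-1)) => [|i _]; last by rewrite abszN.
have := harmonic_le N0; rewrite /index_iota subn1/= => h.
have : ln (N%:R : R) <= ln X by rewrite ler_ln ?posrE ?ltr0n//; lra.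
rewrite mulrDr mulr1; move: h.
rewrite (eq_bigr (fun i : nat => (`|i|%N%:R : R)^-1)) => [|i _ //]; lra.
Qed.

Lemma size_tree kap th T (k0 : R) j : 0 < k0 -> (forall i, k0 <= kap i) -> 0 < T ->
  (size (tree kap th T j))%:R <= (2 * (T / k0) + 1) ^+ j.
Proof.
move=> k00 k0k T0; have kap0 i : 0 < kap i by exact: lt_le_trans (k0k i).
elim: j => [|j IH]; first by rewrite expr0.
rewrite -sum1_size big_allpairs_dep natr_sum exprSr.
apply: (@le_trans _ _ (\sum_(n <- tree kap th T j) (2 * (T / k0) + 1))).
  rewrite big_seq [leRHS]big_seq; apply: ler_sum => n; rewrite mem_tree// => /andP[_ s0].
  rewrite sum1_size.
  have r0 : 0 <= Num.sqrt (slack kap th T n) / kap j.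
    by rewrite divr_ge0 ?sqrtr_ge0// ltW.
  have := size_window (th n) r0; rewrite ler_norml => /andP[_ h].
  have : Num.sqrt (slack kap th T n) / kap j <= T / k0.
    apply: ler_pM; rewrite ?sqrtr_ge0 ?invr_ge0 ?(ltW (kap0 _))//.
      rewrite -[leRHS]gtr0_norm// -sqrtr_sqr; apply: ler_wsqrtr; exact: slack_le.
    by rewrite lef_pV2 ?posrE.
  lra.
rewrite big_const_seq count_predT iter_addr_0 -[leLHS]mulr_natl.
apply: ler_wpM2r => //; by rewrite addr_ge0// mulr_ge0// divr_ge0// ltW.
Qed.

(** A multiple a p lies in the ball of radius T exactly when p lies in that of radius
    T / |a|. *)
Lemma slack_map kap th T (a : int) n : a != 0 ->
  (forall n, th (map ( *%R a) n) = a%:~R * th n) ->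
  slack kap th T (map ( *%R a) n) = a%:~R ^+ 2 * slack kap th (T / `|a|%N%:R) n.
Proof.
move=> a0 tha; elim: n => [|m n IH] /=.
  have -> : a%:~R ^+ 2 = `|a|%N%:R ^+ 2 :> R.
    by rewrite (pmulrn _ `|a|%N) abszE intr_norm real_normK ?num_real.
  by field; rewrite pnatr_eq0 -lt0n absz_gt0.
by rewrite IH tha size_map intrM; ring.
Qed.

(** A coordinate m with kap |m| < T <= kap is zero. *)
Lemma tree_null kap th T n : (forall i, T <= kap i) -> 0 < T ->
  (forall n, null n -> th n = 0) -> 0 < slack kap th T n -> null n.
Proof.
move=> Tk T0 th0; elim: n => //= m n IH s0.
have s1 : 0 < slack kap th T n by apply: lt_le_trans s0 _; rewrite gerBl sqr_ge0.
have n0 := IH s1; rewrite -/(null n) n0 andbT.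
have := lt_le_trans s0 (lerB (slack_le kap th T n) (lexx _)).
rewrite th0// addr0 subr_gt0 => h.
have kp : 0 < kap (size n) by exact: lt_le_trans (Tk _).
rewrite -absz_eq0 -leqn0 -ltnS -(ltr_nat R) (pmulrn _ `|m|%N) abszE intr_norm.
rewrite -(ltr_pM2l kp) mulr1; apply: lt_le_trans (Tk (size n)).
rewrite -[X in X * _](gtr0_norm kp) -normrM.
rewrite -(ltr_pXn2r (n := 2)) ?nnegrE//; last exact: ltW.
by rewrite real_normK ?num_real.
Qed.

End column.

Section column_moment.
Variable R : realType.
Implicit Types (kap : nat -> R) (th : seq int -> R) (T : R) (n p : seq int).

Definition homogeneous th := forall (a : int) n, th (map ( *%R a) n) = a%:~R * th n.

Lemma homogeneous_null th n : homogeneous th -> null n -> th n = 0.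
Proof.
move=> hth /all_pred1P n0.
suff -> : n = map ( *%R 0) n by rewrite hth mul0r.
by rewrite {1}n0; elim: n {n0} => //= x n ->; rewrite mul0r.
Qed.

Section multiples.
Variables (kap : nat -> R) (k0 : R).
Hypothesis k00 : 0 < k0.
Hypothesis k0k : forall i, k0 <= kap i.

Let kap0 i : 0 < kap i. Proof. exact: lt_le_trans (k0k i). Qed.

(** If a p lies in the ball of radius T, then p lies in the ball of radius T / |a|, which
    contains nothing but the origin once |a| >= T / k0. *)
Lemma multiples_tree th T j p (a : int) : 0 < T -> homogeneous th ->
  a != 0 -> ~~ null p -> map ( *%R a) p \in tree kap th T j ->
  [/\ p \in tree kap th T j, a \in window 0 (T / k0) &
      p \in tree kap th (T / `|a|%N%:R) j].
Proof.
move=> T0 hth a0 p0; rewrite !mem_tree//; last first.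
  by rewrite divr_gt0// ltr0n absz_gt0.
rewrite size_map slack_map// => /andP[pj s0].
have a2 : 0 < a%:~R ^+ 2 :> R by rewrite exprn_even_gt0//= intr_eq0.
rewrite pmulr_rgt0// in s0.
have a1R : 1 <= `|a|%N%:R :> R by rewrite ler1n absz_gt0.
split.
- rewrite pj /=; apply: lt_le_trans s0 _.
  elim: p {p0 pj} => [|m p IH] /=; last by rewrite lerD2r.
  rewrite lerXn2r ?nnegrE ?divr_ge0 ?(ltW T0)//.
  by rewrite ler_pdivrMr ?ler_peMr ?(ltW T0)//; lra.
- rewrite mem_window addr0 -intr_norm -abszE -pmulrn ltNge.
  apply: contra p0 => h; apply: tree_null s0.
  + move=> i; apply: le_trans (k0k i); rewrite ler_pdivrMr; last by lra.
    by rewrite mulrC -ler_pdivrMr.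
  + by rewrite divr_gt0//; lra.
  + by move=> n; exact: homogeneous_null.
- by rewrite pj.
Qed.

(** The ball of radius T / |a| contains O((T / |a|)^j) vectors p, and |a|^-j <= |a|^-1
    for j > 0; the logarithm is the sum of the 1 / |a|.  For j = 0 there is no vector
    that is not null. *)
Lemma multiples_count th T j : 0 < T -> 1 <= T / k0 -> homogeneous th ->
  \sum_(a <- window 0 (T / k0) | a != 0)
    \sum_(p <- tree kap th T j | ~~ null p) (map ( *%R a) p \in tree kap th T j)%:R <=
  (3 * (T / k0)) ^+ j * (2 * (1 + ln (T / k0))).
Proof.
move=> T0 X1 hth; set X := T / k0 in X1 *.
have X0 : 0 < X by lra.
apply: le_trans (ler_wpM2l (exprn_ge0 _ _) (sum_inv_window X1)); last by lra.
rewrite mulr_sumr big_seq_cond [leRHS]big_seq_cond.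
apply: ler_sum => a /andP[]; rewrite mem_window addr0 -intr_norm -abszE -pmulrn => aX a0.
have a1R : 1 <= `|a|%N%:R :> R by rewrite ler1n absz_gt0.
case: j => [|j].
  rewrite /= big_cons big_nil /=; apply: divr_ge0 => //; exact: exprn_ge0.
have -> : \sum_(p <- tree kap th T j.+1 | ~~ null p) (map ( *%R a) p \in tree kap th T j.+1)%:R
   = (size [seq p <- tree kap th T j.+1 | ~~ null p && (map ( *%R a) p \in tree kap th T j.+1)])%:R :> R.
  rewrite -natr_sum size_filter -sum1_count [in RHS]big_mkcondr/=.
  by congr (_%:R); apply: eq_bigr => p _; case: (_ \in _).
apply: (@le_trans _ _ (size (tree kap th (T / `|a|%N%:R) j.+1))%:R).
  rewrite ler_nat; apply: uniq_leq_size; first by rewrite filter_uniq// uniq_tree.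
  by move=> p; rewrite mem_filter => /andP[/andP[p0 ap] _]; have [] := multiples_tree T0 hth a0 p0 ap.
have Ta : 0 < T / `|a|%N%:R by rewrite divr_gt0//; lra.
apply: le_trans (size_tree th j.+1 k00 k0k Ta) _.
have Xa : 1 <= X / `|a|%N%:R by rewrite ler_pdivlMr; lra.
have -> : T / `|a|%N%:R / k0 = X / `|a|%N%:R by rewrite /X mulrAC.
apply: (@le_trans _ _ ((3 * (X / `|a|%N%:R)) ^+ j.+1)).
  by rewrite lerXn2r ?nnegrE//; lra.
rewrite mulrA expr_div_n ler_wpM2l//; first by rewrite exprn_ge0//; lra.
rewrite lef_pV2 ?posrE ?exprn_gt0//; try by lra.
by rewrite ler_eXnr.
Qed.

(** In [second_moment] the factor K^2 is of order T^(d - j - 1) and, by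
    [multiples_count], the number of pairs is of order T^j ln T. *)
Lemma column_moment d j : k0 <= 1 -> (j < d)%N -> exists2 C : R, 0 < C &
  forall T th (s : seq int -> R), 2 <= T -> homogeneous th ->
    let D u := \sum_(n <- tree kap th T j)
      chord_err (kap j) (d - j.+1) (Num.sqrt (slack kap th T n)) (dot n (nth 0 u) + s n) in
    bounded_measurable j D /\
    cube_mean j (fun u => D u ^+ 2) <= C * (T ^+ d.-1 * ln T).
Proof.
move=> k01 jd; have [C C0 CP] := chord_err_equidistributed (d - j.+1) (kap0 j).
have dj : (d - j.+1 + j = d.-1)%N.
  by case: d jd {CP} => // d; rewrite ltnS subSS => /subnK.
have ln2 : 0 < ln (2 : R) by rewrite ln_gt0// ltr1n.
have lnk : ln k0 <= 0 by exact: ln_le0.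
(* chosen so that 1 + ln (T / k0) <= L * ln T for T >= 2 *)
pose L := 1 + (1 - ln k0) / ln (2 : R).
have L1 : 1 <= L by rewrite lerDl divr_ge0 ?(ltW ln2)//; lra.
(* 17 = 1 + 8 * 2, from [second_moment] and [multiples_count] *)
exists (C ^+ 2 * (17 * ((3 / k0) ^+ j * L))).
  by rewrite !mulr_gt0 ?exprn_gt0 ?divr_gt0//; lra.
move=> T th s T2 hth D.
have T0 : 0 < T by lra.
set K := C * Num.sqrt T ^+ (d - j.+1).
pose F n x := chord_err (kap j) (d - j.+1) (Num.sqrt (slack kap th T n)) (x + s n).
have eF n : n \in tree kap th T j -> equidistributed K (F n).
  move=> _; apply: CP; first exact: sqrtr_ge0.
  by rewrite -[leRHS]gtr0_norm// -sqrtr_sqr; apply: ler_wsqrtr; exact: slack_le.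
have sz n : n \in tree kap th T j -> size n = j by rewrite mem_tree// => /andP[/eqP].
split.
  by apply: bounded_measurable_sum => n nS; exact: (bounded_measurable_dot j n (eF n nS)).
have SA p (a : int) : a != 0 -> ~~ null p -> map ( *%R a) p \in tree kap th T j ->
    p \in tree kap th T j /\ a \in window 0 (T / k0).
  by move=> a0 p0 ap; have [] := multiples_tree T0 hth a0 p0 ap.
have := second_moment (uniq_tree kap th T j) (uniq_window 0 (T / k0)) sz eF SA.
move/le_trans; apply.
have X1 : 1 <= T / k0 by rewrite ler_pdivlMr//; lra.
have lnT : ln 2 <= ln T by rewrite ler_ln ?posrE//; lra.
have K2 : K ^+ 2 = C ^+ 2 * T ^+ (d - j.+1).
  by rewrite /K exprMn -!exprM mulnC exprM sqr_sqrtr// ltW.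
rewrite K2 -[leLHS]mulrA -[leRHS]mulrA ler_wpM2l ?sqr_ge0//.
have -> : T ^+ d.-1 = T ^+ (d - j.+1) * T ^+ j.
  by rewrite -exprD dj.
have Tk : 0 <= T ^+ (d - j.+1) by rewrite exprn_ge0// ltW.
have -> : 17 * ((3 / k0) ^+ j * L) * (T ^+ (d - j.+1) * T ^+ j * ln T) =
  T ^+ (d - j.+1) * (17 * ((3 * (T / k0)) ^+ j * (L * ln T))).
  have -> : 3 * (T / k0) = 3 / k0 * T by ring.
  by rewrite [(3 / k0 * T) ^+ j]exprMn; ring.
rewrite ler_wpM2l//.
have M := multiples_count j T0 X1 hth.
set P := (3 * (T / k0)) ^+ j in M *.
have P1 : 1 <= P by rewrite exprn_ege1//; lra.
have LX : 1 + ln (T / k0) <= L * ln T.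
  rewrite ln_div ?posrE// /L mulrDl mul1r mulrAC -mulrA.
  have : 1 <= ln T / ln 2 by rewrite ler_pdivlMr// mul1r.
  move/(ler_wpM2l (_ : 0 <= 1 - ln k0)); rewrite mulr1 mulrA => /(_ _); lra.
have LX1 : 1 <= L * ln T.
  apply: le_trans LX; rewrite lerDl; exact: ln_ge0.
have PL : P * (1 + ln (T / k0)) <= P * (L * ln T) by rewrite ler_wpM2l//; lra.
have PL1 : 1 <= P * (L * ln T).
  have P0 : 0 <= P := le_trans ler01 P1.
  exact: le_trans P1 (ler_peMr P0 LX1).
move: M; have -> : P * (2 * (1 + ln (T / k0))) = 2 * (P * (1 + ln (T / k0))) by ring.
move: PL PL1; set x := P * (L * _); set y := P * (1 + _); set z := \sum_(_ <- _ | _) _.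
move: x y z => x y z; lra.
Qed.

End multiples.
End column_moment.

(** * Accumulating the columns *)

Section columns.
Variable R : realType.
Implicit Types (kap : nat -> R) (th : seq int -> R) (T : R) (n p : seq int).

Lemma eq_slack kap th th' T n : (forall p, (size p < size n)%N -> th p = th' p) ->
  slack kap th T n = slack kap th' T n.
Proof.
elim: n => //= m n IH h; rewrite IH => [|p pn]; last by apply: h; rewrite ltnW.
by rewrite h.
Qed.

Lemma eq_tree kap th th' T j : (forall p, (size p < j)%N -> th p = th' p) ->
  tree kap th T j = tree kap th' T j.
Proof.
elim: j => //= j IH h; rewrite IH => [|p pj]; last by apply: h; rewrite ltnW.
congr flatten; apply/eq_in_map => n nS.
have sn : size n = j.
  elim: j n {IH h} nS => [|j IH] n; first by rewrite inE => /eqP ->.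
  by move=> /allpairsPdep[n' [m [n'S _ ->]]] /=; rewrite IH.
by rewrite h ?sn// (@eq_slack kap th th')// => p pn; rewrite h// -sn ltnW.
Qed.

Lemma size_in_tree kap th T j n : n \in tree kap th T j -> size n = j.
Proof.
elim: j n => [|j IH] n; first by rewrite inE => /eqP ->.
by move=> /allpairsPdep[n' [m [n'S _ ->]]] /=; rewrite IH.
Qed.

Lemma eq_fibre_sum kap th th' T d j : (forall p, (size p < j)%N -> th p = th' p) ->
  fibre_sum kap th T d j = fibre_sum kap th' T d j.
Proof.
move=> h; rewrite /fibre_sum (eq_tree _ _ h); apply: eq_big_seq => n /size_in_tree sn.
by rewrite (@eq_slack kap th th')// => p; rewrite sn; exact: h.
Qed.

Section bounds.
Variables (kap : nat -> R) (k0 : R).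
Hypothesis k00 : 0 < k0.
Hypothesis k01 : k0 <= 1.
Hypothesis k0k : forall i, k0 <= kap i.

Let kap0 i : 0 < kap i. Proof. exact: lt_le_trans (k0k i). Qed.

(** Here the number of errors is multiplied by their maximal size.  The bound is weak
    but uniform in the shifts th, hence valid for all translates of a lattice. *)
Lemma fibre_sum_dist d j : (j <= d)%N -> exists2 C : R, 0 < C & forall T th, 1 <= T ->
  `|fibre_sum kap th T d j - fibre_sum kap th T d 0| <= C * T ^+ d.-1.
Proof.
elim: j => [_|j IH jd].
  by exists 1 => // T th T1; rewrite subrr normr0 mul1r exprn_ge0//; lra.
have [C C0 CP] := IH (ltnW jd).
have [E E0 EP] := chord_err_equidistributed (d - j.+1) (kap0 j).
have c0 := fibre_coef_gt0 d j.+1 kap0; set c := fibre_coef _ _ _ in c0.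
pose B := 2 / k0 + 1.
have B1 : 0 < B by rewrite addr_gt0// divr_gt0.
exists (C + c * (B ^+ j * E)); first by rewrite addr_gt0// !mulr_gt0// exprn_gt0.
move=> T th T1; have T0 : 0 < T by lra.
rewrite fibre_sumS// -/c addrAC mulrDl; apply: le_trans (ler_normD _ _) _.
apply: lerD; first exact: CP.
rewrite normrM (gtr0_norm c0) -!mulrA ler_pM2l//.
apply: le_trans (ler_norm_sum _ _ _) _.
apply: (@le_trans _ _ (\sum_(n <- tree kap th T j) E * Num.sqrt T ^+ (d - j.+1))).
  rewrite big_seq [leRHS]big_seq; apply: ler_sum => n nS.
  have := EP T (Num.sqrt (slack kap th T n)) 0 (sqrtr_ge0 _) _.
  have -> : Num.sqrt (slack kap th T n) <= T.
    by rewrite -[leRHS]gtr0_norm// -sqrtr_sqr; apply: ler_wsqrtr; exact: slack_le.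
  by move=> /(_ isT)/(equidistributed_le (th n)); rewrite addr0.
rewrite big_const_seq count_predT iter_addr_0 -mulr_natl.
have s1 := size_tree th j k00 k0k T0.
have s2 : (2 * (T / k0) + 1) ^+ j <= B ^+ j * T ^+ j.
  have h0 : 0 <= 2 * (T / k0) + 1 by rewrite addr_ge0// mulr_ge0// divr_ge0// ltW.
  rewrite -exprMn lerXn2r ?nnegrE//; first by rewrite mulr_ge0// ltW.
  rewrite /B; have -> : (2 / k0 + 1) * T = 2 * (T / k0) + T by ring.
  by rewrite lerD2l.
have sT : Num.sqrt T ^+ (d - j.+1) <= T ^+ (d - j.+1).
  rewrite lerXn2r ?nnegrE ?sqrtr_ge0 ?(ltW T0)//.
  rewrite -[leRHS]gtr0_norm// -sqrtr_sqr; apply: ler_wsqrtr.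
  by rewrite expr2 ler_peMr// ltW.
have -> : T ^+ d.-1 = T ^+ j * T ^+ (d - j.+1).
  rewrite -exprD; congr (_ ^+ _).
  by case: d jd {CP EP IH c c0 s2 sT} => // d jd; rewrite subSS subnKC.
have -> : B ^+ j * (E * (T ^+ j * T ^+ (d - j.+1))) = B ^+ j * T ^+ j * (E * T ^+ (d - j.+1)).
  by ring.
apply: ler_pM => //.
- by rewrite mulr_ge0 ?exprn_ge0 ?sqrtr_ge0// ltW.
- exact: le_trans s2.
- by rewrite ler_pM2l.
Qed.

Section iteration.
Variables (th : seq R -> seq int -> R) (sh : seq R -> seq int -> R).
Hypothesis hth : forall x, homogeneous (th x).
(* s lists the columns before column size n, and u starts with that column *)
Hypothesis th_col : forall s u n, size s = 'C(size n, 2) ->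
  th (s ++ u) n = dot n (nth 0 u) + sh s n.
Hypothesis th_loc : forall s u n j, size s = 'C(j, 2) -> (size n < j)%N ->
  th (s ++ u) n = th s n.

Let X T d j s := fibre_sum kap (th s) T d j - fibre_sum kap (th s) T d 0.

(** Let X be the difference between [fibre_sum] and its initial value and c D the increment due to
    column j.  Then (X + c D)^2 <= 2 X^2 + 2 c^2 D^2, and the mean of D^2 over column j
    is bounded by [column_moment] uniformly in the earlier columns.  The constants a and
    b make the induction work: the integral is monotone on all nonnegative functions
    but not additive in general. *)
Lemma iterated_moment d j : (j <= d)%N -> exists2 C : R, 0 < C &
  forall T (a b : R), 2 <= T -> 0 <= a -> 0 <= b ->
  (iter_integral 'C(j, 2) (fun s => (a * X T d j s ^+ 2 + b)%:E) <=
   (a * (C * (T ^+ d.-1 * ln T)) + b)%:E)%E.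
Proof.
elim: j => [_|j IH jd].
  exists 1 => // T a b T2 a0 b0; rewrite /= /X subrr expr0n mulr0 add0r lee_fin.
  by rewrite lerDr !mulr_ge0// ?exprn_ge0 ?ln_ge0; lra.
have [C C0 CP] := IH (ltnW jd).
have [E E0 EP] := column_moment k00 k0k k01 jd.
have c0 := fibre_coef_gt0 d j.+1 kap0; set c := fibre_coef _ _ _ in c0.
exists (2 * C + 2 * c ^+ 2 * E).
  by rewrite addr_gt0// !mulr_gt0// exprn_gt0.
move=> T a b T2 a0 b0; have T0 : 0 < T by lra.
set W := T ^+ d.-1 * ln T.
have W0 : 0 <= W by rewrite mulr_ge0 ?exprn_ge0 ?ln_ge0//; lra.
have a'0 : 0 <= 2 * a by rewrite mulr_ge0.
have ac0 : 0 <= 2 * a * c ^+ 2 := mulr_ge0 a'0 (sqr_ge0 c).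
have b'0 : 0 <= 2 * a * c ^+ 2 * (E * W) + b.
  exact: addr_ge0 (mulr_ge0 ac0 (mulr_ge0 (ltW E0) W0)) b0.
rewrite binS bin1 iter_integral_cat.
have -> : (a * ((2 * C + 2 * c ^+ 2 * E) * W) + b)%:E =
   ((2 * a) * (C * W) + (2 * a * c ^+ 2 * (E * W) + b))%:E.
  by congr EFin; ring.
apply: le_trans (CP _ _ _ T2 a'0 b'0).
apply: le_iter_integral => [s|s ss].
  by apply: iter_integral_ge0 => u; rewrite lee_fin addr_ge0// mulr_ge0// sqr_ge0.
pose D u := \sum_(n <- tree kap (th s) T j)
  chord_err (kap j) (d - j.+1) (Num.sqrt (slack kap (th s) T n)) (dot n (nth 0 u) + sh s n).
have [bD mD] := EP T (th s) (sh s) T2 (hth s).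
rewrite -/D in bD mD.
have XE u : X T d j.+1 (s ++ u) = X T d j s + c * D u.
  rewrite /X fibre_sumS// -/c.
  have h j' : (j' <= j)%N -> forall p, (size p < j')%N -> th (s ++ u) p = th s p.
    by move=> jj p pj; rewrite (th_loc _ ss)// (leq_trans pj).
  rewrite (eq_fibre_sum _ _ _ (h j _))// (eq_fibre_sum _ _ _ (h 0 _))//.
  rewrite addrAC; congr (_ + c * _).
  rewrite (eq_tree _ _ (h j _))//; apply: eq_big_seq => n nS.
  have sn := size_in_tree nS.
  rewrite th_col ?sn// (@eq_slack kap (th (s ++ u)) (th s))// => p pn.
  by rewrite (th_loc _ ss)// -sn.
pose G u := (2 * a * X T d j s ^+ 2 + b) + (2 * a * c ^+ 2) * (D u * D u).
have bG : bounded_measurable j G.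
  apply: bounded_measurableD; first exact: bounded_measurable_cst.
  apply: bounded_measurableM; first exact: bounded_measurable_cst.
  exact: bounded_measurableM.
have G0 u : 0 <= G u.
  apply: addr_ge0; first exact: addr_ge0 (mulr_ge0 a'0 (sqr_ge0 _)) b0.
  by apply: mulr_ge0 => //; rewrite -expr2 sqr_ge0.
apply: (@le_trans _ _ (iter_integral j (fun u => (G u)%:E))).
  apply: le_iter_integral => [u|u _]; rewrite lee_fin.
    by rewrite addr_ge0// mulr_ge0// sqr_ge0.
  rewrite XE /G -expr2.
  have := mulr_ge0 a0 (sqr_ge0 (X T d j s - c * D u)); set x := X T d j s.
  have -> : a * (x - c * D u) ^+ 2 = (2 * a * x ^+ 2 + b + 2 * a * c ^+ 2 * D u ^+ 2) -
     (a * (x + c * D u) ^+ 2 + b) by ring.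
  by rewrite subr_ge0.
rewrite -iter_integralE; last 2 first.
- by case: bG => mG _; exact/measurable_EFinP.
- by move=> u; rewrite lee_fin.
rewrite cube_meanE// lee_fin /G.
rewrite cube_meanD; last 2 first.
- exact: bounded_measurable_cst.
- by apply: bounded_measurableM; [exact: bounded_measurable_cst|exact: bounded_measurableM].
rewrite cube_mean_cst.
have -> : cube_mean j (fun u => 2 * a * c ^+ 2 * (D u * D u)) =
   2 * a * c ^+ 2 * cube_mean j (fun u => D u ^+ 2).
  rewrite /cube_mean RintegralZl//; first exact: measurable_unit_cube.
  exact: (bounded_measurable_integrable (bounded_measurableM bD bD)).
have := ler_wpM2l ac0 mD; rewrite -/W; lra.
Qed.

End iteration.

End bounds.
End columns.

(** * Completing squares *)

Section cholesky.
Variable R : realType.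
Implicit Types (y : nat -> R) (B : nat -> nat -> R) (n : nat).

Definition quadratic n B y : R := \sum_(i < n) \sum_(j < n) B i j * y i * y j.

(** Completing the square in the last variable. *)
Lemma quadraticS n B y : (forall i j, B i j = B j i) -> B n n != 0 ->
  quadratic n.+1 B y =
  B n n * (y n + \sum_(i < n) B i n / B n n * y i) ^+ 2 +
  quadratic n (fun i j => B i j - B i n * B j n / B n n) y.
Proof.
move=> sB b0; rewrite /quadratic big_ord_recr/=.
under eq_bigr do rewrite big_ord_recr/=.
rewrite big_split/= big_ord_recr/=.
set Q := \sum_(i < n) \sum_(j < n) _; pose l := \sum_(i < n) B i n * y i.
have e1 : \sum_(i < n) B i n * y i * y n = l * y n by rewrite mulr_suml.
have e2 : \sum_(i < n) B n i * y n * y i = l * y n.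
  by rewrite mulr_suml; apply: eq_bigr => i _; rewrite sB; ring.
have e3 : \sum_(i < n) B i n / B n n * y i = l / B n n.
  by rewrite mulr_suml; apply: eq_bigr => i _; ring.
have e4 : \sum_(i < n) \sum_(j < n) (B i j - B i n * B j n / B n n) * y i * y j =
   Q - l * l / B n n.
  rewrite -mulrA [X in _ = _ - X]mulr_suml -sumrB; apply: eq_bigr => i _.
  rewrite [l / _]mulr_suml mulr_sumr -sumrB.
  by apply: eq_bigr => j _; ring.
by rewrite e1 e2 e3 e4; field.
Qed.

(** The form that remains after completing a square is again positive definite: it is
    the value of the given form where the last variable is chosen so that the square
    vanishes. *)
Lemma cholesky n B : (forall i j, B i j = B j i) ->
  (forall y, (exists2 i, (i < n)%N & y i != 0) -> 0 < quadratic n B y) ->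
  exists (k0 : R) (kap : nat -> R) (nu : nat -> nat -> R),
    [/\ 0 < k0, k0 <= 1, forall i, k0 <= kap i & forall y,
    quadratic n B y = \sum_(j < n) (kap j * (y j + \sum_(i < j) nu i j * y i)) ^+ 2].
Proof.
elim: n B => [|n IH] B sB pB.
  exists 1, (fun=> 1), (fun _ _ => 0); split => // y.
  by rewrite /quadratic !big_ord0.
have b0 : 0 < B n n.
  have := pB (fun i => (i == n)%:R); rewrite /quadratic.
  rewrite big_ord_recr/= big1 ?add0r; last first.
    by move=> i _; rewrite big1// => j _; rewrite ltn_eqF// mulr0 mul0r.
  rewrite big_ord_recr/= big1 ?add0r; last first.
    by move=> j _; rewrite (ltn_eqF (ltn_ord j)) mulr0.
  by rewrite eqxx !mulr1; apply; exists n; rewrite ?eqxx ?oner_neq0.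
have bN : B n n != 0 by rewrite gt_eqF.
pose B' i j := B i j - B i n * B j n / B n n.
have sB' i j : B' i j = B' j i by rewrite /B' sB [B i n * _]mulrC.
have pB' y : (exists2 i, (i < n)%N & y i != 0) -> 0 < quadratic n B' y.
  move=> [i i_n yi].
  (* the choice of the last variable that makes the completed square vanish *)
  pose y' j := if j == n then - \sum_(i < n) B i n / B n n * y i else y j.
  have yE j : (j < n)%N -> y' j = y j by move=> jn; rewrite /y' ltn_eqF.
  have := pB y'; rewrite quadraticS//.
  have -> : y' n + \sum_(i < n) B i n / B n n * y' i = 0.
    rewrite {1}/y' eqxx addrC; apply/eqP; rewrite subr_eq0; apply/eqP.
    by apply: eq_bigr => j _; rewrite yE.
  rewrite expr0n mulr0 add0r.
  have -> : quadratic n B' y = quadratic n B' y'.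
    by apply: eq_bigr => j _; apply: eq_bigr => j' _; rewrite !yE.
  by apply; exists i; [exact: ltnW|rewrite yE].
have [k0 [kap [nu [k00 k01 k0k QE]]]] := IH _ sB' pB'.
pose s := Num.sqrt (B n n).
have s0 : 0 < s by rewrite sqrtr_gt0.
exists (Num.min k0 s), (fun i => if i == n then s else kap i),
  (fun i j => if j == n then B i n / B n n else nu i j).
split.
- by rewrite lt_min k00.
- by rewrite ge_min k01.
- by move=> i; case: ifP => _; rewrite ge_min ?lexx ?orbT ?k0k.
move=> y; rewrite quadraticS// -/B' QE big_ord_recr/= eqxx addrC exprMn sqr_sqrtr ?(ltW b0)//.
congr (_ + _); apply: eq_bigr => j _; rewrite ltn_eqF//.
Qed.

(** The Gram matrix of the rows of an invertible matrix is positive definite. *)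
Lemma norm_cholesky d (g : 'M[R]_d) : g \in unitmx ->
  exists (k0 : R) (kap : nat -> R) (nu : nat -> nat -> R),
    [/\ 0 < k0, k0 <= 1, forall i, k0 <= kap i & forall y,
    \sum_(k < d) ((\row_(i < d) y i) *m g) 0 k ^+ 2 =
    \sum_(j < d) (kap j * (y j + \sum_(i < j) nu i j * y i)) ^+ 2].
Proof.
case: d g => [|d] g gu.
  exists 1, (fun=> 1), (fun _ _ => 0); split => // y.
  by rewrite !big_ord0.
pose B i j := \sum_(k < d.+1) g (inord i) k * g (inord j) k.
have QE y : quadratic d.+1 B y = \sum_(k < d.+1) ((\row_(i < d.+1) y i) *m g) 0 k ^+ 2.
  under [RHS]eq_bigr => k _.
    rewrite mxE expr2 mulr_suml; under eq_bigr do rewrite mulr_sumr.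
    over.
  rewrite exchange_big/=; apply: eq_bigr => i _.
  rewrite exchange_big/=; apply: eq_bigr => j _.
  rewrite /B !inord_val !mulr_suml; apply: eq_bigr => k _; rewrite !mxE.
  ring.
have [||k0 [kap [nu [h1 h2 h3 h4]]]] := @cholesky d.+1 B; last first.
- by exists k0, kap, nu; split => // y; rewrite -h4 QE.
- move=> y [i i_n yi]; rewrite QE lt_neqAle sumr_ge0 ?andbT; last by move=> k _; exact: sqr_ge0.
  rewrite eq_sym psumr_neq0; last by move=> k _; exact: sqr_ge0.
  apply/hasP; apply: contrapT => h.
  have z : (\row_(i < d.+1) y i) *m g = 0.
    apply/rowP => k; apply: contrapT => zk; apply: h; exists k; first exact: mem_index_enum.
    rewrite /= exprn_even_gt0//=; apply/eqP => e; apply: zk; rewrite e; exact/esym/mxE.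
  have : \row_(i < d.+1) y i = 0 by rewrite -[LHS](mulmxK gu) z mul0mx.
  by move=> /rowP/(_ (Ordinal i_n)); rewrite !mxE/= => e; rewrite e eqxx in yi.
- by move=> i j; apply: eq_bigr => k _; rewrite mulrC.
Qed.

End cholesky.

(** * The lattice points in unipotent coordinates *)

Section unipotent_tree.
Variable R : realType.
Variable nu : nat -> nat -> R.
Implicit Types (kap sft : nat -> R) (x : seq R) (n p : seq int) (T : R).

(** Column j of the unipotent matrix with the entries x, read along the rows i < j. *)
Definition column x j (i : nat) : R := nth 0 x ('C(j, 2) + i).

(** Coordinate j of n u + sft, where u is the unipotent matrix with the entries x. *)
Definition coord x sft n j : R :=
  (nth 0 (rev n) j)%:~R + \sum_(i < j) (nth 0 (rev n) i)%:~R * column x j i + sft j.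

(** The part of the next square that is fixed by the earlier coordinates: the next
    coordinate without its own integer, and the cross terms of the quadratic form. *)
Definition offset x sft n : R := let k := size n in
  dot n (column x k) + sft k + \sum_(i < k) nu i k * coord x sft n i.

Lemma coord_cons x sft (m : int) n j : (j < size n)%N ->
  coord x sft (m :: n) j = coord x sft n j.
Proof.
move=> jn; rewrite /coord rev_cons nth_rcons size_rev jn; congr (_ + _ + _).
by apply: eq_bigr => i _; rewrite nth_rcons size_rev (ltn_trans _ jn).
Qed.

Lemma coord_head x sft (m : int) n :
  coord x sft (m :: n) (size n) = m%:~R + (dot n (column x (size n)) + sft (size n)).
Proof.
rewrite /coord rev_cons nth_rcons size_rev ltnn eqxx -addrA; congr (_ + (_ + _)).
by apply: eq_bigr => i _; rewrite nth_rcons size_rev ltn_ord.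
Qed.

Lemma slack_offset kap x sft T n : slack kap (offset x sft) T n =
  T ^+ 2 - \sum_(j < size n)
    (kap j * (coord x sft n j + \sum_(i < j) nu i j * coord x sft n i)) ^+ 2.
Proof.
elim: n => [|m n IH]; first by rewrite big_ord0 subr0.
rewrite -[LHS]/(slack _ _ _ n - _ ^+ 2) IH big_ord_recr/= [in RHS]opprD [in RHS]addrA.
congr (_ - _ - (_ ^+ 2)%R).
  apply: eq_bigr => j _; rewrite coord_cons//; congr ((_ * (_ + _)) ^+ 2).
  by apply: eq_bigr => i _; rewrite coord_cons// (ltn_trans (ltn_ord i)).
rewrite coord_head /offset -!addrA; congr (_ * (_ + (_ + (_ + _)))).
by apply: eq_bigr => i _; rewrite coord_cons.
Qed.

Lemma homogeneous_offset x : homogeneous (offset x (fun=> 0)).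
Proof.
move=> a n; have cE j : coord x (fun=> 0) (map ( *%R a) n) j = a%:~R * coord x (fun=> 0) n j.
  have nE i : (nth 0 (rev (map ( *%R a) n)) i)%:~R = a%:~R * (nth 0 (rev n) i)%:~R :> R.
    rewrite -map_rev -intrM; congr (_%:~R).
    have [h|h] := ltnP i (size (rev n)); first by rewrite (nth_map 0).
    by rewrite !nth_default ?size_map ?mulr0.
  rewrite /coord nE !addr0 mulrDr mulr_sumr; congr (_ + _).
  by apply: eq_bigr => i _; rewrite nE mulrA.
rewrite /offset dot_map size_map !addr0 mulrDr [X in _ = _ + X]mulr_sumr; congr (_ + _).
by apply: eq_bigr => i _; rewrite cE mulrCA.
Qed.

Lemma coord_cat x s sft n j : size x = 'C(j, 2) -> forall i, (i < j)%N ->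
  coord (x ++ s) sft n i = coord x sft n i.
Proof.
move=> sx i ij; rewrite /coord; congr (_ + _ + _); apply: eq_bigr => k _.
rewrite /column nth_cat ifT// sx (@leq_trans 'C(i.+1, 2))//; last exact: leq_bin2l.
by rewrite binS bin1 ltn_add2l.
Qed.

(** The next offset depends on the next column only through the linear form n. *)
Lemma offset_column s x sft n : size s = 'C(size n, 2) ->
  offset (s ++ x) sft n = dot n (nth 0 x) +
    (sft (size n) + \sum_(i < size n) nu i (size n) * coord s sft n i).
Proof.
move=> ss; rewrite /offset -addrA; congr (_ + (_ + _)).
  by apply: eq_dot => i _; rewrite /column nth_cat ss ltnNge leq_addr/= addKn.
by apply: eq_bigr => i _; rewrite (coord_cat _ _ _ ss).
Qed.

Lemma offset_cat s x sft n j : size s = 'C(j, 2) -> (size n < j)%N ->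
  offset (s ++ x) sft n = offset s sft n.
Proof.
move=> ss nj; rewrite /offset; congr (_ + _ + _).
  apply: eq_dot => i i_n; rewrite /column nth_cat ifT// ss.
  apply: (@leq_trans 'C((size n).+1, 2)); last exact: leq_bin2l.
  by rewrite binS bin1 ltn_add2l.
by apply: eq_bigr => i _; rewrite (coord_cat _ _ _ ss)// (ltn_trans (ltn_ord i)).
Qed.

End unipotent_tree.

Section quotient_moment.
Variable R : realType.

Lemma quotient_moment (k0 : R) kap nu d : 0 < k0 -> k0 <= 1 -> (forall i, k0 <= kap i) ->
  exists2 C : R, 0 < C & forall T, 2 <= T ->
  (cube_integral 'C(d, 2) (fun x =>
     ((fibre_sum kap (offset nu x (fun=> 0)) T d d - fibre_coef kap d 0 * T ^+ d) ^+ 2)%:E)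
     <= (C * (T ^+ d.-1 * ln T))%:E)%E.
Proof.
move=> k00 k01 k0k.
have [C C0 CP] := iterated_moment k00 k01 k0k
  (homogeneous_offset nu) (fun s u n => @offset_column _ nu s u (fun=> 0) n)
  (fun s u n j => @offset_cat _ nu s u (fun=> 0) n j) (leqnn d).
exists C => // T T2; have T0 : 0 < T by lra.
have := CP T 1 0 T2 ler01 (lexx 0).
rewrite mul1r addr0; apply: le_trans.
under [X in iter_integral _ X]eq_fun do rewrite mul1r addr0 fibre_sum0//.
by apply: cube_integral_le_iter => s; rewrite lee_fin sqr_ge0.
Qed.

End quotient_moment.

(** * Volumes of balls *)

Section affine.
Local Open Scope ereal_scope.
Variable R : realType.
Local Notation mu := (@lebesgue_measure R).
Local Notation RM := (measurableTypeR R).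

Definition affine n (c : R) (v : nat -> R) (t : n.-tuple RM) : n.-tuple RM :=
  [tuple (c * tnth t i + v i)%R | i < n].

Lemma affine_cons n c v (x : RM) (t : n.-tuple RM) :
  affine c v [tuple of x :: t] =
  [tuple of (c * x + v 0%N)%R :: affine c (fun i => v i.+1) t].
Proof.
apply: eq_from_tnth => i; rewrite tnth_mktuple.
by have [j ->|->] := unliftP ord0 i; rewrite ?tnthS ?tnth_mktuple.
Qed.

Lemma measurable_affine n c v : measurable_fun [set: n.-tuple RM] (@affine n c v).
Proof.
apply/measurable_fun_tnthP => i.
rewrite (_ : _ \o _ = fun t : n.-tuple RM => (c * tnth t i + v i)%R : RM).
  by apply: measurable_funD => //; apply: measurable_funM => //; exact: measurable_tnth.
by apply/funext => t /=; rewrite tnth_mktuple.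
Qed.

Lemma integral_affine n (c : R) (v : nat -> R) (f : n.-tuple RM -> \bar R) : (0 < c)%R ->
  measurable_fun setT f -> (forall x, 0 <= f x) ->
  \int[lebesgue_tuple R n]_t f (affine c v t) =
  (c^-1 ^+ n)%:E * \int[lebesgue_tuple R n]_t f t.
Proof.
move=> c0; elim: n v f => [|n IH] v f mf f0.
  rewrite expr0 mul1e; apply: eq_integral => t _; congr (f _).
  by rewrite [LHS]tuple0 [RHS]tuple0.
have mfa : measurable_fun setT (fun t : n.+1.-tuple RM => f (affine c v t)).
  exact: (measurableT_comp mf (@measurable_affine n.+1 c v)).
rewrite !tonelli_tuple//.
have mcons (x : RM) : measurable_fun setT (fun t : n.-tuple RM => f [tuple of x :: t]).
  apply: (measurableT_comp mf); exact: measurable_cons.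
under eq_integral => x _.
  under eq_integral do rewrite affine_cons.
  rewrite (IH _ (fun t => f [tuple of (c * x + v 0%N)%R :: t]))//.
  over.
pose g (x : RM) := \int[lebesgue_tuple R n]_t f [tuple of x :: t].
have g0 x : 0 <= g x by apply: integral_ge0.
have mg : measurable_fun setT g.
  pose h (p : RM * n.-tuple RM) := f (pair_cons p).
  have mh : measurable_fun setT h by exact: (measurableT_comp mf (@measurable_pair_cons R n)).
  exact: (@measurable_fun_fubini_tonelli_F _ _ _ _ _ (lebesgue_tuple R n) h mh (fun p => f0 _)).
have mphi : measurable_fun [set: RM] (fun x : RM => (c * x + v 0%N)%R : RM).
  by apply: measurable_funD => //; exact: measurable_funM.
have mg' : measurable_fun setT (fun x : RM => g (c * x + v 0%N)%R).
  exact: (measurableT_comp mg mphi).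
have ci0 : (0 <= c^-1 ^+ n)%R by rewrite exprn_ge0// invr_ge0 ltW.
rewrite -[LHS]/(\int[mu]_x ((c^-1 ^+ n)%:E * g (c * x + v 0%N)%R)).
rewrite (@ge0_integralZl_EFin _ _ _ _ _ measurableT _ (fun x _ => g0 _) mg' _ ci0).
by rewrite (integral_affine1 (v 0%N) c0 mg g0) muleA -EFinM -exprSr.
Qed.

End affine.

Section counting.

Lemma card_set_seq (T : choiceType) (s : seq T) : uniq s -> #|` fset_set [set` s]| = size s.
Proof.
move=> us; have -> : [set` s] = [set` seq_fset tt s].
  by apply/seteqP; split => x; rewrite /mkset seq_fsetE.
by rewrite set_fsetK size_seq_fset undup_id.
Qed.

Lemma nneseries_mem (R : realType) (s : seq nat) : uniq s ->
  (\sum_(0 <= k <oo) ((k \in s)%:R : R)%:E = (size s)%:R%:E)%E.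
Proof.
move=> us; rewrite nneseries_esumT => [|k]; last by rewrite lee_fin.
rewrite -(@card_set_seq _ s)// -finite_card_sum; last exact: finite_seq.
rewrite [RHS]esum_mkcond; apply: eq_esum => k _.
have -> : (k \in [set` s]) = (k \in s) by apply/idP/idP; rewrite inE.
by case: ifP.
Qed.

End counting.

Section volume.
Variables (R : realType) (d : nat).
Local Notation RM := (measurableTypeR R).
Implicit Types (A B F : set 'rV[R]_d) (l v : 'rV[R]_d) (n : seq int).

Definition entries l (i : nat) : R := oapp (l 0) 0 (insub i).

Lemma entriesE l (i : 'I_d) : entries l i = l 0 i.
Proof. by rewrite /entries valK. Qed.

Lemma row_affine c l (t : d.-tuple RM) :
  row_of_tuple (affine c (entries l) t) = c *: row_of_tuple t + l.
Proof. by apply/rowP => i; rewrite !mxE tnth_mktuple entriesE. Qed.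

Lemma measurable_rV_affine c l A : measurable_rV A ->
  measurable_rV [set v | A (c *: v + l)].
Proof.
move=> mA; rewrite /measurable_rV.
rewrite (_ : _ @^-1` _ = @affine R d c (entries l) @^-1` (@row_of_tuple R d @^-1` A)).
  by rewrite -[X in measurable X]setTI; exact: measurable_affine.
by apply/seteqP; split => t /=; rewrite row_affine.
Qed.

Lemma vol_affine c l A : 0 < c -> measurable_rV A ->
  vol [set v | A (c *: v + l)] = ((c^-1 ^+ d)%:E * vol A)%E.
Proof.
move=> c0 mA.
have volE B : measurable_rV B -> vol B =
    (\int[lebesgue_tuple R d]_t (\1_(@row_of_tuple R d @^-1` B) t)%:E)%E.
  by move=> mB; rewrite integral_indic// setIT.
rewrite !volE//; last exact: measurable_rV_affine.
rewrite -(integral_affine (entries l) c0).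
- by apply: eq_integral => t _; rewrite !indicE/=; congr ((nat_of_bool _)%:R%:E);
    apply/idP/idP; rewrite !inE/= row_affine.
- apply/measurable_EFinP; exact: measurable_indic.
- by move=> t; rewrite lee_fin.
Qed.

Lemma measurable_sum_entries (a : 'I_d -> R) :
  measurable_fun [set: d.-tuple RM] (fun t : d.-tuple RM => \sum_i tnth t i * a i : RM).
Proof.
apply: measurable_sum => i; apply: measurable_funM => //; exact: measurable_tnth.
Qed.

Lemma mem_euclidean_ball T v : 0 < T ->
  euclidean_ball T v <-> \sum_i v 0 i ^+ 2 < T ^+ 2.
Proof.
move=> T0; rewrite /euclidean_ball /euclidean_norm /=.
have s0 : 0 <= \sum_i v 0 i ^+ 2 by apply: sumr_ge0 => i _; exact: sqr_ge0.
by rewrite -{2}(sqr_sqrtr s0) ltr_pXn2r// nnegrE ?sqrtr_ge0// ltW.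
Qed.

Lemma measurable_euclidean_ball T : 0 < T -> measurable_rV (euclidean_ball T : set 'rV[R]_d).
Proof.
move=> T0; rewrite /measurable_rV.
pose f (t : d.-tuple RM) : RM := \sum_i tnth t i ^+ 2.
rewrite (_ : _ @^-1` _ = [set: d.-tuple RM] `&` f @^-1` `]-oo, T ^+ 2[).
  have mf : measurable_fun setT f.
    by apply: measurable_sum => i; apply: measurable_funX; exact: measurable_tnth.
  by apply: mf => //; exact: measurable_itv.
rewrite setTI; apply/seteqP; split => t /=; rewrite in_itv/=.
  by move=> /(mem_euclidean_ball _ T0); rewrite /f; under eq_bigr do rewrite mxE.
by move=> h; apply/(mem_euclidean_ball _ T0); under eq_bigr do rewrite mxE.
Qed.

Lemma vol_ball_scale T : 0 < T ->
  vol (euclidean_ball T : set 'rV[R]_d) = ((T ^+ d)%:E * vol (euclidean_ball 1 : set 'rV[R]_d))%E.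
Proof.
move=> T0; have := vol_affine 0 (_ : 0 < T^-1) (measurable_euclidean_ball ltr01).
rewrite invr_gt0 invrK => <-//; congr (vol _); apply/seteqP; split => v /=.
  move=> /(mem_euclidean_ball _ T0) h; apply/(mem_euclidean_ball _ ltr01).
  under eq_bigr do rewrite addr0 mxE exprMn.
  by rewrite -mulr_sumr exprVn ltr_pdivrMl ?exprn_gt0// expr1n mulr1.
move=> /(mem_euclidean_ball _ ltr01); under eq_bigr do rewrite addr0 mxE exprMn.
rewrite -mulr_sumr exprVn ltr_pdivrMl ?exprn_gt0// expr1n mulr1 => h.
exact/(mem_euclidean_ball _ T0).
Qed.

Lemma vol_le A B : measurable_rV A -> measurable_rV B -> A `<=` B -> (vol A <= vol B)%E.
Proof. by move=> mA mB AB; apply: le_measure; rewrite ?inE// => t /AB. Qed.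

Definition box (r : R) : set 'rV[R]_d := [set v | forall i, `|v 0 i| < r].

Lemma vol_box r : 0 < r -> measurable_rV (box r) /\ vol (box r) = ((2 * r) ^+ d)%:E.
Proof.
move=> r0.
have e : @row_of_tuple R d @^-1` box r =
    [set t | forall i, (`](- r), r[%classic : set RM) (tnth t i)].
  by apply/seteqP; split => t /= h i; have := h i; rewrite in_itv/= mxE ltr_norml.
split.
  rewrite /measurable_rV e.
  rewrite (_ : mkset _ = \bigcap_(i in [set: 'I_d])
      ((fun t : d.-tuple RM => tnth t i) @^-1` `](- r), r[)).
    apply: fin_bigcap_measurable => // i _; rewrite -[X in measurable X]setTI.
    exact: measurable_tnth.
  by apply/seteqP; split => t /= ht i; [move=> _; exact: ht|exact: ht].
have := @lebesgue_tuple_box R d (fun=> `](- r), r[%classic) (fun=> measurable_itv _).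
rewrite /vol e => ->.
under eq_bigr => i _.
  rewrite lebesgue_measure_itv/= lte_fin ifT; last by lra.
  rewrite -EFinB opprK -[r + r]/(r *+ 2) -mulr_natl.
  over.
by rewrite prodEFin prodr_const card_ord.
Qed.

(** The ball contains a box and is contained in another. *)
Lemma vol_unit_ball : exists2 w : R, 0 < w & vol (euclidean_ball 1 : set 'rV[R]_d) = w%:E.
Proof.
have mb := measurable_euclidean_ball ltr01.
have [m1 v1] := vol_box ltr01.
pose r : R := (d.+1%:R)^-1; have r0 : 0 < r by rewrite invr_gt0.
have [m2 v2] := vol_box r0.
have lo : (vol (box r) <= vol (euclidean_ball 1 : set 'rV[R]_d))%E.
  apply: vol_le => // v vr; apply/(mem_euclidean_ball _ ltr01).
  apply: (@le_lt_trans _ _ (\sum_(i < d) r ^+ 2)).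
    apply: ler_sum => i _; rewrite -real_normK ?num_real// lerXn2r ?nnegrE ?(ltW r0)//.
    exact/ltW/vr.
  rewrite sumr_const card_ord expr1n -mulr_natl /r expr2 mulrA.
  have h0 : d%:R / d.+1%:R < 1 :> R by rewrite ltr_pdivrMr// mul1r ltr_nat.
  have h1 : (d.+1%:R)^-1 <= 1 :> R by rewrite invf_le1// ler1n.
  have h2 : 0 <= d%:R / d.+1%:R :> R by rewrite divr_ge0.
  by apply: le_lt_trans (ler_piMr h2 h1) h0.
have hi : (vol (euclidean_ball 1 : set 'rV[R]_d) <= vol (box 1))%E.
  apply: vol_le => // v /(mem_euclidean_ball _ ltr01) h i.
  rewrite -(ltr_pXn2r (n := 2))// ?nnegrE// real_normK ?num_real//.
  apply: le_lt_trans h; rewrite (bigD1 i)//= lerDl.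
  by apply: sumr_ge0 => j _; exact: sqr_ge0.
move: lo hi; rewrite v1 v2; case: (vol (euclidean_ball 1)) => [w| |]//=.
rewrite lee_fin => lo _; exists w => //; apply: lt_le_trans lo.
by rewrite exprn_gt0// mulr_gt0.
Qed.

End volume.

(** * Lattice point counts determine the covolume *)

Section covolume.
Variables (R : realType) (d : nat).
Local Notation RM := (measurableTypeR R).
Implicit Types (A B F : set 'rV[R]_d) (l v : 'rV[R]_d) (n : seq int).

Definition lattice_vec n : 'rV[R]_d := \row_(i < d) (nth 0 (rev n) i)%:~R.

Lemma lattice_vecE (z : 'rV[int]_d) :
  lattice_vec (rev [seq z 0 i | i <- enum 'I_d]) = map_mx intr z.
Proof.
apply/rowP => i; rewrite !mxE revK (nth_map i) ?size_enum_ord//.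
by rewrite nth_ord_enum.
Qed.

Lemma lattice_vec_inj n m : size n = d -> size m = d ->
  lattice_vec n = lattice_vec m -> n = m.
Proof.
move=> sn sm e; rewrite -[n]revK -[m]revK; congr rev.
apply: (@eq_from_nth _ 0); rewrite !size_rev ?sn ?sm// => i i_d.
move/rowP : e => /(_ (Ordinal i_d)); rewrite !mxE/= => /eqP.
by rewrite eqr_int => /eqP.
Qed.

Variable h : 'M[R]_d.
Hypothesis hu : h \in unitmx.

Lemma lattice_ofP l : lattice_of h l <-> exists2 n, size n = d & l = lattice_vec n *m h.
Proof.
split=> [[z _ <-]|[n sn ->]].
  exists (rev [seq z 0 i | i <- enum 'I_d]); last by rewrite lattice_vecE.
  by rewrite size_rev size_map size_enum_ord.
exists (\row_(i < d) nth 0 (rev n) i) => //; congr (_ *m h).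
by apply/rowP => i; rewrite !mxE.
Qed.

Lemma lattice_mulmx_inj n m : size n = d -> size m = d ->
  lattice_vec n *m h = lattice_vec m *m h -> n = m.
Proof.
move=> sn sm e; apply: lattice_vec_inj => //.
by rewrite -[LHS](mulmxK hu) e mulmxK.
Qed.

(** Unfolding: the translates of F by lattice vectors cut B into pieces.  Moved back into
    F, these pieces cover a point v as many times as the translate of the lattice by v
    meets B. *)
Lemma vol_fundamental_domain F B (s : 'rV[R]_d -> seq (seq int)) :
  fundamental_domain (lattice_of h) F -> measurable_rV B ->
  (forall v, uniq (s v)) ->
  (forall v n, (n \in s v) <-> size n = d /\ B (v + lattice_vec n *m h)) ->
  vol B = (\int[lebesgue_tuple R d]_(t in @row_of_tuple R d @^-1` F)
    (size (s (row_of_tuple t)))%:R%:E)%E.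
Proof.
move=> [mF tileF] mB us sP.
pose mu := lebesgue_tuple R d; pose L n := lattice_vec n *m h.
(* the lattice vectors are numbered, in order to sum over them as a series *)
pose code (n : seq int) : nat := choice.pickle n.
pose E (k : nat) : set 'rV[R]_d := if choice.pickle_inv k is Some n then
  [set v | size n = d /\ F (v - L n) /\ B v] else set0.
pose D (k : nat) : set 'rV[R]_d := [set v | k \in map code (s v)].
have EP k v : E k v <-> exists2 n, code n = k & size n = d /\ F (v - L n) /\ B v.
  rewrite /E; split.
    case e : (choice.pickle_inv k) => [n|//] h'; exists n => //.
    by have := @choice.pickle_invK (seq int) k; rewrite e.
  by move=> [n <-]; rewrite choice.pickleK_inv.
have DP k v : D k v <-> exists2 n, code n = k & size n = d /\ B (v + L n).
  rewrite /D /=; split=> [/mapP[n /sP nP ->]|[n <- /sP nP]]; first by exists n.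
  exact: map_f.
have affE l A : [set v | A (1 *: v + l)] = [set v | A (v + l)].
  by apply/seteqP; split => v /=; rewrite scale1r.
have mshift l A : measurable_rV A -> measurable_rV [set v | A (v + l)].
  by move=> mA; rewrite -affE; exact: measurable_rV_affine.
have vshift l A : measurable_rV A -> vol [set v | A (v + l)] = vol A.
  by move=> mA; rewrite -affE vol_affine// invr1 expr1n mul1e.
have pinj n m k : code n = k -> code m = k -> n = m :> seq int.
  by move=> <- /esym/(pcan_inj choice.pickleK_inv).
have cases k : (exists2 n, size n = d & code n = k) \/
    E k = set0 /\ D k = set0.
  have [[n sn nk]|nex] := pselect (exists2 n : seq int, size n = d & code n = k).
    by left; exists n.
  right; split; apply/seteqP; split => v //.
    by move=> /EP[n nk [sn _]]; case: nex; exists n.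
  by move=> /DP[n nk [sn _]]; case: nex; exists n.
have EE n k : size n = d -> code n = k -> E k = [set v | F (v - L n)] `&` B.
  move=> sn nk; apply/seteqP; split => v.
    by move=> /EP[m mk [_]]; rewrite (pinj _ _ _ nk mk).
  by move=> h'; apply/EP; exists n.
have DE n k : size n = d -> code n = k -> D k = [set v | B (v + L n)].
  move=> sn nk; apply/seteqP; split => v.
    by move=> /DP[m mk [_]]; rewrite (pinj _ _ _ nk mk).
  by move=> h'; apply/DP; exists n.
have m0 : measurable_rV (set0 : set 'rV[R]_d) by rewrite /measurable_rV preimage_set0.
have mE k : measurable_rV (E k).
  have [[n sn nk]|[-> _]//] := cases k.
  by rewrite (EE n k)// /measurable_rV preimage_setI; apply: measurableI => //; exact: mshift.
have mD k : measurable_rV (D k).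
  have [[n sn nk]|[_ ->]//] := cases k.
  by rewrite (DE n k)//; exact: mshift.
have vE k : vol (E k) = (\int[mu]_(t in @row_of_tuple R d @^-1` F)
    ((k \in map code (s (row_of_tuple t)))%:R : R)%:E)%E.
  transitivity (mu (@row_of_tuple R d @^-1` D k `&` @row_of_tuple R d @^-1` F)).
    have [[n sn nk]|[-> ->]] := cases k; last by rewrite /vol !preimage_set0 set0I.
    rewrite -(vshift (L n) _ (mE k)) (EE n k)// (DE n k)//; congr (mu _).
    by apply/seteqP; split => t /= [h1 h2]; split => //; move: h1 h2; rewrite addrK.
  rewrite -(integral_indic mu mF (mD k)); apply: eq_integral => t _; rewrite indicE.
  by congr ((nat_of_bool _)%:R%:E); apply/idP/idP; rewrite inE.
have tE : trivIset [set: nat] (fun k => @row_of_tuple R d @^-1` E k).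
  move=> k k' _ _ [t [/EP[n nk [sn [Fn _]]] /EP[n' nk' [sn' [Fn' _]]]]].
  have [l [_ lu]] := tileF (row_of_tuple t).
  have latL m : size m = d -> lattice_of h (L m) by move=> sm; apply/lattice_ofP; exists m.
  rewrite -nk -nk'; congr code; apply: lattice_mulmx_inj => //.
  exact: etrans (esym (lu _ (conj (latL _ sn) Fn))) (lu _ (conj (latL _ sn') Fn')).
have cE : \bigcup_k (@row_of_tuple R d @^-1` E k) = @row_of_tuple R d @^-1` B.
  apply/seteqP; split => t /=; first by move=> [k _ /EP[n _ [_ []]]].
  move=> Bt; have [l [[/lattice_ofP[n sn lE] Fl] _]] := tileF (row_of_tuple t).
  by exists (code n) => //; apply/EP; exists n => //; rewrite /L -lE.
transitivity (\sum_(0 <= k <oo) vol (E k))%E.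
  by rewrite /vol -cE; apply: measure_semi_bigcup => //; rewrite cE.
have mind k : measurable_fun (@row_of_tuple R d @^-1` F : set (d.-tuple RM))
   (fun t => ((k \in map code (s (row_of_tuple t)))%:R : R)%:E).
  rewrite (_ : (fun t => _) = fun t => (\1_(@row_of_tuple R d @^-1` D k) t)%:E).
    by apply/measurable_EFinP; apply: measurable_indic; exact: mD.
  apply/funext => t; rewrite indicE.
  by congr ((nat_of_bool _)%:R%:E); apply/idP/idP; rewrite inE.
rewrite (eq_eseriesr (fun k _ => vE k)) -(integral_nneseries mu mF mind); last first.
  by move=> k t _; rewrite lee_fin.
apply: eq_integral => t _; rewrite nneseries_mem ?size_map//.
by rewrite map_inj_uniq// => n m e; exact: pinj e _.
Qed.

(** The half-open parallelepiped spanned by the rows of h; a point is moved into it by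
    the integral parts of its coordinates. *)
Lemma fundamental_domain_exists : exists F, fundamental_domain (lattice_of h) F.
Proof.
exists [set v | forall i, 0 <= (v *m invmx h) 0 i < 1]; split.
  rewrite /measurable_rV.
  rewrite (_ : _ @^-1` _ = \bigcap_(i in [set: 'I_d])
      ((fun t : d.-tuple RM => \sum_k tnth t k * invmx h k i) @^-1` `[0, 1[)).
    apply: fin_bigcap_measurable => // i _; rewrite -[X in measurable X]setTI.
    exact: measurable_sum_entries.
  have e (t : d.-tuple R) i : (row_of_tuple t *m invmx h) 0 i = \sum_k tnth t k * invmx h k i.
    by rewrite mxE; apply: eq_bigr => k _; rewrite mxE.
  apply/seteqP; split => t /= ht i; first by move=> _; rewrite /= in_itv/= -e.
  by have := ht i Logic.I; rewrite /= in_itv/= -e.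
move=> v; pose w := v *m invmx h; pose z : 'rV[int]_d := \row_i Num.floor (w 0 i).
have cE (z' : 'rV[int]_d) i : ((v - map_mx intr z' *m h) *m invmx h) 0 i = w 0 i - (z' 0 i)%:~R.
  by rewrite mulmxBl mulmxK// !mxE.
exists (map_mx intr z *m h); split.
  split; first by exists z.
  move=> i; rewrite cE (_ : z 0 i = Num.floor (w 0 i)); last by rewrite mxE.
  have /andP[h1] := floor_itv (w 0 i); rewrite intrD => h2.
  by rewrite subr_ge0 h1/= ltrBlDl.
move=> l [[z' _ <-] Fl]; congr (map_mx _ _ *m h); apply/rowP => i; rewrite mxE.
apply: floor_def; have /andP[] := Fl i; rewrite cE subr_ge0 => -> /=.
by rewrite intrD ltrBlDl.
Qed.

(** Integrating the count over a fundamental domain F gives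
    vol (ball T) = vol F * (c T^d + O(T^(d-1))) ([vol_fundamental_domain]).  The left
    side is exactly proportional to T^d, so T -> +oo yields vol F = vol (ball 1) / c,
    the same value for all F. *)
Lemma covolume_of_count (c C : R) (s : R -> 'rV[R]_d -> seq (seq int)) :
  (0 < d)%N -> 0 < c -> 0 < C ->
  (forall T v, uniq (s T v)) ->
  (forall T v n, 0 < T -> (n \in s T v) <->
     size n = d /\ euclidean_ball T (v + lattice_vec n *m h)) ->
  (forall T v, 1 <= T -> `|(size (s T v))%:R - c * T ^+ d| <= C * T ^+ d.-1) ->
  forall T, 0 < T ->
  fine (vol (euclidean_ball T : set 'rV[R]_d)) / covolume (lattice_of h) = c * T ^+ d.
Proof.
move=> d0 c0 C0 us sP sC.
have [w w0 wE] := vol_unit_ball R d.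
have ballE (T : R) : 0 < T -> vol (euclidean_ball T : set 'rV[R]_d) = (w * T ^+ d)%:E.
  by move=> T0; rewrite vol_ball_scale// wE -EFinM mulrC.
have key F : fundamental_domain (lattice_of h) F -> vol F = (w / c)%:E.
  move=> fF; have mF : measurable_rV F by case: fF.
  have vint (T : R) : 0 < T -> ((w * T ^+ d)%:E =
     \int[lebesgue_tuple R d]_(t in @row_of_tuple R d @^-1` F)
    (size (s T (row_of_tuple t)))%:R%:E)%E.
    move=> T0; rewrite -ballE//; apply: vol_fundamental_domain => //.
      exact: measurable_euclidean_ball.
    by move=> v n; exact: sP.
  have bnd (T : R) v : 1 <= T ->
      (c * T - C) * T ^+ d.-1 <= (size (s T v))%:R <= (c * T + C) * T ^+ d.-1.
    move=> T1; have := sC T v T1; rewrite ler_norml.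
    have -> : T ^+ d = T * T ^+ d.-1 by rewrite -exprS prednK.
    rewrite mulrBl mulrDl -[c * T * _]mulrA.
    set x := c * (T * _); set y := C * _; set N := _%:R.
    by move=> /andP[h1 h2]; apply/andP; split; lra.
  (* beyond T0 the lower bound for the count is positive, which excludes vol F = +oo *)
  pose T0 := 1 + C / c.
  have T0P (T : R) : T0 <= T -> 1 <= T /\ C < c * T.
    move=> hT; have h0 : 0 < C / c by rewrite divr_gt0.
    split; first by apply: le_trans hT; rewrite lerDl ltW.
    apply: (@lt_le_trans _ _ (c * T0)); last by rewrite ler_pM2l.
    by rewrite /T0 mulrDr mulr1 mulrCA mulfV ?gt_eqF// mulr1 ltrDr.
  have lower (T : R) : T0 <= T ->
      (((c * T - C) * T ^+ d.-1)%:E * vol F <= (w * T ^+ d)%:E)%E.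
    move=> /T0P[T1 CT]; rewrite vint; last by lra.
    rewrite -integral_cst//; apply: ge0_le_integral_any => t /=; rewrite lee_fin.
      by rewrite mulr_ge0 ?exprn_ge0//; lra.
    by case/andP: (bnd T (row_of_tuple t) T1).
  have upper (T : R) : T0 <= T ->
      ((w * T ^+ d)%:E <= ((c * T + C) * T ^+ d.-1)%:E * vol F)%E.
    move=> /T0P[T1 CT]; rewrite vint; last by lra.
    rewrite -integral_cst//; apply: ge0_le_integral_any => t /=; rewrite lee_fin//.
    by case/andP: (bnd T (row_of_tuple t) T1).
  have V0 : (0 <= vol F)%E by exact: measure_ge0.
  move: V0 lower upper; case: (vol F) => [V| |]// V0 lower upper; last first.
    have := lower _ (lexx T0); rewrite gt0_muley ?lte_fin//.
    have [T1 CT] := T0P _ (lexx T0).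
    by rewrite mulr_gt0 ?exprn_gt0//; lra.
  rewrite lee_fin in V0.
  congr EFin; apply/eqP; rewrite eq_sym -subr_eq0 -normr_eq0 eq_le normr_ge0 andbT leNgt.
  apply/negP => e0; set e := `|_| in e0.
  (* large enough for the error term to fall below the difference e *)
  pose T := T0 + C * (V + 1) / (c * e).
  have TT0 : T0 <= T by rewrite lerDl divr_ge0 ?mulr_ge0//; lra.
  have [T1 CT] := T0P _ TT0.
  have Td : T ^+ d = T * T ^+ d.-1 by rewrite -exprS prednK.
  have p0 : 0 < T ^+ d.-1 by rewrite exprn_gt0//; lra.
  have := lower _ TT0; have := upper _ TT0; rewrite Td -!EFinM !lee_fin.
  rewrite mulrAC [w * _]mulrA ler_pM2r// mulrAC ler_pM2r// => h1 h2.
  have h3 : T * (c * e) <= C * V.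
    have -> : c * e = `|w - c * V|.
      by rewrite /e -{1}(gtr0_norm c0) -normrM; congr `|_|; field; rewrite gt_eqF.
    have [Tp] : 0 < T by lra.
    rewrite -{1}(gtr0_norm Tp) -normrM ler_norml; apply/andP; split; lra.
  have h4 : C * (V + 1) <= T * (c * e).
    rewrite -ler_pdivrMr ?mulr_gt0// /T lerDr /T0.
    by rewrite addr_ge0// divr_ge0// ltW.
  lra.
have covE : covolume (lattice_of h) = w / c.
  rewrite /covolume; have [F fF] := fundamental_domain_exists.
  have -> : [set vol F | F in fundamental_domain (lattice_of h)] = [set (w / c)%:E].
    apply/seteqP; split => x /=; first by move=> [F' fF' <-]; exact: key.
    by move=> ->; exists F => //; exact: key.
  by rewrite ereal_inf1.
move=> T T0; rewrite covE ballE//=; field.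
by rewrite !gt_eqF.
Qed.

End covolume.

(** * The mean square of the discrepancy *)

Section unipotent_lattices.
Variables (R : realType) (d : nat) (g : 'M[R]_d) (kap : nat -> R) (nu : nat -> nat -> R).
Hypothesis gu : g \in unitmx.
Hypothesis kap0 : forall i, 0 < kap i.
Hypothesis normE : forall y : nat -> R,
  \sum_(k < d) ((\row_(i < d) y i) *m g) 0 k ^+ 2 =
  \sum_(j < d) (kap j * (y j + \sum_(i < j) nu i j * y i)) ^+ 2.
Variable x : 'C(d, 2).-tuple R.
Let u := unipotent_of_tuple x.

Lemma unipotent_unitmx : u \in unitmx.
Proof.
rewrite unitmxE -det_tr det_trig.
  by rewrite big1 ?unitr1// => i _; rewrite !mxE eqxx.
apply/is_trig_mxP => i j ij; rewrite !mxE -val_eqE/= gtn_eqF// ltnNge.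
by rewrite (ltnW ij).
Qed.

Lemma unipotent_mulmx_unit : u *m g \in unitmx.
Proof. by rewrite unitmx_mul unipotent_unitmx. Qed.

Lemma coord_lattice_vec v n : size n = d ->
  (\row_(j < d) coord x (entries (v *m invmx g)) n j) *m g =
  v + lattice_vec R d n *m (u *m g).
Proof.
move=> sn; rewrite mulmxA -[v in RHS](mulmxKV gu) -mulmxDl; congr (_ *m g).
apply/rowP => j; rewrite mxE /coord entriesE [RHS]mxE addrC; congr (_ + _); rewrite mxE.
rewrite (bigD1 j)//= !mxE eqxx mulr1; congr (_ + _).
rewrite (bigID (fun i : 'I_d => (i < j)%N))/= [X in _ + X]big1 ?addr0; last first.
  move=> i /andP[ij ji]; rewrite !mxE (negbTE ij) (negbTE ji) mulr0//.
rewrite (big_ord_widen_cond d xpredT (fun i => (nth 0 (rev n) i)%:~R * column x j i)); last exact/ltnW.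
apply: eq_big => [i|i /= ij]; last first.
  by rewrite !mxE -val_eqE/= ltn_eqF// ij.
by rewrite -val_eqE/=; case: ltngtP.
Qed.

Lemma mem_tree_ball T v n : 0 < T ->
  n \in tree kap (offset nu x (entries (v *m invmx g))) T d <->
  size n = d /\ euclidean_ball T (v + lattice_vec R d n *m (u *m g)).
Proof.
move=> T0; rewrite mem_tree//.
have E : size n = d -> 0 < slack kap (offset nu x (entries (v *m invmx g))) T n <->
    euclidean_ball T (v + lattice_vec R d n *m (u *m g)).
  move=> sn; rewrite slack_offset sn -normE coord_lattice_vec// subr_gt0.
  by rewrite mem_euclidean_ball.
split=> [/andP[/eqP sn /(E sn)]//|[sn /(E sn) ->]].
by rewrite sn eqxx.
Qed.

End unipotent_lattices.

Theorem theorem1 (R : realType) (d : nat) (hd : (2 <= d)%N)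
    (g : 'M[R]_d) (hg : g \in unitmx) :
  exists c : R, 0 < c /\
    forall T : R, 2 <= T ->
      (unipotent_quotient_integral
         (fun u : 'M[R]_d =>
            ((`|ball_discrepancy T (lattice_of (u *m g))| ^+ 2)%R)%:E)
       <= (c * T ^+ d.-1 * ln T ^+ 2)%R%:E)%E.
Proof.
have [k0 [kap [nu [k00 k01 k0k normE]]]] := norm_cholesky hg.
have kap0 i : 0 < kap i by exact: lt_le_trans (k0k i).
have [C C0 CP] := quotient_moment nu d k00 k01 k0k.
have [D D0 DP] := fibre_sum_dist k00 k0k (leqnn d).
have ln2 : 0 < ln (2 : R) by rewrite ln_gt0//; lra.
exists (C / ln 2); split; first by rewrite divr_gt0.
move=> T T2; have T0 : 0 < T by lra.
have d0 : (0 < d)%N by apply: leq_trans hd.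
have c0 := fibre_coef_gt0 d 0 kap0.
have discE (x : 'C(d, 2).-tuple R) :
    ball_discrepancy T (lattice_of (unipotent_of_tuple x *m g)) =
    fibre_sum kap (offset nu x (fun=> 0)) T d d - fibre_coef kap d 0 * T ^+ d.
  pose s T v := tree kap (offset nu x (entries (v *m invmx g))) T d.
  have hu := unipotent_mulmx_unit hg x.
  have sP (T' : R) v n : 0 < T' -> (n \in s T' v) <->
     size n = d /\ euclidean_ball T' (v + lattice_vec R d n *m (unipotent_of_tuple x *m g)).
    by move=> T'0; exact: mem_tree_ball.
  have us (T' : R) v : uniq (s T' v) by exact: uniq_tree.
  have sD (T' : R) v : 1 <= T' ->
      `|(size (s T' v))%:R - fibre_coef kap d 0 * T' ^+ d| <= D * T' ^+ d.-1.
    move=> T1; have := DP T' (offset nu x (entries (v *m invmx g))) T1.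
    by rewrite fibre_sum_full fibre_sum0//; lra.
  rewrite /ball_discrepancy (covolume_of_count hu d0 c0 D0 us sP sD T0).
  congr (_ - _); rewrite fibre_sum_full; congr (_%:R).
  have -> : tree kap (offset nu x (fun=> 0)) T d = s T 0.
    apply: eq_tree => n _; congr (offset _ _ _ _); apply/funext => i.
    rewrite /entries mul0mx; by case: insubP => //= j _ _; rewrite mxE.
  pose L n := lattice_vec R d n *m (unipotent_of_tuple x *m g).
  rewrite -(size_map L) -[RHS]card_set_seq; last first.
    rewrite map_inj_in_uniq// => n m /(sP _ _ _ T0)[sn _] /(sP _ _ _ T0)[sm _].
    exact: lattice_mulmx_inj.
  congr (#|` fset_set _|); apply/seteqP; split => v /=.
    move=> [/lattice_ofP[n sn ->] nB]; apply/mapP; exists n => //.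
    by apply/(sP _ _ _ T0); rewrite add0r.
  move=> /mapP[n /(sP _ _ _ T0)[sn]]; rewrite add0r => nB ->; split => //.
  by apply/lattice_ofP; exists n.
rewrite /unipotent_quotient_integral.
under eq_integral do rewrite real_normK ?num_real// discE.
apply: le_trans (CP T T2) _; rewrite lee_fin.
have T1 : 0 <= T ^+ d.-1 by rewrite exprn_ge0// ltW.
have lnT : ln 2 <= ln T by rewrite ler_ln ?posrE.
rewrite -subr_ge0.
have -> : C / ln 2 * T ^+ d.-1 * ln T ^+ 2 - C * (T ^+ d.-1 * ln T) =
  (C / ln 2) * T ^+ d.-1 * ln T * (ln T - ln 2) by field; rewrite gt_eqF.
rewrite mulr_ge0 ?subr_ge0// mulr_ge0//; last by lra.
by rewrite mulr_ge0// divr_ge0 ?ltW.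
Qed.
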